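(* Let $X$ and $Y$ be finite spaces over $k$. If $X$ and $Y$ are schematic (resp. semi-separated), then $X\times_kY$ is schematic (resp. semi-separated).
   Context: All rings are commutative with unit. A ringed finite space is a ringed space $(X,\mathcal O)$ with $X$ a finite topological space. For $p\in X$, $U_p$ is the smallest open subset containing $p$; $p\le q$ means $q\in U_p$. The stalk is $\mathcal O_p=\mathcal O(U_p)$, with restriction morphisms $\mathcal O_p\to\mathcal O_q$ for $p\le q$. A finite space is a ringed finite space all of whose restriction morphisms are flat. An $\mathcal O$-module is quasi-coherent if it is locally a cokernel of a morphism between free modules of arbitrary rank. $k$ is a commutative base ring; spaces and morphisms are over the one-point ringed space $( *,k)$. $X\times_kY$ is the product topological space with $\mathcal O_{(x,y)}=\mathcal O_x\otimes_k\mathcal O_y$. Let $\delta\colon X\to X\times_kX$ be the diagonal morphism. A finite space $X$ is schematic if $R^i\delta_*\mathcal O$ is quasi-coherent for all $i\ge0$; it is semi-separated if $\delta_*\mathcal O$ is quasi-coherent and $R^i\delta_*\mathcal O=0$ for $i>0$ (these notions do not depend on $k$). *)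

(* Defs.v *)
From HB Require Import structures.
From mathcomp Require Import all_boot all_algebra all_classical.

Set Implicit Arguments.
Unset Strict Implicit.
Unset Printing Implicit Defensive.

Import GRing.Theory.
Local Open Scope ring_scope.
Local Open Scope quotient_scope.

(* [M (x)_R N] is built as finite formal sums of pairs [(a, b)] modulo the
   congruence generated by bilinearity and [r a (x) b = a (x) r b].  Formal
   sums with natural number coefficients suffice, since [(- a, b)] is an
   opposite of [(a, b)].  Only the scaling operations of [R] on [M] and [N] are
   parameters: they come from a module structure or from a ring morphism. *)
Section Tensor.
Variables (R : Type) (M N : zmodType) (sM : R -> M -> M) (sN : R -> N -> N).

Inductive tensor_eq : seq (M * N) -> seq (M * N) -> Prop :=
| tensor_eq_refl s : tensor_eq s s
| tensor_eq_sym s t : tensor_eq s t -> tensor_eq t s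
| tensor_eq_trans t s u : tensor_eq s t -> tensor_eq t u -> tensor_eq s u
| tensor_eq_cat s s' t t' :
    tensor_eq s s' -> tensor_eq t t' -> tensor_eq (s ++ t) (s' ++ t')
| tensor_eq_comm s t : tensor_eq (s ++ t) (t ++ s)
| tensor_eq_0l b : tensor_eq [:: (0, b)] [::]
| tensor_eq_0r a : tensor_eq [:: (a, 0)] [::]
| tensor_eq_Dl a a' b : tensor_eq [:: (a + a', b)] [:: (a, b); (a', b)]
| tensor_eq_Dr a b b' : tensor_eq [:: (a, b + b')] [:: (a, b); (a, b')]
| tensor_eq_bal r a b : tensor_eq [:: (sM r a, b)] [:: (a, sN r b)].

Definition tensor_rel (s t : seq (M * N)) : bool := `[< tensor_eq s t >].

Lemma tensor_rel_refl : reflexive tensor_rel.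
Proof. by move=> s; apply/asboolP; exact: tensor_eq_refl. Qed.

Lemma tensor_rel_sym : symmetric tensor_rel.
Proof.
by move=> s t; apply/asboolP/asboolP => h; exact: tensor_eq_sym.
Qed.

Lemma tensor_rel_trans : transitive tensor_rel.
Proof.
move=> t s u /asboolP h /asboolP h'; apply/asboolP.
exact: tensor_eq_trans h h'.
Qed.

Canonical tensor_equiv :=
  EquivRel tensor_rel tensor_rel_refl tensor_rel_sym tensor_rel_trans.

Definition tensor := {eq_quot tensor_equiv}.

HB.instance Definition _ := Choice.on tensor.

Lemma tensor_piP s t :
  \pi_{eq_quot tensor_equiv} s = \pi_{eq_quot tensor_equiv} t <->
  tensor_eq s t.
Proof.
split=> [/eqquotP /asboolP //|h]; apply/eqquotP; exact/asboolP.
Qed.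

Lemma tensor_reprP s : tensor_eq (repr (\pi_{eq_quot tensor_equiv} s)) s.
Proof. by apply/tensor_piP; rewrite reprK. Qed.

Definition tensor_pi (s : seq (M * N)) : tensor := \pi_{eq_quot tensor_equiv} s.
Definition tensor_zero : tensor := tensor_pi [::].
Definition tensor_add (x y : tensor) : tensor := tensor_pi (repr x ++ repr y).
Definition tensor_opp (x : tensor) : tensor :=
  tensor_pi [seq (- a.1, a.2) | a <- repr x].

Lemma tensor_piK (x : tensor) : tensor_pi (repr x) = x.
Proof. exact: reprK. Qed.

Lemma tensor_pi_eq s t : tensor_eq s t -> tensor_pi s = tensor_pi t.
Proof. by move=> h; apply/tensor_piP. Qed.

Lemma tensor_add_pi s t :
  tensor_add (tensor_pi s) (tensor_pi t) = tensor_pi (s ++ t).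
Proof. by apply: tensor_pi_eq; apply: tensor_eq_cat; exact: tensor_reprP. Qed.

Lemma tensor_addA : associative tensor_add.
Proof.
move=> x y z; rewrite -(tensor_piK x) -(tensor_piK y) -(tensor_piK z).
by rewrite !tensor_add_pi catA.
Qed.

Lemma tensor_addC : commutative tensor_add.
Proof. by move=> x y; apply: tensor_pi_eq; exact: tensor_eq_comm. Qed.

Lemma tensor_add0 : left_id tensor_zero tensor_add.
Proof. by move=> x; rewrite -(tensor_piK x) tensor_add_pi. Qed.

Lemma tensor_addN : left_inverse tensor_zero tensor_opp tensor_add.
Proof.
move=> x; rewrite /tensor_opp -{2}(tensor_piK x) tensor_add_pi.
elim: (repr x) => [//|[a b] s IHs] /=.
rewrite -cat1s -[(a, b) :: s]cat1s catA.
have h : tensor_eq (([:: (- a, b)] ++ [seq (- c.1, c.2) | c <- s])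
                    ++ [:: (a, b)])
                   [seq (- c.1, c.2) | c <- s].
  apply: (tensor_eq_trans (tensor_eq_comm _ _)); rewrite catA.
  apply: (tensor_eq_trans (t := [::] ++ _)); last exact: tensor_eq_refl.
  apply: tensor_eq_cat; last exact: tensor_eq_refl.
  apply: (tensor_eq_trans (tensor_eq_sym (tensor_eq_Dl _ _ _))).
  by rewrite subrr; exact: tensor_eq_0l.
rewrite -IHs catA; apply: tensor_pi_eq; apply: tensor_eq_cat => //.
exact: tensor_eq_refl.
Qed.

HB.instance Definition _ := GRing.isZmodule.Build tensor
  tensor_addA tensor_addC tensor_add0 tensor_addN.

Lemma tensor_piD s t : tensor_pi (s ++ t) = tensor_pi s + tensor_pi t.
Proof. exact/esym/tensor_add_pi. Qed.

Definition tpure (a : M) (b : N) : tensor := tensor_pi [:: (a, b)].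

Lemma tensor_piE s : tensor_pi s = \sum_(x <- s) tpure x.1 x.2.
Proof.
elim: s => [|[a b] s IHs]; first by rewrite big_nil.
by rewrite big_cons -IHs -tensor_piD.
Qed.

Record balanced (P : zmodType) (f : M -> N -> P) : Prop := Balanced {
  balancedDl : forall a a' b, f (a + a') b = f a b + f a' b;
  balancedDr : forall a b b', f a (b + b') = f a b + f a b';
  balancedZ : forall r a b, f (sM r a) b = f a (sN r b) }.

Lemma balanced_tpure : balanced tpure.
Proof.
split=> [a a' b|a b b'|r a b].
- by rewrite -tensor_piD; apply: tensor_pi_eq; exact: tensor_eq_Dl.
- by rewrite -tensor_piD; apply: tensor_pi_eq; exact: tensor_eq_Dr.
- by apply: tensor_pi_eq; exact: tensor_eq_bal.
Qed.

(* The additive map out of the tensor product induced by [f]; it is only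
   meaningful when [f] is balanced. *)
Definition tlift (P : zmodType) (f : M -> N -> P) (x : tensor) : P :=
  \sum_(a <- repr x) f a.1 a.2.

Section Lift.
Variables (P : zmodType) (f : M -> N -> P).
Hypothesis fb : balanced f.

Lemma balanced0l b : f 0 b = 0.
Proof. by apply: (addrI (f 0 b)); rewrite addr0 -(balancedDl fb) addr0. Qed.

Lemma balanced0r a : f a 0 = 0.
Proof. by apply: (addrI (f a 0)); rewrite addr0 -(balancedDr fb) addr0. Qed.

Lemma tlift_pi s : tlift f (tensor_pi s) = \sum_(a <- s) f a.1 a.2.
Proof.
suff h t u : tensor_eq t u ->
    \sum_(a <- t) f a.1 a.2 = \sum_(a <- u) f a.1 a.2.
  exact: h (tensor_reprP s).
elim=> {s t u}.
- by [].
- by move=> s t _ ->.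
- by move=> t s u _ -> _.
- by move=> s s' t t' _ h _ h'; rewrite !big_cat /= h h'.
- by move=> s t; rewrite !big_cat /= addrC.
- by move=> b; rewrite big_seq1 big_nil balanced0l.
- by move=> a; rewrite big_seq1 big_nil balanced0r.
- by move=> a a' b; rewrite !big_cons !big_nil !addr0 (balancedDl fb).
- by move=> a b b'; rewrite !big_cons !big_nil !addr0 (balancedDr fb).
- by move=> r a b; rewrite !big_seq1 (balancedZ fb).
Qed.

Lemma tlift_tpure a b : tlift f (tpure a b) = f a b.
Proof. by rewrite tlift_pi big_seq1. Qed.

Lemma tliftD : {morph tlift f : x y / x + y}.
Proof.
move=> x y; rewrite -(tensor_piK x) -(tensor_piK y).
by rewrite -tensor_piD !tlift_pi big_cat.
Qed.

End Lift.

Lemma tensor_ind (K : tensor -> Prop) :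
  K 0 -> (forall a b, K (tpure a b)) ->
  (forall x y, K x -> K y -> K (x + y)) -> forall x, K x.
Proof.
move=> K0 Kp KD x; rewrite -(tensor_piK x) tensor_piE.
by elim/big_ind: _ => // a _; exact: Kp.
Qed.

End Tensor.

(* [A (x)_k B], for the [k]-algebras given by the ring morphisms [f] and [g]. *)
Section TensorAlgebra.
Variables (k A B : comPzRingType) (f : {rmorphism k -> A})
  (g : {rmorphism k -> B}).

Definition talg := tensor (fun (c : k) (a : A) => f c * a)
                          (fun (c : k) (b : B) => g c * b).

HB.instance Definition _ := GRing.Zmodule.on talg.

Definition tpr (a : A) (b : B) : talg := tpure _ _ a b.

Definition talg_one : talg := tpr 1 1.

Definition talg_mull (a : A) (b : B) (y : talg) : talg :=
  tlift (fun a' b' => tpr (a * a') (b * b')) y.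

Definition talg_mul (x y : talg) : talg :=
  tlift (fun a b => talg_mull a b y) x.

Lemma tprDl a a' b : tpr (a + a') b = tpr a b + tpr a' b.
Proof. exact: (balancedDl (balanced_tpure _ _)). Qed.

Lemma tprDr a b b' : tpr a (b + b') = tpr a b + tpr a b'.
Proof. exact: (balancedDr (balanced_tpure _ _)). Qed.

Lemma tprZ c a b : tpr (f c * a) b = tpr a (g c * b).
Proof. exact: (balancedZ (balanced_tpure _ _)). Qed.

Lemma talg_mull_balanced a b :
  balanced (fun (c : k) (a : A) => f c * a) (fun (c : k) (b : B) => g c * b)
    (fun a' b' => tpr (a * a') (b * b')).
Proof.
split=> [a1 a2 b'|a' b1 b2|c a' b'].
- by rewrite mulrDr tprDl.
- by rewrite mulrDr tprDr.
- by rewrite mulrCA tprZ mulrCA.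
Qed.

Lemma talg_mull_tpr a b a' b' :
  talg_mull a b (tpr a' b') = tpr (a * a') (b * b').
Proof. exact: (tlift_tpure (talg_mull_balanced a b)). Qed.

Lemma talg_mullD a b : {morph talg_mull a b : y z / y + z}.
Proof. exact: (tliftD (talg_mull_balanced a b)). Qed.

Lemma talg_mull0 a b : talg_mull a b 0 = 0.
Proof.
by apply: (addrI (talg_mull a b 0)); rewrite addr0 -talg_mullD addr0.
Qed.

Lemma talg_mul_balanced y :
  balanced (fun (c : k) (a : A) => f c * a) (fun (c : k) (b : B) => g c * b)
    (fun a b => talg_mull a b y).
Proof.
split=> [a1 a2 b|a b1 b2|c a b].
- elim/tensor_ind: y => [|a' b'|y z hy hz].
  + by rewrite !talg_mull0 addr0.
  + by rewrite !talg_mull_tpr mulrDl tprDl.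
  + by rewrite !talg_mullD hy hz addrACA.
- elim/tensor_ind: y => [|a' b'|y z hy hz].
  + by rewrite !talg_mull0 addr0.
  + by rewrite !talg_mull_tpr mulrDl tprDr.
  + by rewrite !talg_mullD hy hz addrACA.
- elim/tensor_ind: y => [|a' b'|y z hy hz].
  + by rewrite !talg_mull0.
  + by rewrite !talg_mull_tpr -mulrA tprZ mulrA.
  + by rewrite !talg_mullD hy hz.
Qed.

Lemma talg_mul_tprl a b y : talg_mul (tpr a b) y = talg_mull a b y.
Proof. exact: (tlift_tpure (talg_mul_balanced y)). Qed.

Lemma talg_mul_tpr a b a' b' :
  talg_mul (tpr a b) (tpr a' b') = tpr (a * a') (b * b').
Proof. by rewrite talg_mul_tprl talg_mull_tpr. Qed.

Lemma talg_mulDl : left_distributive talg_mul +%R.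
Proof. by move=> x y z; exact: (tliftD (talg_mul_balanced z)). Qed.

Lemma talg_mul0l y : talg_mul 0 y = 0.
Proof.
by apply: (addrI (talg_mul 0 y)); rewrite addr0 -talg_mulDl addr0.
Qed.

Lemma talg_mulDr : right_distributive talg_mul +%R.
Proof.
move=> x y z; elim/tensor_ind: x => [|a b|x x' hx hx'].
- by rewrite !talg_mul0l addr0.
- by rewrite !talg_mul_tprl talg_mullD.
- by rewrite !talg_mulDl hx hx' addrACA.
Qed.

Lemma talg_mul0r y : talg_mul y 0 = 0.
Proof.
by apply: (addrI (talg_mul y 0)); rewrite addr0 -talg_mulDr addr0.
Qed.

Lemma talg_mulC : commutative talg_mul.
Proof.
move=> x y; elim/tensor_ind: x => [|a b|x x' hx hx'].
- by rewrite talg_mul0l talg_mul0r.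
- elim/tensor_ind: y => [|a' b'|y y' hy hy'].
  + by rewrite talg_mul0l talg_mul0r.
  + by rewrite !talg_mul_tpr mulrC [b * _]mulrC.
  + by rewrite talg_mulDl talg_mulDr hy hy'.
- by rewrite talg_mulDl talg_mulDr hx hx'.
Qed.

Lemma talg_mulA : associative talg_mul.
Proof.
move=> x y z; elim/tensor_ind: x => [|a b|x x' hx hx']; last first.
- by rewrite !talg_mulDl hx hx'.
- elim/tensor_ind: y => [|a' b'|y y' hy hy']; last first.
  + by rewrite talg_mulDl !talg_mulDr talg_mulDl hy hy'.
  + elim/tensor_ind: z => [|a'' b''|z z' hz hz']; last first.
    * by rewrite !talg_mulDr hz hz'.
    * by rewrite !talg_mul_tpr !mulrA.
    * by rewrite !talg_mul0r.
  + by rewrite talg_mul0l !talg_mul0r talg_mul0l.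
- by rewrite !talg_mul0l.
Qed.

Lemma talg_mul1 : left_id talg_one talg_mul.
Proof.
move=> x; elim/tensor_ind: x => [|a b|x x' hx hx'].
- by rewrite talg_mul0r.
- by rewrite talg_mul_tpr !mul1r.
- by rewrite talg_mulDr hx hx'.
Qed.

HB.instance Definition _ := GRing.Zmodule_isComPzRing.Build talg
  talg_mulA talg_mulC talg_mul1 talg_mulDl.

Lemma talg_ind (K : talg -> Prop) :
  K 0 -> (forall a b, K (tpr a b)) ->
  (forall x y, K x -> K y -> K (x + y)) -> forall x, K x.
Proof. exact: tensor_ind. Qed.

Lemma tprM a b a' b' : tpr a b * tpr a' b' = tpr (a * a') (b * b').
Proof. exact: talg_mul_tpr. Qed.

Lemma tpr0l b : tpr 0 b = 0.
Proof. exact: (balanced0l (balanced_tpure _ _)). Qed.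

Lemma tpr0r a : tpr a 0 = 0.
Proof. exact: (balanced0r (balanced_tpure _ _)). Qed.

Section Copair.
Variables (C : comPzRingType) (u : {rmorphism A -> C}) (v : {rmorphism B -> C}).
Hypothesis uv : forall c, u (f c) = v (g c).

Definition copair & (forall c, u (f c) = v (g c)) : talg -> C :=
  tlift (fun a b => u a * v b).

Lemma copair_balanced :
  balanced (fun (c : k) (a : A) => f c * a) (fun (c : k) (b : B) => g c * b)
    (fun a b => u a * v b).
Proof.
split=> [a a' b|a b b'|c a b].
- by rewrite rmorphD mulrDl.
- by rewrite rmorphD mulrDr.
- by rewrite !rmorphM uv mulrAC mulrC.
Qed.

Lemma copairE a b : copair uv (tpr a b) = u a * v b.
Proof. exact: (tlift_tpure copair_balanced). Qed.

Lemma copairD : {morph copair uv : x y / x + y}.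
Proof. exact: (tliftD copair_balanced). Qed.

Lemma copair0 : copair uv 0 = 0.
Proof. by apply: (addrI (copair uv 0)); rewrite addr0 -copairD addr0. Qed.

Lemma copair_zmod : zmod_morphism (copair uv).
Proof.
by move=> x y; apply: (addIr (copair uv y)); rewrite -copairD !subrK.
Qed.

Lemma copair_monoid : monoid_morphism (copair uv).
Proof.
split=> [|x y]; first by rewrite [1]/(tpr 1 1) copairE !rmorph1 mulr1.
elim/talg_ind: x => [|a b|x x' hx hx'].
- by rewrite mul0r copair0 mul0r.
- elim/talg_ind: y => [|a' b'|y y' hy hy'].
  + by rewrite mulr0 copair0 mulr0.
  + by rewrite tprM !copairE !rmorphM mulrACA.
  + by rewrite mulrDr !copairD mulrDr hy hy'.
- by rewrite mulrDl !copairD mulrDl hx hx'.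
Qed.

HB.instance Definition _ :=
  GRing.isZmodMorphism.Build talg C (copair uv) copair_zmod.
HB.instance Definition _ :=
  GRing.isMonoidMorphism.Build talg C (copair uv) copair_monoid.

End Copair.

Definition tinl (a : A) : talg := tpr a 1.
Definition tinr (b : B) : talg := tpr 1 b.

Lemma tinl_zmod : zmod_morphism tinl.
Proof. by move=> x y; apply: (addIr (tinl y)); rewrite -tprDl !subrK. Qed.

Lemma tinr_zmod : zmod_morphism tinr.
Proof. by move=> x y; apply: (addIr (tinr y)); rewrite -tprDr !subrK. Qed.

Lemma tinl_monoid : monoid_morphism tinl.
Proof. by split=> // x y; rewrite /tinl tprM mulr1. Qed.

Lemma tinr_monoid : monoid_morphism tinr.
Proof. by split=> // x y; rewrite /tinr tprM mulr1. Qed.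

HB.instance Definition _ := GRing.isZmodMorphism.Build A talg tinl tinl_zmod.
HB.instance Definition _ :=
  GRing.isMonoidMorphism.Build A talg tinl tinl_monoid.
HB.instance Definition _ := GRing.isZmodMorphism.Build B talg tinr tinr_zmod.
HB.instance Definition _ :=
  GRing.isMonoidMorphism.Build B talg tinr tinr_monoid.

Lemma tinlr c : tinl (f c) = tinr (g c).
Proof. by rewrite /tinl -[f c]mulr1 tprZ mulr1. Qed.

Lemma tinlrM a b : tinl a * tinr b = tpr a b.
Proof. by rewrite /tinl /tinr tprM mulr1 mul1r. Qed.

End TensorAlgebra.

(* [B] is flat over [A]: the functor [B (x)_A -] preserves injections. *)
Definition flat (A B : comPzRingType) (f : {rmorphism A -> B}) : Prop :=
  forall (N N' : lmodType A) (u : {linear N -> N'}), injective u ->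
    injective (tlift (fun (b : B) (n : N) =>
      tpure (fun (a : A) (b : B) => f a * b) ( *:%R ) b (u n))
      : tensor (fun (a : A) (b : B) => f a * b) ( *:%R ) -> _).

(* A finite topological space is the same as a finite set with a preorder:
   [le p q] means that [q] lies in the smallest open set [U_p] containing [p],
   and the open sets are the sets closed upwards.  A sheaf is then the same as
   its stalks [F_p = F(U_p)] with their restriction maps [F_p -> F_q] for
   [p <= q]; its sections on an open set [U] are the compatible families of
   elements of the stalks at the points of [U] (see [sections]). *)
Record ringedSpace := RingedSpace {
  pt :> finType;
  le : rel pt;
  le_refl : reflexive le;
  le_trans : transitive le;
  stalk : pt -> comPzRingType;
  res : forall p q, le p q -> {rmorphism stalk p -> stalk q};
  res_id : forall p (h : le p p) a, res h a = a;
  res_comp : forall p q r (hpq : le p q) (hqr : le q r) (hpr : le p r) a,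
    res hqr (res hpq a) = res hpr a }.

Definition is_open (X : ringedSpace) (U : pred X) : Prop :=
  forall p q, le p q -> U p -> U q.

Definition finite_space (X : ringedSpace) : Prop :=
  forall (p q : X) (h : le p q), flat (res h).

(* A continuous map together with the morphism [f^-1 O_Y -> O_X], given on
   stalks. *)
Record ringedMor (X Y : ringedSpace) := RingedMor {
  mor :> X -> Y;
  mor_le : forall x x', le x x' -> le (mor x) (mor x');
  comor : forall x, {rmorphism stalk (mor x) -> stalk x};
  comor_res : forall x x' (h : le x x') a,
    res h (comor x a) = comor x' (res (mor_le h) a) }.

Definition point (k : comPzRingType) : ringedSpace :=
  @RingedSpace unit (fun _ _ => true) (fun _ => isT) (fun _ _ _ _ _ => isT)
    (fun _ => k) (fun _ _ _ => idfun) (fun _ _ _ => erefl)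
    (fun _ _ _ _ _ _ _ => erefl).

Record overSpace (k : comPzRingType) := OverSpace {
  tot :> ringedSpace;
  str : ringedMor tot (point k) }.

Definition kmor (k : comPzRingType) (X : overSpace k) (x : X) :
  {rmorphism k -> stalk x} := comor (str X) x.

Lemma kmor_res (k : comPzRingType) (X : overSpace k) (x x' : X) (h : le x x') c :
  res h (kmor x c) = kmor x' c.
Proof. exact: (@comor_res _ _ (str X) x x' h c). Qed.

Section Product.
Variables (k : comPzRingType) (X Y : overSpace k).

Definition prod_le (p q : X * Y) : bool := le p.1 q.1 && le p.2 q.2.

Lemma prod_le_refl : reflexive prod_le.
Proof. by move=> p; rewrite /prod_le !le_refl. Qed.

Lemma prod_le_trans : transitive prod_le.
Proof.
move=> q p r /andP[h1 h2] /andP[h1' h2'].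
by rewrite /prod_le (le_trans h1 h1') (le_trans h2 h2').
Qed.

Lemma prod_le1 p q : prod_le p q -> le p.1 q.1.
Proof. by case/andP. Qed.

Lemma prod_le2 p q : prod_le p q -> le p.2 q.2.
Proof. by case/andP. Qed.

Definition prod_stalk (p : X * Y) : comPzRingType := talg (kmor p.1) (kmor p.2).

Section Res.
Variables (p q : X * Y) (h : prod_le p q).

Lemma prod_res_compat c :
  (tinl (kmor q.1) (kmor q.2) \o res (prod_le1 h)) (kmor p.1 c) =
  (tinr (kmor q.1) (kmor q.2) \o res (prod_le2 h)) (kmor p.2 c).
Proof. by rewrite /= !kmor_res tinlr. Qed.

(* [a (x) b |-> a|_{q.1} (x) b|_{q.2}] *)
Definition prod_res : {rmorphism prod_stalk p -> prod_stalk q} :=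
  copair prod_res_compat.

Lemma prod_resE a b :
  prod_res (tpr _ _ a b) =
  tpr _ _ (res (prod_le1 h) a) (res (prod_le2 h) b).
Proof. by rewrite [LHS]copairE /= tinlrM. Qed.

End Res.

Lemma prod_res_id p (h : prod_le p p) a : prod_res h a = a.
Proof.
elim/talg_ind: a => [|a b|x y hx hy]; first by rewrite rmorph0.
- by rewrite prod_resE !res_id.
- by rewrite rmorphD hx hy.
Qed.

Lemma prod_res_comp p q r (hpq : prod_le p q) (hqr : prod_le q r)
  (hpr : prod_le p r) a : prod_res hqr (prod_res hpq a) = prod_res hpr a.
Proof.
elim/talg_ind: a => [|a b|x y hx hy]; first by rewrite !rmorph0.
- rewrite !prod_resE (res_comp _ _ (prod_le1 hpr)).
  by rewrite (res_comp _ _ (prod_le2 hpr)).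
- by rewrite !rmorphD hx hy.
Qed.

Definition prod_ringed : ringedSpace :=
  RingedSpace prod_le_refl prod_le_trans prod_res_id prod_res_comp.

Definition prod_kmor (p : X * Y) : {rmorphism k -> prod_stalk p} :=
  tinl (kmor p.1) (kmor p.2) \o kmor p.1.

Lemma prod_kmor_res (p q : X * Y) (h : prod_le p q) c :
  prod_res h (prod_kmor p c) = prod_kmor q c.
Proof. by rewrite prod_resE rmorph1 kmor_res. Qed.

Definition prod_str : ringedMor prod_ringed (point k) :=
  @RingedMor prod_ringed (point k) (fun _ => tt) (fun _ _ _ => isT)
    prod_kmor prod_kmor_res.

Definition prod_space : overSpace k := OverSpace prod_str.

End Product.

Section Diagonal.
Variables (k : comPzRingType) (X : overSpace k).

Definition diag_fun (x : X) : prod_space X X := (x, x).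

Lemma diag_le x x' : le x x' -> le (diag_fun x) (diag_fun x').
Proof. by move=> h; rewrite /= /prod_le h. Qed.

(* The diagonal is given on stalks by multiplication [O_x (x)_k O_x -> O_x]. *)
Definition diag_comor (x : X) : {rmorphism stalk (diag_fun x) -> stalk x} :=
  copair (u := idfun) (v := idfun) (fun c => erefl (kmor x c)).

Lemma diag_comor_res x x' (h : le x x') a :
  res h (diag_comor x a) = diag_comor x' (res (diag_le h) a).
Proof.
elim/talg_ind: a => [|a b|y z hy hz]; first by rewrite !rmorph0.
- rewrite [diag_comor _ _]copairE [res (diag_le h) _]prod_resE.
  rewrite [RHS]copairE rmorphM /=.
  rewrite (bool_irrelevance (prod_le1 (diag_le h)) h).
  by rewrite (bool_irrelevance (prod_le2 (diag_le h)) h).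
- by rewrite !rmorphD hy hz.
Qed.

Definition diag : ringedMor X (prod_space X X) := RingedMor diag_comor_res.

End Diagonal.

Record omodule (X : ringedSpace) := OModule {
  mstalk :> forall p : X, lmodType (stalk p);
  mres : forall (p q : X) (h : le p q),
    {linear mstalk p -> mstalk q | res h \; *:%R};
  mres_id : forall p (h : le p p) m, mres h m = m;
  mres_comp : forall p q r (hpq : le p q) (hqr : le q r) (hpr : le p r) m,
    mres hqr (mres hpq m) = mres hpr m }.

Record omorphism (X : ringedSpace) (M N : omodule X) := OMorphism {
  omor :> forall p : X, {linear M p -> N p};
  omor_res : forall (p q : X) (h : le p q) m,
    mres N h (omor p m) = omor q (mres M h m) }.

(* Injectivity, surjectivity and exactness of morphisms of sheaves are
   conditions on stalks. *)
Definition omono (X : ringedSpace) (M N : omodule X) (f : omorphism M N) : Prop :=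
  forall p : X, injective (f p).

Definition oepi (X : ringedSpace) (M N : omodule X) (f : omorphism M N) : Prop :=
  forall (p : X) n, exists m, f p m = n.

Definition oexact (X : ringedSpace) (L M N : omodule X)
    (f : omorphism L M) (g : omorphism M N) : Prop :=
  forall (p : X) m, g p m = 0 <-> exists l, f p l = m.

Definition is_kernel (X : ringedSpace) (L M N : omodule X)
    (f : omorphism L M) (g : omorphism M N) : Prop := omono f /\ oexact f g.

Definition is_cokernel (X : ringedSpace) (L M N : omodule X)
    (f : omorphism L M) (g : omorphism M N) : Prop := oexact f g /\ oepi g.

Definition is_zero (X : ringedSpace) (M : omodule X) : Prop :=
  forall (p : X) (m : M p), m = 0.

Section StructureSheaf.
Variable X : ringedSpace.

Definition sheaf_res (p q : X) (h : le p q) (a : (stalk p)^o) : (stalk q)^o :=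
  res h a.

Lemma sheaf_res_linear p q (h : le p q) :
  linear_for (res h \; *:%R) (sheaf_res h).
Proof. by move=> c a b; rewrite /sheaf_res rmorphD rmorphM. Qed.

HB.instance Definition _ p q (h : le p q) :=
  GRing.isLinear.Build (stalk p) (stalk p)^o (stalk q)^o (res h \; *:%R)
    (sheaf_res h) (sheaf_res_linear h).

Definition structure_sheaf : omodule X :=
  @OModule X (fun p => (stalk p)^o) (fun p q h => sheaf_res h)
    (@res_id X) (@res_comp X).

End StructureSheaf.

Section FreeLmodule.
Variables (I : Type) (R : comPzRingType).

(* The direct sum [R^(I)]: functions with finite support. *)
Definition finsupp : {pred (I -> R^o)} :=
  fun f => `[< finite_set [set i | f i <> 0]%classic >].

Lemma finsupp_submod : submod_closed finsupp.
Proof.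
split=> [|a f g /asboolP hf /asboolP hg]; apply/asboolP.
  by rewrite (_ : [set i | _]%classic = set0) //; apply/seteqP; split=> i //=.
apply: (sub_finite_set _ (_ : finite_set
  ([set i | f i <> 0] `|` [set i | g i <> 0])%classic)); last first.
  by rewrite finite_setU.
move=> i /= h; have [fi0|] := pselect (f i = 0); last by left.
right=> gi0; apply: h.
by rewrite -[LHS]/(a *: f i + g i) fi0 gi0 scaler0 addr0.
Qed.

HB.instance Definition _ :=
  GRing.isSubmodClosed.Build R (I -> R^o) finsupp finsupp_submod.

Record freeMod := FreeMod { fval :> I -> R^o; fvalP : fval \in finsupp }.

HB.instance Definition _ := [isSub for fval].
HB.instance Definition _ := [Choice of freeMod by <:].
HB.instance Definition _ := [SubChoice_isSubLmodule of freeMod by <:].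

End FreeLmodule.

Section FreeOModule.
Variables (X : ringedSpace) (I : Type).

Lemma free_res_subproof (p q : X) (h : le p q) (f : freeMod I (stalk p)) :
  (fun i => res h (f i)) \in @finsupp I (stalk q).
Proof.
have /asboolP hf := fvalP f; apply/asboolP.
by apply: sub_finite_set hf => i /= hi fi0; apply: hi; rewrite fi0 rmorph0.
Qed.

Definition free_res (p q : X) (h : le p q) (f : freeMod I (stalk p)) :
  freeMod I (stalk q) := FreeMod (free_res_subproof h f).

Lemma free_res_linear (p q : X) (h : le p q) :
  linear_for (res h \; *:%R) (free_res h).
Proof.
move=> c f g; apply: val_inj; apply: funext => i /=.
by rewrite rmorphD rmorphM.
Qed.

HB.instance Definition _ (p q : X) (h : le p q) :=
  GRing.isLinear.Build (stalk p) (freeMod I (stalk p)) (freeMod I (stalk q))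
    (res h \; *:%R) (free_res h) (free_res_linear h).

Lemma free_res_id (p : X) (h : le p p) f : free_res h f = f.
Proof. by apply: val_inj; apply: funext => i /=; rewrite res_id. Qed.

Lemma free_res_comp (p q r : X) (hpq : le p q) (hqr : le q r) (hpr : le p r) f :
  free_res hqr (free_res hpq f) = free_res hpr f.
Proof.
by apply: val_inj; apply: funext => i /=; rewrite (res_comp _ _ hpr).
Qed.

Definition free_omodule : omodule X :=
  @OModule X (fun p => freeMod I (stalk p)) (fun p q h => free_res h)
    free_res_id free_res_comp.

End FreeOModule.

Section OpenSubspace.
Variables (X : ringedSpace) (U : pred X).

Definition sub_space : ringedSpace :=
  @RingedSpace {x : X | U x} (fun p q => le (val p) (val q))
    (fun p => le_refl (val p)) (fun q p r => @le_trans X (val q) (val p) (val r))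
    (fun p => stalk (val p)) (fun p q h => res h)
    (fun p => @res_id X (val p))
    (fun p q r => @res_comp X (val p) (val q) (val r)).

Definition restrict (M : omodule X) : omodule sub_space :=
  @OModule sub_space (fun p => M (val p)) (fun p q h => @mres X M (val p) (val q) h)
    (fun p => @mres_id X M (val p))
    (fun p q r => @mres_comp X M (val p) (val q) (val r)).

End OpenSubspace.

Definition quasi_coherent (X : ringedSpace) (M : omodule X) : Prop :=
  forall p : X, exists U : pred X, [/\ is_open U, U p &
    exists (I J : Type)
      (f : omorphism (free_omodule (sub_space U) I)
                     (free_omodule (sub_space U) J))
      (g : omorphism (free_omodule (sub_space U) J) (restrict U M)),
      is_cokernel f g].

Record sections (X : ringedSpace) (M : omodule X) (U : pred X) := Sections {
  germ : forall x : X, U x -> M x;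
  germ_res : forall (x x' : X) (h : le x x') (hx : U x) (hx' : U x'),
    mres M h (germ hx) = germ hx' }.

Section SectionsModule.
Variables (X : ringedSpace) (M : omodule X) (U : pred X).
Implicit Types s t : sections M U.

Lemma sections_ext s t :
  (forall x (hx : U x), germ s hx = germ t hx) -> s = t.
Proof.
case: s t => s hs [t ht] /= st; have e : s = t.
  by apply: functional_extensionality_dep => x; apply: funext => hx.
by subst t; congr Sections; exact: Prop_irrelevance.
Qed.

HB.instance Definition _ := gen_eqMixin (sections M U).
HB.instance Definition _ := gen_choiceMixin (sections M U).

Program Definition sections_zero : sections M U :=
  @Sections X M U (fun x hx => 0) _.
Next Obligation. by move=> *; rewrite raddf0. Qed.

Program Definition sections_add s t : sections M U :=
  @Sections X M U (fun x hx => germ s hx + germ t hx) _.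
Next Obligation. by move=> s t x x' h hx hx'; rewrite raddfD /= !(germ_res _ h hx hx'). Qed.

Program Definition sections_opp s : sections M U :=
  @Sections X M U (fun x hx => - germ s hx) _.
Next Obligation. by move=> s x x' h hx hx'; rewrite raddfN /= !(germ_res _ h hx hx'). Qed.

Lemma sections_addA : associative sections_add.
Proof. by move=> s t u; apply: sections_ext => x hx /=; rewrite addrA. Qed.

Lemma sections_addC : commutative sections_add.
Proof. by move=> s t; apply: sections_ext => x hx /=; rewrite addrC. Qed.

Lemma sections_add0 : left_id sections_zero sections_add.
Proof. by move=> s; apply: sections_ext => x hx /=; rewrite add0r. Qed.

Lemma sections_addN : left_inverse sections_zero sections_opp sections_add.
Proof. by move=> s; apply: sections_ext => x hx /=; rewrite addNr. Qed.

HB.instance Definition _ := GRing.isZmodule.Build (sections M U)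
  sections_addA sections_addC sections_add0 sections_addN.

End SectionsModule.

Section DirectImage.
Variables (X Y : ringedSpace) (f : ringedMor X Y).

Section Module.
Variable M : omodule X.

(* [(f_* M)_y = M(f^-1(U_y))], on which [O_y] acts through
   [O_y -> O_{f x} -> O_x] *)
Definition push_stalk (y : Y) := sections M (fun x : X => le y (f x)).

HB.instance Definition _ (y : Y) := GRing.Zmodule.on (push_stalk y).

Program Definition push_scale (y : Y) (a : stalk y) (s : push_stalk y) :
    push_stalk y :=
  @Sections X M _ (fun x (hx : le y (f x)) => comor f x (res hx a) *: germ s hx) _.
Next Obligation.
move=> y a s x x' h hx hx' /=.
rewrite linearZ_LR /= (germ_res _ h hx hx') comor_res.
by rewrite (res_comp _ _ hx').
Qed.

Lemma push_scaleA y a b (s : push_stalk y) :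
  push_scale a (push_scale b s) = push_scale (a * b) s.
Proof. by apply: sections_ext => x hx /=; rewrite scalerA !rmorphM. Qed.

Lemma push_scale1 y : left_id 1 (@push_scale y).
Proof. by move=> s; apply: sections_ext => x hx /=; rewrite !rmorph1 scale1r. Qed.

Lemma push_scaleDr y : right_distributive (@push_scale y) +%R.
Proof. by move=> a s t; apply: sections_ext => x hx /=; rewrite scalerDr. Qed.

Lemma push_scaleDl y (s : push_stalk y) :
  {morph (@push_scale y)^~ s : a b / a + b}.
Proof.
by move=> a b; apply: sections_ext => x hx /=; rewrite !rmorphD scalerDl.
Qed.

HB.instance Definition _ (y : Y) :=
  GRing.Zmodule_isLmodule.Build (stalk y) (push_stalk y)
    (@push_scaleA y) (@push_scale1 y) (@push_scaleDr y) (@push_scaleDl y).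

Program Definition push_res (y y' : Y) (h : le y y') (s : push_stalk y) :
    push_stalk y' :=
  @Sections X M _ (fun x (hx : le y' (f x)) => germ s (le_trans h hx)) _.
Next Obligation. by move=> y y' h s x x' hxx' hx hx'; exact: germ_res. Qed.

Lemma push_res_linear y y' (h : le y y') :
  linear_for (res h \; *:%R) (push_res h).
Proof.
move=> a s t; apply: sections_ext => x hx /=.
by rewrite (res_comp _ _ (le_trans h hx)).
Qed.

HB.instance Definition _ (y y' : Y) (h : le y y') :=
  GRing.isLinear.Build (stalk y) (push_stalk y) (push_stalk y')
    (res h \; *:%R) (push_res h) (push_res_linear h).

Lemma push_res_id y (h : le y y) s : push_res h s = s.
Proof.
by apply: sections_ext => x hx /=; congr germ; exact: bool_irrelevance.
Qed.

Lemma push_res_comp y y' y'' (h : le y y') (h' : le y' y'') (h'' : le y y'') s :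
  push_res h' (push_res h s) = push_res h'' s.
Proof.
by apply: sections_ext => x hx /=; congr germ; exact: bool_irrelevance.
Qed.

Definition direct_image : omodule Y :=
  @OModule Y push_stalk (fun y y' h => push_res h) push_res_id push_res_comp.

End Module.

Section Morphism.
Variables (M N : omodule X) (u : omorphism M N).

Program Definition push_map (y : Y) (s : push_stalk M y) : push_stalk N y :=
  @Sections X N _ (fun x hx => u x (germ s hx)) _.
Next Obligation. by move=> y s x x' h hx hx'; rewrite omor_res (germ_res _ h hx hx'). Qed.

Lemma push_map_linear y : linear (@push_map y).
Proof. by move=> a s t; apply: sections_ext => x hx /=; rewrite linearP. Qed.

HB.instance Definition _ (y : Y) :=
  GRing.isLinear.Build (stalk y) (push_stalk M y) (push_stalk N y) *:%R
    (@push_map y) (@push_map_linear y).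

Lemma push_map_res y y' (h : le y y') (s : push_stalk M y) :
  push_res h (push_map s) = push_map (push_res h s).
Proof. exact: sections_ext. Qed.

Definition direct_image_map : omorphism (direct_image M) (direct_image N) :=
  @OMorphism Y (direct_image M) (direct_image N) (fun y => @push_map y)
    push_map_res.

End Morphism.

End DirectImage.

Definition injective_omodule (X : ringedSpace) (E : omodule X) : Prop :=
  forall (M N : omodule X) (i : omorphism M N) (u : omorphism M E), omono i ->
    exists v : omorphism N E, forall (p : X) m, v p (i p m) = u p m.

Record injective_resolution (X : ringedSpace) (M : omodule X)
    (E : nat -> omodule X) (e : omorphism M (E 0))
    (d : forall n, omorphism (E n) (E n.+1)) : Prop := InjectiveResolution {
  resolution_injective : forall n, injective_omodule (E n);
  resolution_aug : is_kernel e (d 0);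
  resolution_exact : forall n, oexact (d n) (d n.+1) }.

(* The complex [E 0 -> E 1 -> ...] is extended by zero in degree -1. *)
Definition boundary (X : ringedSpace) (E : nat -> omodule X)
    (d : forall n, omorphism (E n) (E n.+1)) (n : nat) (p : X) :
    E n p -> Prop :=
  match n with
  | 0 => fun b => b = 0
  | n'.+1 => fun b => exists a, d n' p a = b
  end.

(* [H] is the [n]-th cohomology of the complex [E]: the quotient of the kernel
   [Z] of [d n] by the image of the previous differential. *)
Definition is_cohomology (X : ringedSpace) (E : nat -> omodule X)
    (d : forall n, omorphism (E n) (E n.+1)) (n : nat) (H : omodule X) : Prop :=
  exists (Z : omodule X) (i : omorphism Z (E n)) (q : omorphism Z H),
    [/\ is_kernel i (d n), oepi q &
        forall (p : X) z, q p z = 0 <-> boundary d (i p z)].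

(* [H] is (isomorphic to) the right derived functor [R^n f_* M]. *)
Definition is_higher_direct_image (X Y : ringedSpace) (f : ringedMor X Y)
    (M : omodule X) (n : nat) (H : omodule Y) : Prop :=
  exists (E : nat -> omodule X) (e : omorphism M (E 0))
      (d : forall n, omorphism (E n) (E n.+1)),
    injective_resolution e d /\
    is_cohomology (fun n => direct_image_map f (d n)) n H.

(* [R^n delta_* O] exists and is unique up to isomorphism, so that requiring a
   property of one representative is the same as requiring it of all. *)
Definition schematic (k : comPzRingType) (X : overSpace k) : Prop :=
  finite_space X /\
  forall n, exists H : omodule (prod_space X X),
    is_higher_direct_image (diag X) (structure_sheaf X) n H /\
    quasi_coherent H.

Definition semi_separated (k : comPzRingType) (X : overSpace k) : Prop :=
  [/\ finite_space X,
      quasi_coherent (direct_image (diag X) (structure_sheaf X)) &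
      forall n, (0 < n)%N -> exists H : omodule (prod_space X X),
        is_higher_direct_image (diag X) (structure_sheaf X) n H /\ is_zero H].

(* Main.v *)
Require Import Defs.
From HB Require Import structures.
From mathcomp Require Import all_boot all_algebra all_classical.
From mathcomp Require Import ring_quotient.

Set Implicit Arguments.
Unset Strict Implicit.
Unset Printing Implicit Defensive.

Import GRing.Theory Num.Theory.
Local Open Scope ring_scope.

(* The stalk of [R^n delta_* O] at [(x, x')] is [H^n(U_x n U_x', O)], and a
   module [H] on a finite space is quasi-coherent iff
   [O_q (x)_{O_p} H_p -> H_q] is bijective for all [p <= q].  By flatness, [X]
   is then schematic iff, for a complex [K] computing the cohomology of [O_X],
   the maps [O_x'' (x)_{O_x} K(U_x n U_x') -> K(U_x'' n U_x')] are
   quasi-isomorphisms for [x <= x''].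

   Take for [K] the Godement resolution: on a finite space it is bounded, flat,
   and split on stalks.  Hence [K (x)_k O_y] has the same base change property,
   and it maps to the sections over [U x U_y] of an injective resolution [E] of
   the structure sheaf of [X x Y]; this map is a quasi-isomorphism, since both
   sides are flabby in [U] and resolve [O_x (x)_k O_y] on [U_x].  By
   Mayer-Vietoris in the second variable, base change holds for the sections of
   [E] over [U x V], for every open [V] of [Y].  A specialization in
   [(X x Y) x (X x Y)] is a composition of four specializations, each of them
   in a single coordinate, and along these the rings change by pushout.

   In the semi-separated case [K_X(U)] and [K_Y(V)] are acyclic in positive
   degrees, for [U] and [V] intersections of two [U_x]'s, and the sections of
   [E] over [U x V] are quasi-isomorphic to [O_X(U) (x)_k K_Y(V)]. *)

(** The obstacle is that [O_x] and [O_y] need not be flat over [k], so that [- (x)_k O_y] does not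
    preserve quasi-isomorphisms in general. It does preserve those between bounded complexes of flat
    [O_x]-modules: the cone is exact and bounded, hence its cycles are flat, by descending induction
    from the top degree, and a short exact sequence of [O_x]-modules with flat cokernel stays exact
    over [k], as [- (x)_k O_y] is tensoring over [O_x] with [O_x (x)_k O_y]. An injective resolution
    need be neither bounded nor flat; the Godement resolution is bounded because the space is
    finite, and flat because the restriction maps are. Its flabbiness and its exactness on [U_x]
    survive the tensor product for another reason: they are witnessed by [k]-linear maps, extension
    by zero and a contracting homotopy. The group [Q/Z] enters twice: its characters prove the right
    exactness of the tensor product, and they produce injective modules. *)

Lemma additive_of_morph (U V : zmodType) (f : U -> V) :
  {morph f : x y / x + y} -> zmod_morphism f.
Proof. by move=> fD x y; apply: (addIr (f y)); rewrite -fD !subrK. Qed.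

(* Opaque, lest unification compare additive maps by unfolding them. *)
Fact mkadd_key (U V : zmodType) (f : U -> V) :
  {morph f : x y / x + y} -> {g : {additive U -> V} | forall x, g x = f x}.
Proof.
move=> fD; pose m := GRing.isZmodMorphism.Build U V f (additive_of_morph fD).
by exists (HB.pack f m : {additive U -> V}).
Qed.

Definition mkadd (U V : zmodType) (f : U -> V) (fD : {morph f : x y / x + y}) :
  {additive U -> V} := sval (mkadd_key fD).

Lemma mkaddE (U V : zmodType) (f : U -> V) fD x : @mkadd U V f fD x = f x.
Proof. exact: (svalP (mkadd_key fD)). Qed.

(** * Divisible cogenerator *)

Definition rat_int : {pred rat} := fun r => r \is a Num.int.

Lemma rat_int_closed : zmod_closed rat_int.
Proof. by split=> [|x y hx hy]; [exact: int_num0 | exact: rpredB]. Qed.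

HB.instance Definition _ := GRing.isZmodClosed.Build rat rat_int rat_int_closed.

(** The group [Q/Z]: divisibility makes it injective, and its elements of every finite order make it
    a cogenerator. *)
Definition ratmodZ := Quotient.quot rat_int.
HB.instance Definition _ := GRing.Zmodule.on ratmodZ.

Definition ratpi (r : rat) : ratmodZ := \pi_(ratmodZ)%qT r.

Lemma ratpi_eq r s : (ratpi r = ratpi s) <-> r - s \is a Num.int.
Proof.
split=> [h|h]; last first.
  by apply/eqP; rewrite -(@Quotient.idealrBE _ rat_int).
by move/eqP: h; rewrite -(@Quotient.idealrBE _ rat_int).
Qed.

Lemma ratpiD : {morph ratpi : r s / r + s}.
Proof. by move=> r s; rewrite /ratpi raddfD. Qed.

Lemma ratpi0 : ratpi 0 = 0.
Proof. by apply: (addrI (ratpi 0)); rewrite -ratpiD !addr0. Qed.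

Lemma ratpiMn r n : ratpi (r *+ n) = ratpi r *+ n.
Proof.
by elim: n => [|n IHn]; rewrite ?mulr0n ?ratpi0 // !mulrS ratpiD IHn.
Qed.

Lemma ratmodZ_divisible (a : ratmodZ) n : exists b, b *+ n.+1 = a.
Proof.
rewrite -[a]reprK; exists (ratpi (repr a / n.+1%:R)).
by rewrite -ratpiMn -mulrnAr -[_^-1 *+ _]mulr_natr mulVf ?mulr1 ?pnatr_eq0.
Qed.

(** Euclidean division by the least positive element of [Q], or [n = 0] if there is none. *)
Lemma int_subgroup (Q : int -> Prop) :
  Q 0 -> (forall i j, Q i -> Q j -> Q (i - j)) ->
  exists n : nat, Q n /\ forall j, Q j -> exists q : int, j = q * n.
Proof.
move=> Q0 QB.
have QN i : Q i -> Q (- i) by move=> Qi; rewrite -[- i]add0r; exact: QB.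
have QD i j : Q i -> Q j -> Q (i + j).
  by move=> Qi Qj; rewrite -[j]opprK; apply/QB/QN.
have QM i q : Q i -> Q (q * i).
  move=> Qi; have Qn (m : nat) : Q (m%:Z * i).
    by elim: m => [|m IHm]; rewrite ?mul0r // intS mulrDl mul1r; exact: QD.
  by case: (intP q) => [|m|m]; rewrite ?mul0r // ?mulNr; last apply: QN.
have [h|h] := pselect (exists n : nat, (0 < n)%N /\ Q n); last first.
  exists 0%N; split=> // j Qj; exists 0; rewrite mul0r.
  apply: contrapT => j0; apply: h; exists `|j|%N; split.
    by rewrite absz_gt0; apply/eqP.
  by case: j Qj {j0} => // m /QN; rewrite NegzE opprK.
have h' : exists n, `[< (0 < n)%N /\ Q n%:Z >].
  by case: h => n hn; exists n; apply/asboolP.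
case: (ex_minnP h') => n /asboolP[n0 Qn] nmin.
exists n; split=> // j Qj; exists (j %/ n)%Z.
have Qr : Q (j %% n)%Z by rewrite /modz; apply: QB => //; exact: QM.
rewrite {1}(divz_eq j n); suff -> : (j %% n)%Z = 0 by rewrite addr0.
have nz : n%:Z != 0 by rewrite eqz_nat -lt0n.
have := modz_ge0 j nz; have := @ltz_pmod j n n0.
case: (j %% n)%Z Qr => // -[|m] // Qm; rewrite ltz_nat => hm _.
have := nmin m.+1 (introT (asboolP _) (conj isT Qm)).
by move=> /leq_ltn_trans/(_ hm); rewrite ltnn.
Qed.

Lemma pairMz (U V : zmodType) (u : U) (v : V) j :
  (u, v) *~ j = (u *~ j, v *~ j).
Proof.
have := raddfMz (@fst U V) j (u, v); have := raddfMz (@snd U V) j (u, v).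
by case: (_ *~ j) => u' v' /= -> ->.
Qed.

Section Extension.
Variables (N : zmodType) (G : N * ratmodZ -> Prop).

(** The graph of a homomorphism from a subgroup of [N] to [Q/Z]: a subgroup whose only element over
    0 is 0. *)
Definition partial_hom (A : N * ratmodZ -> Prop) : Prop :=
  [/\ A 0, forall p q, A p -> A q -> A (p - q) & forall a, A (0, a) -> a = 0].

Lemma partial_homMz A p j : partial_hom A -> A p -> A (p *~ j).
Proof.
case=> A0 AB _ Ap.
have AN q : A q -> A (- q) by move=> Aq; rewrite -[- q]add0r; exact: AB.
have An (m : nat) : A (p *+ m).
  by elim: m => [//|m IHm]; rewrite mulrSr -[p in _ + p]opprK; apply/AB/AN.
by case: (intP j) => [|m|m] //; rewrite ?mulrNz -pmulrn //; apply: AN.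
Qed.

Hypothesis Gh : partial_hom G.

Lemma partial_hom_maximal : exists A, [/\ partial_hom A,
  forall p, G p -> A p & forall B, partial_hom B -> (forall p, A p -> B p) ->
    forall p, B p -> A p].
Proof.
pose good (A : set (N * ratmodZ)) :=
  A = set0 \/ partial_hom A /\ forall p, G p -> A p.
have [|A [[A0|[Ah GA]] Amax]] := @Zorn_bigcup _ good.
- move=> F Fgood Ftot.
  have [[A FA Ane]|h] := pselect (exists2 A, F A & A <> set0); last first.
    left; apply/seteqP; split=> p //= [A FA Ap]; apply: h; exists A => // A0.
    by rewrite A0 in Ap.
  right; have [//|[[A0 AB Ah] GA]] := Fgood _ FA.
  split; last by move=> p Gp; exists A => //; apply: GA.
  have sub B p : F B -> B p -> partial_hom B.
    by move=> FB Bp; case: (Fgood _ FB) => [B0|[]//]; rewrite B0 in Bp.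
  split; first by exists A.
  + move=> p q [B FB Bp] [C FC Cq].
    by case: (Ftot _ _ FB FC) => BC; [exists C => //; have [_ h _] := sub _ _ FC Cq
      | exists B => //; have [_ h _] := sub _ _ FB Bp]; apply: h => //; apply: BC.
  + by move=> a [B FB Ba]; have [_ _ h] := sub _ _ FB Ba; exact: h.
- have [G0 _ _] := Gh; case: (Amax G); last by right.
  by rewrite A0; split=> // /(_ _ G0).
- exists A; split=> // B Bh AB p Bp; apply: contrapT => Ap.
  apply: (Amax B); last by right; split=> // q /GA /AB.
  by split=> [q /AB//|BA]; apply: Ap; exact: BA.
Qed.

(** Injectivity of [Q/Z]. If a maximal graph [A] missed [x], the multiples of [x] in its domain
    would be those of some [n x]; divisibility provides a value [d] at [x] compatible with the value
    at [n x], and [A] could be enlarged. *)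
Lemma partial_hom_extend :
  exists f : {additive N -> ratmodZ}, forall x a, G (x, a) -> f x = a.
Proof.
have [A [Ah GA Amax]] := partial_hom_maximal.
have [A0 AB Af] := Ah.
have total x : exists a, A (x, a).
  have [||n [[a Aa] hn]] := @int_subgroup (fun j => exists a, A (x *~ j, a)).
  - by exists 0.
  - move=> i j [a Aa] [b Ab]; exists (a - b).
    by have := AB _ _ Aa Ab; rewrite mulrzBr.
  (* For [n = 0] only [j = 0] puts [x *~ j] into the domain, and any [d] would do. *)
  have [d hd] : exists d : ratmodZ, d *~ n = a.
    case: n Aa {hn} => [|n] Aa; last exact: ratmodZ_divisible.
    by exists 0; rewrite mulr0z; apply/esym/Af.
  have key j b : A (x *~ j, b) -> b = d *~ j.
    move=> Ab; have [|q jq] := hn j; first by exists b.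
    apply/eqP; rewrite -subr_eq0; apply/eqP; apply: Af.
    have := AB _ _ Ab (partial_homMz q Ah Aa).
    rewrite pairMz -hd -!mulrzA [n%:Z * q]mulrC -jq.
    by congr A; rewrite -[LHS]/(_ - _, _ - _) subrr.
  pose B p := exists q j, A q /\ p = q + (x, d) *~ j.
  exists d; apply: (Amax B).
  - split; first by exists 0, 0; rewrite addr0.
    + move=> _ _ [p [i [Ap ->]]] [q [j [Aq ->]]]; exists (p - q), (i - j).
      by split; [exact: AB | rewrite mulrzBr opprD addrACA].
    + move=> a' [[y b] [j [Ap]]]; rewrite pairMz => -[hy ->].
      have /eqP := esym hy; rewrite addr_eq0 => /eqP yE.
      have := AB _ _ A0 Ap; rewrite yE sub0r -[- (_, _)]/(_, _) opprK.
      by move=> /key <-; rewrite addrN.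
  - by move=> p Ap; exists p, 0; rewrite addr0.
  - by exists 0, 1; rewrite add0r.
have [f fE] := choice total.
have fu x a : A (x, a) -> f x = a.
  move=> Axa; apply/eqP; rewrite -subr_eq0; apply/eqP; apply: Af.
  by have := AB _ _ (fE x) Axa; rewrite -[_ - _]/(_ - _, _ - _) subrr.
have fD : {morph f : x y / x + y}.
  move=> x y; apply: fu; rewrite -[(_, _)]/((x, f x) + (y, f y)).
  by rewrite -[(y, _)]opprK -[- (y, _)]sub0r; apply: (AB) => //; exact: AB.
by exists (mkadd fD) => x a /GA /fu; rewrite mkaddE.
Qed.

End Extension.

Lemma ratmodZ_cogenerator (N : zmodType) (S : N -> Prop) (x : N) :
  S 0 -> (forall y z, S y -> S z -> S (y - z)) -> ~ S x ->
  exists2 f : {additive N -> ratmodZ}, forall y, S y -> f y = 0 & f x <> 0.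
Proof.
move=> S0 SB Sx.
have [||n [Sn hn]] := @int_subgroup (fun j => S (x *~ j)).
- by [].
- by move=> i j Si Sj; rewrite mulrzBr; exact: SB.
(* The order of [x] modulo [S] is [n], with [n = 0] for infinite order; [d] is the class of [1/2] if
   [n = 0] and of [1/n] if [n >= 2], while [n = 1] is excluded by [~ S x]. *)
have [d d0 dn] : exists2 d : ratmodZ, d <> 0 & d *+ n = 0.
  have inv_nint (m : nat) : ratpi m.+2%:R^-1 <> 0.
    rewrite -ratpi0 ratpi_eq subr0 => /intrP[z /(congr1 ( *%R m.+2%:R))].
    rewrite divff ?pnatr_eq0 // -[m.+2%:R]/(m.+2%:~R) -intrM -[1]/(1%:~R).
    move/intr_inj/(congr1 absz); rewrite abszM mulnC.
    by case: `|z|%N => [|[|u]].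
  case: n Sn {hn} => [|[|m]] Sn.
  - by exists (ratpi 2%:R^-1); first exact: inv_nint.
  - by case: Sx; rewrite mulr1z in Sn.
  - exists (ratpi m.+2%:R^-1); first exact: inv_nint.
    rewrite -ratpiMn -[_^-1 *+ _]mulr_natr mulVf ?pnatr_eq0 // -ratpi0 ratpi_eq subr0.
    exact: int_num1.
pose G p := exists s j, S s /\ p = (s + x *~ j, d *~ j).
have [|f fE] := @partial_hom_extend N G.
  split; first by exists 0, 0; rewrite mulr0z addr0.
  + move=> _ _ [s [i [Ss ->]]] [t [j [St ->]]]; exists (s - t), (i - j).
    split; first exact: SB.
    by rewrite -[LHS]/(_ - _, _ - _) !mulrzBr opprD addrACA.
  + move=> a [s [j [Ss [hs ->]]]].
    have [|q ->] := hn j; last by rewrite mulrC mulrzA -pmulrn dn mul0rz.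
    have /eqP := esym hs; rewrite addrC addr_eq0 => /eqP ->.
    by rewrite -sub0r; exact: SB.
exists f => [y Sy|].
  by apply: fE; exists y, 0; rewrite !mulr0z addr0.
by rewrite (fE _ d) //; exists 0, 1; rewrite add0r.
Qed.

(** * Modules and tensor products *)

Global Opaque tensor.

(** Modules are groups with a separate action, not [lmodType]s: the same group of sections is a
    module over [k], over several stalks and over their tensor products, and restriction of scalars
    leaves the group unchanged. *)
Record act (A : comPzRingType) (M : zmodType) := Act {
  act_op :> A -> M -> M;
  actDl : forall a b x, act_op (a + b) x = act_op a x + act_op b x;
  actDr : forall a, {morph act_op a : x y / x + y};
  actM : forall a b x, act_op a (act_op b x) = act_op (a * b) x;
  act1 : forall x, act_op 1 x = x }.

Definition actadd A M (s : act A M) a : {additive M -> M} := mkadd (actDr s a).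

Lemma actaddE A M (s : act A M) a x : actadd s a x = s a x.
Proof. exact: mkaddE. Qed.

Lemma act0 A M (s : act A M) a : s a 0 = 0.
Proof. by rewrite -actaddE raddf0. Qed.

Lemma actB A M (s : act A M) a x y : s a (x - y) = s a x - s a y.
Proof. by rewrite -!actaddE raddfB. Qed.

Lemma act0l A M (s : act A M) x : s 0 x = 0.
Proof. by apply: (addrI (s 0 x)); rewrite -actDl !addr0. Qed.

Lemma actC A M (s : act A M) a b x : s a (s b x) = s b (s a x).
Proof. by rewrite !actM mulrC. Qed.

Definition equiv R (M N : Type) (s : R -> M -> M) (t : R -> N -> N) (f : M -> N) :=
  forall a x, f (s a x) = t a (f x).

Definition lact (A : comPzRingType) (M : lmodType A) : act A M :=
  @Act A M *:%R (fun a b x => scalerDl x a b) (fun a x y => scalerDr a x y)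
    (fun a b x => scalerA a b x) (fun x => scale1r x).

Definition restr (A B : comPzRingType) (f : {rmorphism A -> B}) (M : zmodType)
  (s : act B M) : act A M.
Proof.
by exists (fun a x => s (f a) x) => [a b x|a|a b x|x];
  rewrite ?rmorphD ?rmorphM ?rmorph1 ?actDl ?actM ?act1 //; exact: actDr.
Defined.

Definition ralg (A B : comPzRingType) (f : {rmorphism A -> B}) : act A B.
Proof.
exists (fun a x => f a * x) => [a b x|a x y|a b x|x].
- by rewrite rmorphD mulrDl.
- by rewrite mulrDr.
- by rewrite rmorphM mulrA.
- by rewrite rmorph1 mul1r.
Defined.

(** The way back to [lmodType], in which [flat] and [omodule] are stated. *)
Definition modof (A : comPzRingType) (M : zmodType) (s : act A M) : Type := M.

HB.instance Definition _ A M (s : act A M) := GRing.Zmodule.on (modof s).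
HB.instance Definition _ A M (s : act A M) :=
  GRing.Zmodule_isLmodule.Build A (modof s) (actM s) (act1 s)
    (actDr s) (fun x a b => actDl s a b x).

Ltac tens_elim x a b :=
  let y := fresh "y" in let z := fresh "z" in
  let hy := fresh "hy" in let hz := fresh "hz" in
  elim/tensor_ind: x => [|a b|y z hy hz];
  [by rewrite !(act0, raddf0) ?addr0
  | idtac
  | by rewrite !(actDr, raddfD) ?hy ?hz ?addr0 // addrACA].

Lemma tpureDl R (M N : zmodType) (sM : R -> M -> M) (sN : R -> N -> N) a a' b :
  tpure sM sN (a + a') b = tpure sM sN a b + tpure sM sN a' b.
Proof. exact: (balancedDl (balanced_tpure _ _)). Qed.

Lemma tpureDr R (M N : zmodType) (sM : R -> M -> M) (sN : R -> N -> N) a b b' :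
  tpure sM sN a (b + b') = tpure sM sN a b + tpure sM sN a b'.
Proof. exact: (balancedDr (balanced_tpure _ _)). Qed.

Lemma tpureZ R (M N : zmodType) (sM : R -> M -> M) (sN : R -> N -> N) r a b :
  tpure sM sN (sM r a) b = tpure sM sN a (sN r b).
Proof. exact: (balancedZ (balanced_tpure _ _)). Qed.

Definition tliftA R (M N P : zmodType) (sM : R -> M -> M) (sN : R -> N -> N)
  (f : M -> N -> P) (fb : balanced sM sN f) : {additive tensor sM sN -> P} :=
  mkadd (tliftD fb).

Lemma tliftAE R (M N P : zmodType) (sM : R -> M -> M) (sN : R -> N -> N)
  (f : M -> N -> P) (fb : balanced sM sN f) a b :
  tliftA fb (tpure sM sN a b) = f a b.
Proof. by rewrite mkaddE tlift_tpure. Qed.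

Definition idadd (M : zmodType) : {additive M -> M} := idfun.

Section Tmap.
Variables (R : Type) (M M' N N' : zmodType).
Variables (sM : R -> M -> M) (sM' : R -> M' -> M').
Variables (sN : R -> N -> N) (sN' : R -> N' -> N').
Variables (g : {additive M -> M'}) (h : {additive N -> N'}).
Hypotheses (gE : equiv sM sM' g) (hE : equiv sN sN' h).

Lemma tmap_balanced : balanced sM sN (fun a b => tpure sM' sN' (g a) (h b)).
Proof.
split=> [a a' b|a b b'|r a b].
- by rewrite raddfD tpureDl.
- by rewrite raddfD tpureDr.
- by rewrite gE hE tpureZ.
Qed.

Definition tmap : {additive tensor sM sN -> tensor sM' sN'} :=
  tliftA tmap_balanced.

Lemma tmapE a b : tmap (tpure sM sN a b) = tpure sM' sN' (g a) (h b).
Proof. exact: tliftAE. Qed.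

End Tmap.

Lemma equiv_id R (M : zmodType) (s : R -> M -> M) : equiv s s (idadd M).
Proof. by []. Qed.

Notation lmap sL hE := (tmap (@equiv_id _ _ sL) hE).
Notation rmap hE sL := (tmap hE (@equiv_id _ _ sL)).

Section Swap.
Variables (R : Type) (M N : zmodType) (sM : R -> M -> M) (sN : R -> N -> N).

Lemma tswap_balanced : balanced sM sN (fun a b => tpure sN sM b a).
Proof. by split=> *; rewrite ?tpureDl ?tpureDr ?tpureZ. Qed.

Definition tswap : {additive tensor sM sN -> tensor sN sM} :=
  tliftA tswap_balanced.

Lemma tswapE a b : tswap (tpure sM sN a b) = tpure sN sM b a.
Proof. exact: tliftAE. Qed.

End Swap.

Lemma tswapK R (M N : zmodType) (sM : R -> M -> M) (sN : R -> N -> N) :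
  cancel (tswap sM sN) (tswap sN sM).
Proof.
by move=> x; tens_elim x a b; rewrite !tswapE.
Qed.

Lemma tswap_map R (M M' N N' : zmodType) (sM : R -> M -> M)
  (sM' : R -> M' -> M') (sN : R -> N -> N) (sN' : R -> N' -> N')
  (g : {additive M -> M'}) (h : {additive N -> N'})
  (gE : equiv sM sM' g) (hE : equiv sN sN' h) x :
  tswap sM' sN' (tmap gE hE x) = tmap hE gE (tswap sM sN x).
Proof.
by tens_elim x a b; rewrite !(tmapE, tswapE).
Qed.

Section RightExact.
Variables (R : Type) (L M' M M'' : zmodType).
Variables (sL : R -> L -> L) (s' : R -> M' -> M').
Variables (s : R -> M -> M) (s'' : R -> M'' -> M'').
Variables (i : {additive M' -> M}) (p : {additive M -> M''}).
Hypotheses (iE : equiv s' s i) (pE : equiv s s'' p).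
Hypothesis psurj : forall y, exists x, p x = y.

Lemma lmap_surj y : exists x, lmap sL pE x = y.
Proof.
elim/tensor_ind: y => [|a b|y y' [x <-] [x' <-]].
- by exists 0; rewrite raddf0.
- have [b' <-] := psurj b.
  by exists (tpure _ _ a b'); rewrite tmapE.
- by exists (x + x'); rewrite raddfD.
Qed.

Hypothesis pi_exact : forall x, p x = 0 -> exists y, i y = x.

(* A character of [L (x) M] which vanishes on the image of [L (x) M'] factors
   through [L (x) M'']; characters separate points from subgroups. *)
Lemma lmap_exact x : lmap sL pE x = 0 -> exists w, lmap sL iE w = x.
Proof.
move=> px0; apply: contrapT => Sx.
have [||f f0 fx] := @ratmodZ_cogenerator _
  (fun y => exists w, lmap sL iE w = y) x _ _ Sx.
- by exists 0; rewrite raddf0.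
- by move=> _ _ [w <-] [w' <-]; exists (w - w'); rewrite raddfB.
(* The section [q] need not be additive, but by [fq] the character [f] does not see the choice of a
   preimage. *)
have [q qE] := choice psurj.
have fq l m : f (tpure sL s l (q (p m))) = f (tpure sL s l m).
  have [|y hy] := @pi_exact (q (p m) - m); first by rewrite raddfB /= qE subrr.
  have -> : q (p m) = i y + m by rewrite hy subrK.
  by rewrite tpureDr raddfD f0 ?add0r //; exists (tpure _ _ l y); rewrite tmapE.
have qb : balanced sL s'' (fun l m => f (tpure sL s l (q m))).
  split=> [a a' b|a b b'|r a b]; first by rewrite tpureDl raddfD.
  - by rewrite -[b]qE -[b']qE -raddfD !fq tpureDr raddfD.
  - by rewrite tpureZ -[b in RHS]qE -pE fq.
apply: fx; have -> : f x = tliftA qb (lmap sL pE x); last by rewrite px0 raddf0.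
by clear px0 Sx; tens_elim x a b; rewrite tmapE tliftAE fq.
Qed.

End RightExact.

Section LeftFactor.
Variables (R : Type) (L M' M M'' : zmodType).
Variables (sL : R -> L -> L) (s' : R -> M' -> M').
Variables (s : R -> M -> M) (s'' : R -> M'' -> M'').
Variables (i : {additive M' -> M}) (p : {additive M -> M''}).
Hypotheses (iE : equiv s' s i) (pE : equiv s s'' p).
Hypothesis psurj : forall y, exists x, p x = y.

Lemma rmap_surj y : exists x, rmap pE sL x = y.
Proof.
have [x hx] := lmap_surj (sL := sL) pE psurj (tswap _ _ y).
by exists (tswap _ _ x); rewrite -[y]tswapK -hx tswap_map.
Qed.

Hypothesis pi_exact : forall x, p x = 0 -> exists y, i y = x.

Lemma rmap_exact x : rmap pE sL x = 0 -> exists w, rmap iE sL w = x.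
Proof.
move=> px0; have [|w hw] := @lmap_exact _ _ _ _ _ sL _ _ _ _ _ iE pE psurj pi_exact
    (tswap _ _ x).
  by rewrite -tswap_map px0 raddf0.
by exists (tswap _ _ w); rewrite -[x]tswapK -hw tswap_map.
Qed.

End LeftFactor.

Section TensorAction.
Variables (A : comPzRingType) (R : Type) (M N : zmodType).
Variables (sM : R -> M -> M) (sN : R -> N -> N) (s : act A M).
Hypothesis comm : forall a, equiv sM sM (actadd s a).

Definition tact : act A (tensor sM sN).
Proof.
exists (fun a => rmap (comm a) sN) => [a b x|a x y|a b x|x].
- elim/tensor_ind: x => [|m n|y z hy hz]; first by rewrite !raddf0 addr0.
    by rewrite !tmapE -tpureDl !actaddE actDl.
  by rewrite !raddfD hy hz addrACA.
- by rewrite raddfD.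
- by tens_elim x m n; rewrite !tmapE !actaddE actM.
- by tens_elim x m n; rewrite tmapE actaddE act1.
Defined.

Lemma tactE a m n : tact a (tpure sM sN m n) = tpure sM sN (s a m) n.
Proof. by rewrite /= tmapE actaddE. Qed.

End TensorAction.

Definition mulact (A : comPzRingType) : act A A := ralg idfun.

Lemma balg_comm (A B : comPzRingType) (f : {rmorphism A -> B}) b :
  equiv (ralg f) (ralg f) (actadd (mulact B) b).
Proof. by move=> a x; rewrite !actaddE /= mulrCA. Qed.

Notation bact f t := (@tact _ _ _ _ _ t _ (balg_comm f)).

Section Cancel.
Variables (A B : comPzRingType) (f : {rmorphism A -> B}) (M N : zmodType).
Variables (s : act B M) (t : act A N).

Lemma cancel_balanced1 m :
  balanced (ralg f) t (fun b n => tpure (restr f s) t (s b m) n).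
Proof.
split=> [b b' n|b n n'|a b n].
- by rewrite actDl tpureDl.
- by rewrite tpureDr.
- by rewrite -tpureZ /= actM.
Qed.

Lemma cancel_balanced :
  balanced s (bact f t) (fun m z => tliftA (cancel_balanced1 m) z).
Proof.
split=> [m m' z|m z z'|b m z].
- by tens_elim z b n; rewrite !tliftAE actDr tpureDl.
- by rewrite raddfD.
- by tens_elim z b' n; rewrite tactE !tliftAE actM mulrC.
Qed.

(** The isomorphism of [M (x)_B (B (x)_A N)] with [M (x)_A N], inverse to [cfrom]. *)
Definition cto : {additive tensor s (bact f t) -> tensor (restr f s) t} :=
  tliftA cancel_balanced.

Lemma ctoE m b n :
  cto (tpure _ _ m (tpure _ _ b n)) = tpure (restr f s) t (s b m) n.
Proof. by rewrite !tliftAE. Qed.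

Lemma cfrom_balanced : balanced (restr f s) t
  (fun m n => tpure s (bact f t) m (tpure (ralg f) t 1 n)).
Proof.
split=> [m m' n|m n n'|a m n]; rewrite ?tpureDl ?tpureDr //.
by rewrite -[LHS]/(tpure _ _ (s (f a) m) _) tpureZ tactE -tpureZ.
Qed.

Definition cfrom : {additive tensor (restr f s) t -> tensor s (bact f t)} :=
  tliftA cfrom_balanced.

Lemma cfromE m n :
  cfrom (tpure _ _ m n) = tpure s (bact f t) m (tpure (ralg f) t 1 n).
Proof. by rewrite !tliftAE. Qed.

Lemma cfromK : cancel cfrom cto.
Proof. by move=> x; tens_elim x m n; rewrite cfromE ctoE act1. Qed.

Lemma ctoK : cancel cto cfrom.
Proof.
move=> x; elim/tensor_ind: x => [|m z|y z hy hz]; rewrite ?raddf0 //; last first.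
  by rewrite !raddfD hy hz.
elim/tensor_ind: z => [|b n|y z hy hz].
- by rewrite (balanced0r (balanced_tpure _ _)) !raddf0.
- by rewrite ctoE cfromE tpureZ tactE /= mulr1.
- by rewrite tpureDr !raddfD hy hz.
Qed.

End Cancel.

(** * Flat modules *)

Definition mflat (A : comPzRingType) (M : zmodType) (s : act A M) : Prop :=
  forall (N N' : zmodType) (t : act A N) (t' : act A N') (u : {additive N -> N'})
    (uE : equiv t t' u), injective u ->
    forall x : tensor s t, lmap s uE x = 0 -> x = 0.

Lemma additive_inj (U V : zmodType) (f : {additive U -> V}) :
  (forall x, f x = 0 -> x = 0) -> injective f.
Proof.
move=> f0 x y fxy; apply/eqP; rewrite -subr_eq0; apply/eqP/f0.
by rewrite raddfB fxy subrr.
Qed.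

Definition to_modof A (N : zmodType) (t : act A N) : {additive N -> modof t} :=
  @mkadd N (modof t) (fun x => x) (fun x y => erefl).

Definition of_modof A (N : zmodType) (t : act A N) : {additive modof t -> N} :=
  @mkadd (modof t) N (fun x => x) (fun x y => erefl).

(** [flat] speaks of linear maps of [lmodType]s; [modof] turns actions into such, and the identity
    maps [i1], [j1], [i2] carry tensors across. *)
Lemma flat_mflat (A B : comPzRingType) (f : {rmorphism A -> B}) :
  flat f -> mflat (ralg f).
Proof.
move=> ff N N' t t' u uE u_inj.
have uZ : linear (u : modof t -> modof t').
  by move=> a x y; rewrite raddfD; congr (_ + _); exact: uE.
pose v : {linear modof t -> modof t'} :=
  HB.pack (u : modof t -> modof t')
    (GRing.isLinear.Build A (modof t) (modof t') *:%R u uZ).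
have iE P (r : act A P) : equiv r (lact (modof r)) (to_modof r).
  by move=> a x; rewrite !mkaddE.
have jE P (r : act A P) : equiv (lact (modof r)) r (of_modof r).
  by move=> a x; rewrite !mkaddE.
have vE : equiv (lact (modof t)) (lact (modof t')) v := uE.
have h (z : tensor (ralg f) (lact (modof t))) : lmap (ralg f) vE z = 0 -> z = 0.
  move=> hz; apply: (ff _ _ v u_inj z 0).
  have e := mkaddE (tliftD (tmap_balanced (@equiv_id _ _ (ralg f)) vE)).
  by apply: etrans (esym (e z)) _; apply: etrans (e 0); rewrite hz raddf0.
move=> x ux0.
pose i1 : {additive _ -> _} := lmap (ralg f) (iE _ t).
pose j1 : {additive _ -> _} := lmap (ralg f) (jE _ t).
pose i2 : {additive _ -> _} := lmap (ralg f) (iE _ t').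
have jiK y : y = j1 (i1 y).
  elim/tensor_ind: y => [|b n|y z hy hz]; first by rewrite (raddf0 i1) (raddf0 j1).
    by rewrite !tmapE !mkaddE.
  by rewrite (raddfD i1) (raddfD j1) -hy -hz.
have uiK y : lmap (ralg f) vE (i1 y) = i2 (lmap (ralg f) uE y).
  elim/tensor_ind: y => [|b n|y z hy hz].
  - by rewrite (raddf0 i1) (raddf0 (lmap _ uE)) (raddf0 i2) (raddf0 (lmap _ vE)).
  - by rewrite !tmapE !mkaddE.
  - rewrite (raddfD i1) (raddfD (lmap _ uE)) (raddfD i2) (raddfD (lmap _ vE)).
    by rewrite hy hz.
by rewrite [x]jiK (h (i1 x)) ?(raddf0 j1) // uiK ux0 (raddf0 i2).
Qed.

Lemma tact_map (A : comPzRingType) (R : Type) (M N N' : zmodType)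
  (sM : R -> M -> M) (sN : R -> N -> N) (sN' : R -> N' -> N') (s : act A M)
  (comm : forall a, equiv sM sM (actadd s a)) (h : {additive N -> N'})
  (hE : equiv sN sN' h) :
  equiv (tact sN comm) (tact sN' comm) (lmap sM hE).
Proof. by move=> a x; tens_elim x m n; rewrite !(tactE, tmapE). Qed.

Section CancelMap.
Variables (A B : comPzRingType) (f : {rmorphism A -> B}) (M N N' : zmodType).
Variables (s : act B M) (t : act A N) (t' : act A N').
Variables (h : {additive N -> N'}) (hE : equiv t t' h).

Lemma cfrom_map x :
  lmap s (tact_map (balg_comm f) hE) (cfrom f s t x) =
  cfrom f s t' (lmap (restr f s) hE x).
Proof. by tens_elim x m n; rewrite !(tmapE, cfromE). Qed.

End CancelMap.

(** [M (x)_A N] is [M (x)_B (B (x)_A N)], a composite of two functors that preserve injections. *)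
Lemma mflat_trans (A B : comPzRingType) (f : {rmorphism A -> B}) (M : zmodType)
  (s : act B M) : mflat (ralg f) -> mflat s -> mflat (restr f s).
Proof.
move=> ff fs N N' t t' u uE u_inj x ux0.
have ui : injective (lmap (ralg f) uE).
  by apply: additive_inj => z; apply: ff.
have h : cfrom f s t x = 0.
  apply: (fs _ _ _ _ _ (tact_map (balg_comm f) uE) ui).
  by rewrite cfrom_map ux0 raddf0.
by rewrite -[x]cfromK h raddf0.
Qed.

Lemma cto_rmap (A B : comPzRingType) (f : {rmorphism A -> B})
  (M M' N : zmodType) (s : act B M) (s' : act B M') (t : act A N)
  (u : {additive M -> M'}) (uE : equiv s s' u)
  (uE' : equiv (restr f s) (restr f s') u) x :
  cto f s' t (rmap uE (bact f t) x) = rmap uE' t (cto f s t x).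
Proof.
elim/tensor_ind: x => [|m z|y z hy hz]; rewrite ?raddf0 //; last first.
  by rewrite !raddfD hy hz.
elim/tensor_ind: z => [|b n|y z hy hz].
- by rewrite (balanced0r (balanced_tpure _ _)) !raddf0.
- by rewrite tmapE !ctoE tmapE uE.
- by rewrite tpureDr !raddfD hy hz.
Qed.

(** The base change [B (x)_A M] tensored over [B] with [N] is [M (x)_A N]. *)
Lemma mflat_base (A B : comPzRingType) (f : {rmorphism A -> B}) (M : zmodType)
  (t : act A M) : mflat t -> mflat (bact f t).
Proof.
move=> ft N N' s s' u uE u_inj x ux0.
have uE' : equiv (restr f s) (restr f s') u by move=> a y; exact: uE.
have h : tswap _ _ (cto f s t (tswap _ _ x)) = 0.
  apply: (ft _ _ _ _ _ uE' u_inj).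
  by rewrite -tswap_map -(cto_rmap uE) -tswap_map ux0 !raddf0.
by rewrite -[x]tswapK -[tswap _ _ x]ctoK -[cto _ _ _ _]tswapK h !raddf0.
Qed.

(** The identity of [M] factors through the finite family [F], hence so does that of [M (x) N]; an
    element killed by [u] has all its components killed by [u], so it vanishes. *)
Lemma mflat_split (A : comPzRingType) (M : zmodType) (s : act A M) (I : finType)
  (F : I -> zmodType) (sF : forall i, act A (F i))
  (p : forall i, {additive M -> F i}) (e : forall i, {additive F i -> M}) :
  (forall i, equiv s (sF i) (p i)) -> (forall i, equiv (sF i) s (e i)) ->
  (forall x, x = \sum_i e i (p i x)) ->
  (forall i, mflat (sF i)) -> mflat s.
Proof.
move=> pE eE pe fF N N' t t' u uE u_inj x ux0.
have -> : x = \sum_i rmap (eE i) t (rmap (pE i) t x).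
  clear ux0; elim/tensor_ind: x => [|m n|y z hy hz].
  - by rewrite big1 // => i _; rewrite !raddf0.
  - rewrite {1}[m]pe; elim/big_rec2: _ => [|i z y _ <-].
      by rewrite (balanced0l (balanced_tpure _ _)).
    by rewrite tpureDl !tmapE.
  - rewrite {1}hy {1}hz -big_split; apply: eq_bigr => i _ /=.
    by rewrite !raddfD.
rewrite big1 // => i _.
suff -> : rmap (pE i) t x = 0 by rewrite raddf0.
apply: (fF i _ _ _ _ _ uE u_inj).
have -> : lmap (sF i) uE (rmap (pE i) t x) = rmap (pE i) t' (lmap s uE x).
  by clear ux0; tens_elim x m n; rewrite !tmapE.
by rewrite ux0 raddf0.
Qed.

Section FreeModule.
Variables (I : choiceType) (A : comPzRingType).
Implicit Types (f g : freeMod I A).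

Lemma fm_addE f g i : (f + g) i = f i + g i.
Proof. by []. Qed.

Lemma fm_scaleE a f i : (a *: f) i = a * f i.
Proof. by []. Qed.

Definition covers f (s : seq I) := uniq s /\ forall i, f i <> 0 -> i \in s.

Lemma covers_exists f : exists s, covers f s.
Proof.
have /asboolP/finite_seqP[s hs] := fvalP f.
exists (undup s); split=> [|i fi]; first exact: undup_uniq.
by rewrite mem_undup; have : [set` s]%classic i by rewrite -hs.
Qed.

Lemma covers_sub f s s' : covers f s -> uniq s' -> {subset s <= s'} -> covers f s'.
Proof. by move=> [_ fs] us' ss'; split=> // i /fs /ss'. Qed.

Lemma covers_join f g : exists s, covers f s /\ covers g s.
Proof.
have [s hs] := covers_exists f; have [s' hs'] := covers_exists g.
exists (undup (s ++ s')); split; [apply: covers_sub hs _ _ | apply: covers_sub hs' _ _];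
  rewrite ?undup_uniq // => i ii; by rewrite mem_undup mem_cat ii ?orbT.
Qed.

Lemma fm_delta_subproof i a : (fun j => if j == i then a else 0) \in @finsupp I A.
Proof.
apply/asboolP; apply: (@sub_finite_set _ _ [set i]%classic) => [j /=|].
  by case: eqP.
exact: finite_set1.
Qed.

Definition fm_delta i a : freeMod I A := FreeMod (fm_delta_subproof i a).

Section Sum.
Variables (M : zmodType) (s : act A M) (m : I -> M).

(** The map [A^(I) -> M] sending the [i]-th basis element to [m i]. By [fm_sumE] the chosen list
    covering the support does not matter. *)
Definition fm_sum f : M := \sum_(i <- projT1 (cid (covers_exists f))) s (f i) (m i).

Lemma fm_sumE f r : covers f r -> fm_sum f = \sum_(i <- r) s (f i) (m i).
Proof.
rewrite /fm_sum; case: cid => r' [ur' fr'] [ur fr] /=.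
have h u : uniq u -> (forall i, f i <> 0 -> i \in u) ->
    \sum_(i <- u) s (f i) (m i) = \sum_(i <- undup (r ++ r')) s (f i) (m i).
  move=> uu fu; rewrite (bigID (fun i => f i == 0)) /= big1; last first.
    by move=> i /eqP ->; rewrite act0l.
  rewrite [RHS](bigID (fun i => f i == 0)) /= [in RHS]big1; last first.
    by move=> i /eqP ->; rewrite act0l.
  rewrite !add0r -big_filter -[RHS]big_filter; apply: perm_big; apply: uniq_perm.
  - exact: filter_uniq.
  - by rewrite filter_uniq ?undup_uniq.
  - move=> i; rewrite !mem_filter; case: eqP => //= fi.
    by rewrite fu // mem_undup mem_cat fr.
by rewrite !h.
Qed.

Lemma fm_sumD : {morph fm_sum : f g / f + g}.
Proof.
move=> f g; have [r [fr gr]] := covers_join f g.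
rewrite (fm_sumE fr) (fm_sumE gr) (fm_sumE (r := r)).
  by rewrite -big_split; apply: eq_bigr => i _; rewrite fm_addE actDl.
case: fr gr => ur fr [_ gr]; split=> // i; rewrite fm_addE => fgi.
apply: contrapT => ir; apply: fgi.
have -> : f i = 0 by apply: contrapT => /fr.
by have -> : g i = 0; [apply: contrapT => /gr | rewrite addr0].
Qed.

Lemma fm_sumZ a f : fm_sum (a *: f) = s a (fm_sum f).
Proof.
have [r fr] := covers_exists f; rewrite (fm_sumE fr) (fm_sumE (r := r)).
  rewrite -actaddE raddf_sum; apply: eq_bigr => i _.
  by rewrite fm_scaleE actaddE actM.
case: fr => ur fr; split=> // i; rewrite fm_scaleE => afi; apply: fr => fi.
by rewrite fi mulr0 in afi.
Qed.

Lemma fm_sum_delta i a : fm_sum (fm_delta i a) = s a (m i).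
Proof.
rewrite (fm_sumE (r := [:: i])) ?big_seq1 /= ?eqxx //.
by split=> // j /=; rewrite inE; case: eqP.
Qed.

Definition fm_sumA : {additive freeMod I A -> M} := mkadd fm_sumD.

End Sum.

Lemma fm_decomp f r : covers f r -> f = \sum_(i <- r) fm_delta i (f i).
Proof.
move=> fr; apply: val_inj; apply: funext => j.
have fjD : {morph (fun g : freeMod I A => fval g j : A) : g h / g + h} by [].
have e := mkaddE fjD (\sum_(i <- r) fm_delta i (f i)).
apply: etrans (etrans e (erefl _)); rewrite raddf_sum.
under eq_bigr do rewrite mkaddE /=.
case: fr => ur fr.
have [jr|jr] := boolP (j \in r).
  rewrite (bigD1_seq j) //= eqxx big1 ?addr0 // => i.
  by rewrite eq_sym; case: eqP.
rewrite big1_seq => [|i /= ir]; last by case: eqP jr => // ->; rewrite ir.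
by apply: contrapT => /fr; rewrite (negPf jr).
Qed.

(** The coordinates [c i] commute with [u], and an element of [A^(I) (x) N] is recovered from
    finitely many of its coordinates. *)
Lemma mflat_free : mflat (lact (freeMod I A)).
Proof.
move=> N N' t t' u uE u_inj x ux0.
have cb i (P : zmodType) (r : act A P) :
    balanced (lact (freeMod I A)) r (fun f n => r (f i) n).
  split=> [f g n|f n n'|a f n]; first by rewrite fm_addE actDl.
  - exact: actDr.
  - by rewrite /= actM mulrC.
pose c i P r : {additive _ -> _} := tliftA (cb i P r).
have cx i : c i _ t x = 0.
  apply: u_inj; rewrite raddf0 -[RHS](raddf0 (c i _ t')) -ux0.
  clear ux0; tens_elim x f n.
  by rewrite tmapE !tliftAE.
(* Stated for all lists containing [r0], so that the lists of two summands can be joined. *)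
have [r hr] : exists r0 : seq I, forall r, uniq r -> {subset r0 <= r} ->
    x = \sum_(i <- r) tpure (lact (freeMod I A)) t (fm_delta i 1) (c i _ t x).
  clear ux0 cx; elim/tensor_ind: x => [|f n|y z [ry hy] [rz hz]].
  - exists [::] => r _ _; rewrite big1 // => i _.
    by rewrite raddf0 (balanced0r (balanced_tpure _ _)).
  - have [r0 hr0] := covers_exists f; exists r0 => r ur r0r.
    have fr := covers_sub hr0 ur r0r.
    rewrite {1}(fm_decomp fr); elim/big_rec2: _ => [|i z y _ <-].
      by rewrite (balanced0l (balanced_tpure _ _)).
    rewrite tpureDl; congr (_ + _); rewrite tliftAE -tpureZ; congr tpure.
    apply: val_inj; apply: funext => j.
    rewrite -[RHS]/(((f i : A) *: fm_delta i 1) j) fm_scaleE /=.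
    by case: eqP; rewrite ?mulr1 ?mulr0.
  - exists (ry ++ rz) => r ur sr; rewrite {1}(hy r) //; last first.
      by move=> i ii; apply: sr; rewrite mem_cat ii.
    rewrite {1}(hz r) //; last by move=> i ii; apply: sr; rewrite mem_cat ii orbT.
    by rewrite -big_split; apply: eq_bigr => i _ /=; rewrite raddfD tpureDr.
rewrite (hr (undup r)) ?undup_uniq //; last by move=> i; rewrite mem_undup.
by rewrite big1 // => i _; rewrite cx (balanced0r (balanced_tpure _ _)).
Qed.

End FreeModule.

(** * Subgroups *)

Record subgroup (N : zmodType) := Subgroup {
  in_subgroup :> N -> Prop;
  subgroup0 : in_subgroup 0;
  subgroupB : forall x y, in_subgroup x -> in_subgroup y -> in_subgroup (x - y) }.

Section SubgroupType.
Variables (N : zmodType) (S : subgroup N).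

Definition subgroup_pred : {pred N} := fun x => `[< S x >].

Lemma subgroup_pred_closed : zmod_closed subgroup_pred.
Proof.
split=> [|x y /asboolP Sx /asboolP Sy]; apply/asboolP; first exact: subgroup0.
exact: subgroupB.
Qed.

HB.instance Definition _ :=
  GRing.isZmodClosed.Build N subgroup_pred subgroup_pred_closed.

Record subg := Subg { subg_val : N; subg_valP : subg_val \in subgroup_pred }.

HB.instance Definition _ := [isSub for subg_val].
HB.instance Definition _ := [Choice of subg by <:].
HB.instance Definition _ := [SubChoice_isSubZmodule of subg by <:].

Definition sgval : {additive subg -> N} := val.

Definition sgmk x (Sx : S x) : subg := Subg (introT (asboolP _) Sx).

Lemma sgvalK x (Sx : S x) : sgval (sgmk Sx) = x. Proof. by []. Qed.

Lemma sgvalP (x : subg) : S (sgval x). Proof. exact/asboolP/subg_valP. Qed.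

Lemma sgval_inj : injective sgval. Proof. exact: val_inj. Qed.

Definition sgcod (M : zmodType) (f : {additive M -> N}) (fS : forall x, S (f x)) :
  {additive M -> subg}.
Proof.
apply: (@mkadd _ _ (fun x => sgmk (fS x))) => x y.
by apply: sgval_inj; rewrite [RHS]raddfD !sgvalK raddfD.
Defined.

Lemma sgcodE (M : zmodType) (f : {additive M -> N}) (fS : forall x, S (f x)) x :
  sgval (sgcod fS x) = f x.
Proof. by rewrite mkaddE. Qed.

Section Action.
Variables (A : comPzRingType) (s : act A N).
Hypothesis Ss : forall a x, S x -> S (s a x).

Definition subact : act A subg.
Proof.
exists (fun a x => sgmk (Ss a (sgvalP x))) => [a b x|a x y|a b x|x];
  apply: sgval_inj; rewrite ?raddfD !sgvalK ?raddfD.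
- exact: actDl.
- exact: actDr.
- exact: actM.
- exact: act1.
Defined.

Lemma sgval_equiv : equiv subact s sgval.
Proof. by []. Qed.

Lemma sgcod_equiv (M : zmodType) (r : act A M) (f : {additive M -> N})
  (fS : forall x, S (f x)) : equiv r s f -> equiv r subact (sgcod fS).
Proof. by move=> fE a x; apply: sgval_inj; rewrite sgval_equiv !sgcodE fE. Qed.

End Action.
End SubgroupType.

Definition kerg (M N : zmodType) (f : {additive M -> N}) : subgroup M.
Proof.
exists (fun x => f x = 0) => [|x y fx fy]; first exact: raddf0.
by rewrite raddfB fx fy subrr.
Defined.

Definition img (M N : zmodType) (f : {additive M -> N}) : subgroup N.
Proof.
exists (fun y => exists x, f x = y); first by exists 0; rewrite raddf0.
by move=> _ _ [x <-] [y <-]; exists (x - y); rewrite raddfB.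
Defined.

Lemma kerg_act (A : comPzRingType) (M N : zmodType) (s : act A M) (t : act A N)
  (f : {additive M -> N}) :
  equiv s t f -> forall a x, kerg f x -> kerg f (s a x).
Proof. by move=> fE a x /= fx; rewrite fE fx act0. Qed.

Lemma img_act (A : comPzRingType) (M N : zmodType) (s : act A M) (t : act A N)
  (f : {additive M -> N}) :
  equiv s t f -> forall a x, img f x -> img f (t a x).
Proof. by move=> fE a _ [x <-]; exists (s a x); rewrite fE. Qed.

(** * Tensoring exact sequences with flat cokernel *)

Section Pure.
Variables (A : comPzRingType) (M' M M'' : zmodType).
Variables (s' : act A M') (s : act A M) (s'' : act A M'').
Variables (i : {additive M' -> M}) (p : {additive M -> M''}).
Hypotheses (iE : equiv s' s i) (pE : equiv s s'' p).
Hypothesis i_inj : injective i.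
Hypothesis psurj : forall y, exists x, p x = y.
Hypothesis pi0 : forall x, p (i x) = 0.
Hypothesis pi_exact : forall x, p x = 0 -> exists y, i y = x.
Hypothesis M''_flat : mflat s''.

(** This is the vanishing of [Tor_1(M'', N)], by a diagram chase on a free cover [F] of [N] with
    kernel [K]: [z] is lifted to [z'] in [F (x) M'], whose image in [F (x) M] comes from [K (x) M]
    and then from [K (x) M']; as [F] is flat, [z'] itself comes from there, and [z = 0]. *)
Lemma lmap_inj_flat (N : zmodType) (t : act A N) z : lmap t iE z = 0 -> z = 0.
Proof.
move=> iz0.
pose F : zmodType := freeMod N A; pose sF : act A F := lact (freeMod N A).
pose c : {additive F -> N} := fm_sumA t id.
have cE : equiv sF t c by move=> a f; rewrite !mkaddE fm_sumZ.
have csurj y : exists x, c x = y.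
  by exists (fm_delta y 1); rewrite mkaddE fm_sum_delta act1.
have kE := kerg_act cE.
pose K := subg (kerg c); pose sK : act A K := subact kE.
have vE : equiv sK sF (sgval (kerg c)) by apply: sgval_equiv.
have v_exact x : c x = 0 -> exists y, sgval (kerg c) y = x.
  by move=> cx; exists (sgmk (cx : kerg c x)).
have [z' z'E] := rmap_surj cE csurj z.
have [w wE] : exists w, rmap vE s w = lmap sF iE z'.
  apply: (rmap_exact vE csurj v_exact (x := lmap sF iE z') (pE := cE)).
  have -> : rmap cE s (lmap sF iE z') = lmap t iE (rmap cE s' z').
    by clear z'E; tens_elim z' f m; rewrite !tmapE.
  by rewrite z'E.
(* By flatness of [M''], [K (x) M''] embeds into [F (x) M''], where the image of [w] is that of [z']
   and vanishes. *)
have w0 : lmap sK pE w = 0.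
  have sw0 : tswap _ _ (lmap sK pE w) = 0; last first.
    by rewrite -[LHS]tswapK sw0 raddf0.
  apply: (@M''_flat _ _ _ _ _ vE); first exact: sgval_inj.
  rewrite -tswap_map.
  have -> : rmap vE s'' (lmap sK pE w) = lmap sF pE (rmap vE s w).
    by clear wE; tens_elim w k m; rewrite !tmapE.
  rewrite wE.
  have h y : lmap sF pE (lmap sF iE y) = 0; last by rewrite h raddf0.
  tens_elim y f m.
  by rewrite !tmapE /= pi0 (balanced0r (balanced_tpure _ _)).
have [v vE'] := lmap_exact (sL := sK) iE psurj pi_exact w0.
have z'v : z' = rmap vE s' v.
  apply/eqP; rewrite -subr_eq0; apply/eqP.
  apply: (@mflat_free _ A _ _ _ _ i iE i_inj).
  rewrite raddfB -wE -vE'; apply/eqP; rewrite subr_eq0; apply/eqP.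
  by clear vE'; tens_elim v k m; rewrite !tmapE.
rewrite -z'E z'v; clear vE' z'v.
tens_elim v k m.
by rewrite !tmapE /= [c _](sgvalP k) (balanced0l (balanced_tpure _ _)).
Qed.

End Pure.

Lemma equiv_restr (k A : comPzRingType) (g : {rmorphism k -> A}) (M N : zmodType)
  (s : act A M) (t : act A N) (u : M -> N) :
  equiv s t u -> equiv (restr g s) (restr g t) u.
Proof. by move=> uE a x; exact: uE. Qed.

Lemma cfrom_rmap (A B : comPzRingType) (f : {rmorphism A -> B})
  (M M' N : zmodType) (s : act B M) (s' : act B M') (t : act A N)
  (u : {additive M -> M'}) (uE : equiv s s' u) x :
  rmap uE (bact f t) (cfrom f s t x) =
  cfrom f s' t (rmap (equiv_restr f uE) t x).
Proof. by tens_elim x m n; rewrite !(cfromE, tmapE). Qed.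

Section PureBase.
Variables (k A : comPzRingType) (g : {rmorphism k -> A}).
Variables (M' M M'' : zmodType).
Variables (s' : act A M') (s : act A M) (s'' : act A M'').
Variables (i : {additive M' -> M}) (p : {additive M -> M''}).
Hypotheses (iE : equiv s' s i) (pE : equiv s s'' p).
Hypothesis i_inj : injective i.
Hypothesis psurj : forall y, exists x, p x = y.
Hypothesis pi0 : forall x, p (i x) = 0.
Hypothesis pi_exact : forall x, p x = 0 -> exists y, i y = x.
Hypothesis M''_flat : mflat s''.

(** The preceding injectivity over [A], for the module [A (x)_k N]: flatness of [M''] over [A]
    controls tensor products over [k]. *)
Lemma lmap_inj_base (N : zmodType) (t : act k N) z :
  lmap t (equiv_restr g iE) z = 0 -> z = 0.
Proof.
move=> iz0.
have h : tswap _ _ (cfrom g s' t (tswap _ _ z)) = 0.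
  apply: (lmap_inj_flat pE i_inj psurj pi0 pi_exact M''_flat).
  by rewrite -tswap_map cfrom_rmap -tswap_map iz0 !raddf0.
by rewrite -[z]tswapK -[tswap _ _ z](@cfromK _ _ g) -[cfrom _ _ _ _]tswapK h !raddf0.
Qed.

(** [M' (x) N] embeds into [M (x) N] because [M''] is flat, and from there into [M (x) N']. *)
Lemma mflat_kernel : mflat s -> mflat s'.
Proof.
move=> fs N N' t t' u uE u_inj x ux0.
suff h : tswap _ _ x = 0 by rewrite -[x]tswapK h raddf0.
apply: (lmap_inj_flat pE i_inj psurj pi0 pi_exact M''_flat).
suff h : tswap _ _ (lmap t iE (tswap _ _ x)) = 0.
  by rewrite -[LHS]tswapK h raddf0.
rewrite tswap_map tswapK; apply: (fs _ _ _ _ _ uE u_inj).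
have -> : lmap s uE (rmap iE t x) = rmap iE t' (lmap s' uE x).
  by clear ux0; tens_elim x m n; rewrite !tmapE.
by rewrite ux0 raddf0.
Qed.

End PureBase.

Lemma mflat_trivial (A : comPzRingType) (M : zmodType) (s : act A M) :
  (forall x : M, x = 0) -> mflat s.
Proof.
move=> M0 N N' t t' u uE _ x _.
elim/tensor_ind: x => [//|m n|x y -> ->]; last by rewrite addr0.
by rewrite (M0 m) (balanced0l (balanced_tpure _ _)).
Qed.

(** * Complexes *)

Definition zero_group : Type := unit.
HB.instance Definition _ := Choice.on zero_group.

Lemma zero_groupP (x y : zero_group) : x = y. Proof. by case: x; case: y. Qed.

HB.instance Definition _ := @GRing.isZmodule.Build zero_group tt id (fun _ _ => tt)
  (fun _ _ _ => zero_groupP _ _) (fun _ _ => zero_groupP _ _)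
  (fun _ => zero_groupP _ _) (fun _ => zero_groupP _ _).

Record cplx := Cplx {
  cob :> nat -> zmodType;
  cd : forall n, {additive cob n -> cob n.+1};
  cdd : forall n x, cd n.+1 (cd n x) = 0 }.

(** The term of degree [n - 1], zero for [n = 0]: boundaries and cones get a description uniform in
    [n]. *)
Definition prevt (C : cplx) (n : nat) : zmodType :=
  if n is m.+1 then C m else zero_group.

Definition zeroadd (U V : zmodType) : {additive U -> V} :=
  @mkadd U V (fun=> 0) (fun _ _ => esym (addr0 0)).

Lemma zeroaddE (U V : zmodType) x : zeroadd U V x = 0.
Proof. exact: mkaddE. Qed.

Definition prevd (C : cplx) (n : nat) : {additive prevt C n -> C n} :=
  match n return {additive prevt C n -> C n} with
  | 0 => zeroadd _ _
  | m.+1 => cd C m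
  end.

Lemma cd_prevd (C : cplx) n x : cd C n (prevd C n x) = 0.
Proof. by case: n x => [|n] x /=; rewrite ?zeroaddE ?raddf0 ?cdd. Qed.

Definition bdry (C : cplx) n (b : C n) := exists a, prevd C n a = b.

Lemma bdry_add (C : cplx) n (b b' : C n) : bdry b -> bdry b' -> bdry (b + b').
Proof. by case=> a <- [a' <-]; exists (a + a'); rewrite raddfD. Qed.

Lemma bdry_opp (C : cplx) n (b : C n) : bdry b -> bdry (- b).
Proof. by case=> a <-; exists (- a); rewrite raddfN. Qed.

Lemma bdry_sub (C : cplx) n (b b' : C n) : bdry b -> bdry b' -> bdry (b - b').
Proof. by move=> h h'; exact/bdry_add/bdry_opp. Qed.

Lemma bdry0 (C : cplx) n : @bdry C n 0.
Proof. by exists 0; rewrite raddf0. Qed.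

Lemma bdry_zero (C : cplx) (b : C 0%N) : bdry b -> b = 0.
Proof. by case=> a <-; exact: zeroaddE. Qed.

Lemma eq_bdry (C : cplx) n (b b' : C n) : b = b' -> bdry (b - b').
Proof. by move=> ->; rewrite subrr; exact: bdry0. Qed.

Definition exact_at (C : cplx) n := forall x, cd C n x = 0 -> bdry x.

Record cmap (C D : cplx) := Cmap {
  cm :> forall n, {additive C n -> D n};
  cmd : forall n x, cm n.+1 (cd C n x) = cd D n (cm n x) }.

Definition prevm (C D : cplx) (f : cmap C D) n : {additive prevt C n -> prevt D n} :=
  match n return {additive prevt C n -> prevt D n} with
  | 0 => zeroadd _ _
  | m.+1 => f m
  end.

Lemma prevmd (C D : cplx) (f : cmap C D) n x :
  f n (prevd C n x) = prevd D n (prevm f n x).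
Proof. by case: n x => [|n] x /=; rewrite ?zeroaddE ?raddf0 ?cmd. Qed.

Lemma cmap_bdry (C D : cplx) (f : cmap C D) n x : bdry x -> bdry (f n x).
Proof. by case=> a <-; exists (prevm f n a); rewrite prevmd. Qed.

(** Injectivity and, below, surjectivity on the [n]-th cohomology, stated on cycles and boundaries
    so that no quotient is formed. *)
Definition qis_inj (C D : cplx) (f : cmap C D) n :=
  forall x, cd C n x = 0 -> bdry (f n x) -> bdry x.

Definition qis_surj (C D : cplx) (f : cmap C D) n :=
  forall y, cd D n y = 0 -> exists2 x, cd C n x = 0 & bdry (y - f n x).

Definition qis_at (C D : cplx) (f : cmap C D) n := qis_inj f n /\ qis_surj f n.

Definition qis (C D : cplx) (f : cmap C D) := forall n, qis_at f n.

Definition cmap_comp (C D E : cplx) (g : cmap D E) (f : cmap C D) : cmap C E.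
Proof.
exists (fun n => (g n \o f n : {additive _ -> _})) => n x /=.
by rewrite !cmd.
Defined.

Lemma qis_at_comp (C D E : cplx) (g : cmap D E) (f : cmap C D) n :
  qis_at f n -> qis_at g n -> qis_at (cmap_comp g f) n.
Proof.
move=> [fi fs] [gi gs]; split=> [x x0 h|y y0].
  by apply: fi => //; apply: gi => //; rewrite -cmd x0 raddf0.
have [z z0 hz] := gs y y0; have [x x0 hx] := fs z z0.
exists x => //=; have -> : y - g n (f n x) = (y - g n z) + g n (z - f n x).
  by rewrite raddfB addrA subrK.
exact/bdry_add/cmap_bdry.
Qed.

Lemma qis_at_ext (C D : cplx) (f g : cmap C D) n :
  (forall x, f n x = g n x) -> qis_at f n -> qis_at g n.
Proof.
move=> fg [fi fs]; split=> [x x0|y y0]; first by rewrite -fg; exact: fi.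
by have [x x0 h] := fs y y0; exists x => //; rewrite -fg.
Qed.

Lemma qis_at_cancel (C D E : cplx) (g : cmap D E) (f : cmap C D) n :
  qis_at f n -> qis_at (cmap_comp g f) n -> qis_at g n.
Proof.
move=> [fi fs] [gi gs]; split=> [y y0 h|z z0].
  have [x x0 hx] := fs y y0.
  rewrite -[y](subrK (f n x)); apply: bdry_add => //; apply: cmap_bdry.
  apply: gi => //=; have -> : g n (f n x) = g n y - g n (y - f n x).
    by rewrite raddfB opprB addrC subrK.
  by apply: bdry_sub => //; exact: cmap_bdry.
have [x x0 h] := gs z z0; exists (f n x) => //.
by rewrite -cmd x0 raddf0.
Qed.

Lemma qis_at_cancel_left (C D E : cplx) (g : cmap D E) (f : cmap C D) n :
  qis_at g n -> qis_at (cmap_comp g f) n -> qis_at f n.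
Proof.
move=> [gi gs] [hi hs]; split=> [x x0 h|y y0].
  by apply: hi => //=; exact: cmap_bdry.
have [|x x0 h] := hs (g n y); first by rewrite -cmd y0 raddf0.
exists x => //; apply: gi; first by rewrite raddfB y0 -cmd x0 raddf0 subrr.
by rewrite raddfB.
Qed.

Section Cone.
Variables (C D : cplx) (f : cmap C D).

(** The mapping cone of [f], shifted by one so as to start in degree 0. *)
Definition cone_ob n : zmodType := (C n * prevt D n)%type.

Definition cone_d n : {additive cone_ob n -> cone_ob n.+1}.
Proof.
apply: (@mkadd (cone_ob n) (cone_ob n.+1)
  (fun x => (cd C n x.1, f n x.1 - prevd D n x.2))) => x y.
rewrite -[RHS]/(_ + _, _ + _) -[(x + y).1]/(x.1 + y.1) -[(x + y).2]/(x.2 + y.2).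
by rewrite !raddfD; congr pair; exact: addrACA.
Defined.

Lemma cone_dE n x : cone_d n x = (cd C n x.1, f n x.1 - prevd D n x.2).
Proof. exact: mkaddE. Qed.

Definition cone : cplx.
Proof.
exists cone_ob cone_d => n x; rewrite !cone_dE.
by congr pair; rewrite /= ?cdd // raddfB cmd cd_prevd subr0 subrr.
Defined.

Lemma cone_exact : qis f -> forall n, exact_at cone n.
Proof.
move=> fq n [x y]; rewrite [cd _ _ _]cone_dE /= => -[x0 /eqP].
rewrite subr_eq0 => /eqP fxy.
have [fi _] := fq n; have [|a ax] := fi x x0; first by exists y; rewrite fxy.
case: n a y x x0 fxy {fi} ax => [|n] /= a y x x0 fxy ax.
  exists tt; rewrite -ax /= !zeroaddE; congr pair; exact: zero_groupP.
have [_ fs] := fq n.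
(* [y - f a] is a cycle of [D] one degree lower; surjectivity there corrects the primitive [a] of
   [x] by a cycle [b] of [C]. *)
have [|b b0 [c hc]] := fs (y - f n a).
  by rewrite raddfB -fxy -cmd ax subrr.
exists (a + b, - c) => /=; rewrite cone_dE; congr pair.
  by rewrite /= raddfD ax b0 addr0.
by rewrite /= raddfN opprK raddfD hc addrC -[y - _ - _]addrA -opprD subrK.
Qed.

Lemma exact_cone : (forall n, exact_at cone n) -> qis f.
Proof.
move=> fe n; split=> [x x0 [y yx]|y y0].
  have [|a ax] := fe n (x, y); first by rewrite [LHS]cone_dE /= x0 yx subrr.
  case: n x x0 y yx a ax => [|n] x x0 y yx /= a.
    by rewrite zeroaddE => -[<- _]; exact: bdry0.
  by rewrite cone_dE => -[<- _]; exists a.1.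
have [|[a b] /=] := fe n.+1 (0, y).
  by rewrite [LHS]cone_dE /= raddf0 y0 raddf0 subr0.
rewrite cone_dE /= => -[a0 ab]; exists a => //.
by rewrite -ab addrC addKr; apply: bdry_opp; exists b.
Qed.

End Cone.

Record acx (A : comPzRingType) := Acx {
  acc :> cplx;
  aca : forall n, act A (acc n);
  acE : forall n, equiv (aca n) (aca n.+1) (cd acc n) }.

Arguments acE [A] a n.

Definition zeroact (A : comPzRingType) : act A zero_group :=
  @Act A zero_group (fun _ x => x) (fun _ _ _ => zero_groupP _ _)
    (fun _ _ _ => erefl) (fun _ _ _ => erefl) (fun _ => erefl).

Definition preva (A : comPzRingType) (C : acx A) n : act A (prevt C n) :=
  match n return act A (prevt C n) with
  | 0 => zeroact A
  | m.+1 => aca C m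
  end.

Lemma prevd_equiv (A : comPzRingType) (C : acx A) n :
  equiv (preva C n) (aca C n) (prevd C n).
Proof.
by case: n => [|n] a x /=; [rewrite zeroaddE act0 | exact: acE].
Qed.

Section Ltc.
Variables (R : Type) (L : zmodType) (sL : R -> L -> L) (C : cplx).
Variables (r : forall n, R -> C n -> C n).
Hypothesis rE : forall n, equiv (@r n) (@r n.+1) (cd C n).

Definition ltc : cplx.
Proof.
exists (fun n => tensor sL (@r n)) (fun n => lmap sL (@rE n)) => n x.
by tens_elim x l c; rewrite !tmapE cdd (balanced0r (balanced_tpure _ _)).
Defined.

End Ltc.

Section LtcMap.
Variables (R : Type) (L : zmodType) (sL : R -> L -> L) (C D : cplx).
Variables (r : forall n, R -> C n -> C n) (q : forall n, R -> D n -> D n).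
Hypothesis rE : forall n, equiv (@r n) (@r n.+1) (cd C n).
Hypothesis qE : forall n, equiv (@q n) (@q n.+1) (cd D n).
Variable f : cmap C D.
Hypothesis fE : forall n, equiv (@r n) (@q n) (f n).

Definition ltcm : cmap (ltc sL rE) (ltc sL qE).
Proof.
exists (fun n => lmap sL (@fE n)) => n x.
by tens_elim x l c; rewrite !tmapE cmd.
Defined.

End LtcMap.

Lemma ltc_bdry (A : comPzRingType) (L : zmodType) (sL : act A L) (C : acx A) n
  (pE : equiv (preva C n) (aca C n) (prevd C n)) w :
  @bdry (ltc sL (acE C)) n (lmap sL pE w).
Proof.
case: n pE w => [|n] pE w.
  exists 0; rewrite raddf0; apply/esym.
  by tens_elim w l c; rewrite tmapE /= zeroaddE (balanced0r (balanced_tpure _ _)).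
by exists w; tens_elim w l c; rewrite /= !tmapE.
Qed.

(** [d] is factored through its image: right exactness applies to the surjection onto the image,
    flatness to the inclusion of the image. *)
Lemma flat_exact (A : comPzRingType) (L M' M M'' : zmodType) (sL : act A L)
  (s' : act A M') (s : act A M) (s'' : act A M'')
  (i : {additive M' -> M}) (d : {additive M -> M''})
  (iE : equiv s' s i) (dE : equiv s s'' d) : mflat sL ->
  (forall x, d x = 0 -> exists y, i y = x) ->
  forall x, lmap sL dE x = 0 -> exists w, lmap sL iE w = x.
Proof.
move=> Lf die x dx0.
have d_im y : img d (d y) by exists y.
pose p := sgcod d_im.
have pE : equiv s (subact (img_act dE)) p by exact: sgcod_equiv.
have psurj y : exists z, p z = y.
  have [z hz] := sgvalP y; exists z; apply: sgval_inj.
  by rewrite sgcodE.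
have pe y : p y = 0 -> exists z, i z = y.
  by move=> /(congr1 (@sgval _ _)); rewrite sgcodE raddf0; exact: die.
have px0 : lmap sL pE x = 0.
  apply: (Lf _ _ _ _ _ (sgval_equiv (img_act dE)) (@sgval_inj _ _)).
  by rewrite -dx0; clear dx0; tens_elim x l c; rewrite !tmapE sgcodE.
exact: (lmap_exact iE psurj pe px0).
Qed.

Lemma ltc_exact_flat (A : comPzRingType) (L : zmodType) (sL : act A L) (C : acx A) n :
  mflat sL -> exact_at C n -> exact_at (ltc sL (acE C)) n.
Proof.
move=> Lf Ce x /(flat_exact (@prevd_equiv _ C n) Lf Ce)[w <-].
exact: ltc_bdry.
Qed.

Section FlatBounded.
Variables (A : comPzRingType) (T : acx A) (m b : nat).
Hypothesis Tflat : forall n, mflat (aca T n).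
Hypothesis Tbound : forall n, (b <= n)%N -> forall x : T n, x = 0.
Hypothesis Texact : forall n, (m < n)%N -> exact_at T n.

Notation Z n := (kerg (cd T n)).
Notation Zact n := (subact (kerg_act (acE T n))).

Lemma cycle_closed n x : Z n.+1 (cd T n x).
Proof. exact: cdd. Qed.

Definition to_cycle n : {additive T n -> subg (Z n.+1)} :=
  sgcod (@cycle_closed n).

Lemma to_cycle_equiv n : equiv (aca T n) (Zact n.+1) (to_cycle n).
Proof. by apply: sgcod_equiv; exact: acE. Qed.

Lemma to_cycle_surj n y : (m <= n)%N -> exists x, to_cycle n x = y.
Proof.
move=> mn; have [//|x hx] := @Texact n.+1 _ _ (sgvalP y).
by exists x; apply: sgval_inj; rewrite sgcodE.
Qed.

Lemma to_cycle0 n (x : subg (Z n)) : to_cycle n (sgval _ x) = 0.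
Proof. by apply: sgval_inj; rewrite sgcodE raddf0; exact: (sgvalP x). Qed.

Lemma to_cycle_exact n x : to_cycle n x = 0 -> exists y : subg (Z n), sgval _ y = x.
Proof.
move=> /(congr1 (@sgval _ _)); rewrite sgcodE raddf0 => x0.
by exists (sgmk (x0 : Z n x)).
Qed.

(** Descending induction from the bound [b]: for [n >= m] the cycles of degree [n] are the kernel of
    the surjection of [T n] onto the cycles of degree [n + 1], and both of these are flat. *)
Lemma cycles_flat n : (m <= n)%N -> mflat (Zact n).
Proof.
have [j] := ubnP (b - n); elim: j n => // j IHj n hj mn.
have [bn|nb] := leqP b n.
  by apply: mflat_trivial => x; apply: sgval_inj; rewrite raddf0; exact: Tbound.
refine (mflat_kernel (sgval_equiv (kerg_act (acE T n))) (@to_cycle_equiv n)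
  (@sgval_inj _ _) (fun y => to_cycle_surj y mn) (@to_cycle0 n)
  (@to_cycle_exact n) _ _) => //.
apply: IHj; last exact: leqW.
by rewrite subnS; move: nb hj; rewrite -subn_gt0; case: (b - n)%N.
Qed.

Variables (k : comPzRingType) (g : {rmorphism k -> A}) (N : zmodType) (t : act k N).

(** The quotient of [T n] by its cycles is the flat module of cycles of degree [n + 1]. *)
Lemma cycles_inj n (mn : (m <= n)%N) z :
  lmap t (equiv_restr g (sgval_equiv (kerg_act (acE T n)))) z = 0 -> z = 0.
Proof.
move=> h; refine (lmap_inj_base (@to_cycle_equiv n) (@sgval_inj _ _)
  (fun y => to_cycle_surj y mn) (@to_cycle0 n) (@to_cycle_exact n) _ h).
by apply: cycles_flat; exact: leqW.
Qed.

Definition ltcr : cplx :=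
  ltc t (r := fun n => restr g (aca T n)) (fun n => equiv_restr g (acE T n)).

(** The cycles of degree [n + 1] tensored with [N] embed into [N (x) T (n + 1)], so [x] already dies
    there; right exactness does the rest. *)
Lemma cycles_surj n (mn : (m <= n)%N) (x : ltcr n) : cd ltcr n x = 0 ->
  exists w, lmap t (equiv_restr g (sgval_equiv (kerg_act (acE T n)))) w = x.
Proof.
move=> dx0; refine (lmap_exact (pE := equiv_restr g (@to_cycle_equiv n)) _
  (fun y => to_cycle_surj y mn) (@to_cycle_exact n) _).
apply: (cycles_inj (n := n.+1) (leqW mn)); rewrite -dx0; clear dx0.
by tens_elim x l c; rewrite !tmapE sgcodE.
Qed.

(** With flat cycles, the short exact sequences into which [T] is cut stay exact under [N (x)_k -],
    for every [k]-module [N]. *)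
Lemma ltcr_exact n : (m < n)%N -> exact_at ltcr n.
Proof.
case: n => // n mn x /(cycles_surj (ltnW mn))[w wE].
have pE := equiv_restr g (@to_cycle_equiv n).
have [v vE] := lmap_surj (sL := t) pE (fun y => to_cycle_surj y mn) w.
exists v; rewrite -wE -vE; clear vE.
by tens_elim v l c; rewrite !tmapE sgcodE.
Qed.

Lemma ltcr_exact0 : m = 0%N -> exact_at T 0 -> exact_at ltcr 0.
Proof.
move=> m0 T0 x /(cycles_surj _)[|w wE]; first by rewrite m0.
exists 0; rewrite raddf0 -wE; clear wE; apply/esym.
tens_elim w l c; rewrite tmapE.
have [a] := T0 _ (sgvalP c); rewrite zeroaddE => <-.
by rewrite (balanced0r (balanced_tpure _ _)).
Qed.

End FlatBounded.

Section PairAction.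
Variables (A : comPzRingType) (M N : zmodType) (s : act A M) (t : act A N).

Definition actpair : act A (M * N)%type.
Proof.
exists (fun a x => (s a x.1, t a x.2)) => [a b x|a x y|a b x|[x y]] /=.
- by rewrite !actDl.
- by rewrite !actDr.
- by rewrite !actM.
- by rewrite !act1.
Defined.

Lemma pair1D : {morph (fun x : M => (x, 0 : N)) : x y / x + y}.
Proof. by move=> x y; rewrite -[RHS]/(_ + _, _ + _) addr0. Qed.

Lemma pair2D : {morph (fun y : N => (0 : M, y)) : x y / x + y}.
Proof. by move=> x y; rewrite -[RHS]/(_ + _, _ + _) addr0. Qed.

Definition pin1 : {additive M -> (M * N)%type} := mkadd pair1D.
Definition pin2 : {additive N -> (M * N)%type} := mkadd pair2D.
Definition pfst : {additive (M * N)%type -> M} := fst.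
Definition psnd : {additive (M * N)%type -> N} := snd.

Lemma pin1E x : pin1 x = (x, 0). Proof. exact: mkaddE. Qed.
Lemma pin2E x : pin2 x = (0, x). Proof. exact: mkaddE. Qed.

Lemma pin1_equiv : equiv s actpair pin1.
Proof. by move=> a x; rewrite !pin1E /= act0. Qed.

Lemma pin2_equiv : equiv t actpair pin2.
Proof. by move=> a x; rewrite !pin2E /= act0. Qed.

Lemma pfst_equiv : equiv actpair s pfst. Proof. by []. Qed.
Lemma psnd_equiv : equiv actpair t psnd. Proof. by []. Qed.

Lemma mflat_pair : mflat s -> mflat t -> mflat actpair.
Proof.
move=> sf tf; pose F (b : bool) : zmodType := if b then M else N.
pose sF b : act A (F b) := if b as b' return act A (F b') then s else t.
pose p b : {additive (M * N)%type -> F b} :=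
  if b as b' return {additive _ -> F b'} then pfst else psnd.
pose e b : {additive F b -> (M * N)%type} :=
  if b as b' return {additive F b' -> _} then pin1 else pin2.
apply: (@mflat_split _ _ _ bool F sF p e).
- by case.
- by case; [exact: pin1_equiv | exact: pin2_equiv].
- move=> [x y]; rewrite big_bool /= pin1E pin2E.
  by rewrite -[RHS]/(_ + _, _ + _) /= addr0 add0r.
- by case.
Qed.

End PairAction.

Definition cone_acx (A : comPzRingType) (C D : acx A) (f : cmap C D)
  (fE : forall n, equiv (aca C n) (aca D n) (f n)) : acx A.
Proof.
exists (cone f) (fun n => actpair (aca C n) (preva D n)) => n a x.
by rewrite /= !cone_dE /= acE fE prevd_equiv actB.
Defined.

Section TensorQis.
Variables (A : comPzRingType) (C D : acx A) (f : cmap C D).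
Hypothesis fE : forall n, equiv (aca C n) (aca D n) (f n).
Variables (k : comPzRingType) (g : {rmorphism k -> A}) (N : zmodType) (t : act k N).
Definition ltcrm : cmap (ltcr C g t) (ltcr D g t) :=
  @ltcm _ _ t C D _ _ (fun n => equiv_restr g (acE C n))
    (fun n => equiv_restr g (acE D n)) f (fun n => equiv_restr g (@fE n)).

(** Tensoring commutes with cones. The two complexes are not identified: [i1], [i2], [p1], [p2]
    split the tensored cone, and [di1], [di2], [dp1], [dp2] express its differential. *)
Lemma ltcrm_qis_cone :
  (forall n, exact_at (ltcr (cone_acx fE) g t) n) -> qis ltcrm.
Proof.
pose T := cone_acx fE => Ne.
pose i1 n := lmap t (equiv_restr g (pin1_equiv (aca C n) (preva D n))).
pose i2 n := lmap t (equiv_restr g (pin2_equiv (aca C n) (preva D n))).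
pose p1 n := lmap t (equiv_restr g (pfst_equiv (aca C n) (preva D n))).
pose p2 n := lmap t (equiv_restr g (psnd_equiv (aca C n) (preva D n))).
have p1i1 n x : p1 n (i1 n x) = x.
  by tens_elim x l c; rewrite !tmapE pin1E.
have p2i2 n x : p2 n (i2 n x) = x.
  by tens_elim x l c; rewrite !tmapE pin2E.
have p1i2 n x : p1 n (i2 n x) = 0.
  by tens_elim x l c; rewrite !tmapE pin2E (balanced0r (balanced_tpure _ _)).
have p2i1 n x : p2 n (i1 n x) = 0.
  by tens_elim x l c; rewrite !tmapE pin1E (balanced0r (balanced_tpure _ _)).
have di1 n x : cd (ltcr T g t) n (i1 n x) =
    i1 n.+1 (cd (ltcr C g t) n x) + i2 n.+1 (ltcrm n x).
  tens_elim x l c; rewrite !tmapE -tpureDr; congr tpure.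
  by rewrite [LHS]cone_dE pin1E pin2E pin1E -[RHS]/(_ + _, _ + _) /= raddf0 !(addr0, add0r, subr0).
have di2 n x :
    cd (ltcr T g t) n.+1 (i2 n.+1 x) + i2 n.+2 (cd (ltcr D g t) n x) = 0.
  elim/tensor_ind: x => [|l c|u v hu hv]; first by rewrite !raddf0 addr0.
    2: by rewrite !raddfD addrACA hu hv addr0.
  rewrite !tmapE -tpureDr [cd T _ _]cone_dE !pin2E -[(_, _) + _]/(_ + _, _ + _) /= !raddf0.
  by rewrite !(addr0, sub0r) addNr (balanced0r (balanced_tpure _ _)).
have dp1 n x : cd (ltcr C g t) n (p1 n x) = p1 n.+1 (cd (ltcr T g t) n x).
  tens_elim x l c; rewrite !tmapE; congr tpure.
  by rewrite [cd T n c]cone_dE.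
have dp2 n x : p2 n.+2 (cd (ltcr T g t) n.+1 x) +
    cd (ltcr D g t) n (p2 n.+1 x) = ltcrm n.+1 (p1 n.+1 x).
  elim/tensor_ind: x => [|l c|u v hu hv]; first by rewrite !raddf0 addr0.
    by rewrite !tmapE -tpureDr [cd T n.+1 c]cone_dE /= subrK.
  by rewrite !raddfD addrACA hu hv.
move=> n; split=> [x x0 [y yx]|y y0].
  case: n x x0 y yx => [|n] x x0 y yx.
    have [|a] := Ne 0 (i1 0 x).
      by rewrite di1 x0 -yx /= zeroaddE !raddf0 addr0.
    rewrite /= zeroaddE => /(congr1 (p1 0)); rewrite p1i1 raddf0 => <-.
    exact: bdry0.
  have [|a ax] := Ne n.+1 (i1 n.+1 x + i2 n.+1 y).
    by rewrite raddfD di1 x0 raddf0 add0r -yx addrC di2.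
  exists (p1 n a); rewrite [LHS]dp1 -[cd _ _ _]/(prevd (ltcr T g t) n.+1 a) ax.
  by rewrite raddfD p1i1 p1i2 addr0.
have [|a /= ay] := Ne n.+1 (i2 n.+1 y).
  by have := di2 n y; rewrite y0 raddf0 addr0.
exists (p1 n a); first by rewrite dp1 ay p1i2.
have -> : y = p2 n.+1 (cd (ltcr T g t) n a) by rewrite ay p2i2.
case: n y y0 a ay => [|n] y _ a _.
  suff -> : p2 1 (cd (ltcr T g t) 0 a) = ltcrm 0 (p1 0 a).
    by rewrite subrr; exact: bdry0.
  tens_elim a l c; rewrite !tmapE; congr tpure.
  by rewrite [cd T 0 c]cone_dE /= zeroaddE subr0.
by rewrite -dp2 opprD addNKr; apply: bdry_opp; exists (p2 n.+1 a).
Qed.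

(** The cone is a bounded exact complex of flat [A]-modules, hence stays exact after tensoring over
    [k]. *)
Lemma ltcrm_qis (b : nat) :
  (forall n, mflat (aca C n)) -> (forall n, mflat (aca D n)) ->
  (forall n, (b <= n)%N -> forall x : C n, x = 0) ->
  (forall n, (b <= n)%N -> forall x : D n, x = 0) -> qis f -> qis ltcrm.
Proof.
move=> Cflat Dflat Cbound Dbound fq; apply: ltcrm_qis_cone => n.
pose T := cone_acx fE.
have Tflat m : mflat (aca T m).
  apply: mflat_pair => //; case: m => [|m] //=.
  by apply: mflat_trivial => x; exact: zero_groupP.
(* One more than [b], since the cone shifts [D] by one degree. *)
have Tbound m : (b.+1 <= m)%N -> forall x : T m, x = 0.
  case: m => // m bm [x y]; congr pair; first by rewrite [LHS]Cbound // leqW.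
  by rewrite [LHS]Dbound.
have Te m : exact_at T m by exact: cone_exact.
have [n0|n0] := posnP n; last exact: (ltcr_exact (m := 0) Tflat Tbound).
by rewrite n0; apply: (ltcr_exact0 (m := 0) Tflat Tbound).
Qed.

End TensorQis.

Lemma ltcm_qis_flat (A : comPzRingType) (C D : acx A) (f : cmap C D)
  (fE : forall n, equiv (aca C n) (aca D n) (f n)) (L : zmodType) (sL : act A L) :
  mflat sL -> qis f -> qis (@ltcm _ _ sL C D _ _ (acE C) (acE D) f fE).
Proof.
move=> Lf fq.
(* [L (x)_A -] is the case [k = A], [g = idfun], where flatness of [L] makes the tensored cone
   exact. *)
have h : qis (ltcrm fE idfun sL).
  apply: ltcrm_qis_cone => n.
  have := ltc_exact_flat (C := cone_acx fE) Lf (@cone_exact _ _ _ fq n).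
  move: (acE (cone_acx fE)) => pf.
  by rewrite (Prop_irrelevance pf (fun n => equiv_restr idfun (acE (cone_acx fE) n))).
pose r n := restr idfun (aca C n); pose q n := restr idfun (aca D n).
have h' (rE : forall n, equiv (r n) (r n.+1) (cd C n))
    (qE : forall n, equiv (q n) (q n.+1) (cd D n))
    (gE : forall n, equiv (r n) (q n) (f n)) : qis (ltcm sL rE qE gE).
  rewrite (Prop_irrelevance rE (fun n => equiv_restr idfun (acE C n))).
  rewrite (Prop_irrelevance qE (fun n => equiv_restr idfun (acE D n))).
  by rewrite (Prop_irrelevance gE (fun n => equiv_restr idfun (@fE n))).
exact: h'.
Qed.

(** * Base change of complexes *)

Section TensorActionRight.
Variables (A : comPzRingType) (R : Type) (M N : zmodType).
Variables (sM : R -> M -> M) (sN : R -> N -> N) (s : act A N).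
Hypothesis comm : forall a, equiv sN sN (actadd s a).

Definition tactr : act A (tensor sM sN).
Proof.
exists (fun a => lmap sM (comm a)) => [a b x|a x y|a b x|x].
- elim/tensor_ind: x => [|m n|y z hy hz]; first by rewrite !raddf0 addr0.
    by rewrite !tmapE -tpureDr !actaddE actDl.
  by rewrite !raddfD hy hz addrACA.
- by rewrite raddfD.
- by tens_elim x m n; rewrite !tmapE !actaddE actM.
- by tens_elim x m n; rewrite tmapE actaddE act1.
Defined.

Lemma tactrE a m n : tactr a (tpure sM sN m n) = tpure sM sN m (s a n).
Proof. by rewrite /= tmapE actaddE. Qed.

End TensorActionRight.

Lemma restr_comm (k A : comPzRingType) (g : {rmorphism k -> A}) (M : zmodType)
  (s : act A M) a : equiv (restr g s) (restr g s) (actadd s a).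
Proof. by move=> c x; rewrite !actaddE /= actC. Qed.

Definition nact (k A : comPzRingType) (g : {rmorphism k -> A}) (N M : zmodType)
  (t : act k N) (s : act A M) : act A (tensor t (restr g s)) :=
  tactr t (restr_comm g s).

Lemma nactE (k A : comPzRingType) (g : {rmorphism k -> A}) (N M : zmodType)
  (t : act k N) (s : act A M) a n m :
  nact g t s a (tpure t (restr g s) n m) = tpure t (restr g s) n (s a m).
Proof. exact: tactrE. Qed.

Lemma nact_map (k A : comPzRingType) (g : {rmorphism k -> A}) (N M M' : zmodType)
  (t : act k N) (s : act A M) (s' : act A M') (u : {additive M -> M'})
  (uE : equiv s s' u) :
  equiv (nact g t s) (nact g t s') (lmap t (equiv_restr g uE)).
Proof. by move=> a x; tens_elim x n m; rewrite !(nactE, tmapE) uE. Qed.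

Definition ntens (k A : comPzRingType) (g : {rmorphism k -> A}) (N : zmodType)
  (t : act k N) (C : acx A) : acx A :=
  @Acx A (ltcr C g t) (fun n => nact g t (aca C n)) (fun n => nact_map (acE C n)).

Section BaseChange.
Variables (A B : comPzRingType) (f : {rmorphism A -> B}).

Section Map.
Variables (M N : zmodType) (s : act A M) (t : act B N) (u : {additive M -> N}).
Hypothesis uE : equiv s (restr f t) u.

Lemma bcmap_balanced : balanced (ralg f) s (fun b m => t b (u m)).
Proof.
split=> [b b' m|b m m'|a b m]; first exact: actDl.
  by rewrite raddfD actDr.
by rewrite uE /= actM mulrC.
Qed.

Definition bcmap : {additive tensor (ralg f) s -> N} := tliftA bcmap_balanced.

Lemma bcmapE b m : bcmap (tpure (ralg f) s b m) = t b (u m).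
Proof. exact: tliftAE. Qed.

Lemma bcmap_equiv : equiv (bact f s) t bcmap.
Proof. by move=> b x; tens_elim x b' m; rewrite tactE !bcmapE actM. Qed.

End Map.

Definition bcx (P : acx A) : acx B :=
  @Acx B (ltc (ralg f) (acE P)) (fun n => bact f (aca P n))
    (fun n => tact_map (balg_comm f) (acE P n)).

Variables (P : acx A) (Q : acx B) (h : cmap P Q).

Definition semilin := forall n, equiv (aca P n) (restr f (aca Q n)) (h n).

(** The map [B (x)_A P -> Q] adjoint to [h]; base change holds when it is a quasi-isomorphism. *)
Definition bcm (hE : semilin) : cmap (bcx P) Q.
Proof.
exists (fun n => bcmap (hE n)) => n x.
by tens_elim x b m; rewrite tmapE !bcmapE cmd acE.
Defined.

End BaseChange.

Lemma qis_iso (C D : cplx) (f : cmap C D) (g : cmap D C) :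
  (forall n x, g n (f n x) = x) -> (forall n x, f n (g n x) = x) -> qis f.
Proof.
move=> gf fg n; split=> [x x0 h|y y0].
  by rewrite -[x]gf; exact: cmap_bdry.
exists (g n y); first by rewrite -cmd y0 raddf0.
by rewrite fg subrr; exact: bdry0.
Qed.

Section Exchange.
Variables (k A B : comPzRingType) (g : {rmorphism k -> A}) (f : {rmorphism A -> B}).
Variables (g' : {rmorphism k -> B}) (fg : forall c, f (g c) = g' c).
Variables (N M : zmodType) (t : act k N) (s : act A M).

Lemma exchange_balanced1 b : balanced t (restr g s)
  (fun n m => tpure t (restr g' (bact f s)) n (tpure (ralg f) s b m)).
Proof.
split=> [n n' m|n m m'|c n m]; rewrite ?tpureDl ?tpureDr //.
rewrite tpureZ [restr _ _ _ _]tactE; congr tpure.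
by rewrite -[restr g s c m]/(s (g c) m) -tpureZ /= fg.
Qed.

Lemma exchange_balanced : balanced (ralg f) (nact g t s)
  (fun b z => tliftA (exchange_balanced1 b) z).
Proof.
split=> [b b' z|b z z'|a b z].
- by tens_elim z n m; rewrite !tliftAE tpureDl tpureDr.
- exact: raddfD.
- by tens_elim z n m; rewrite nactE !tliftAE tpureZ.
Qed.

(** The isomorphism of [B (x)_A (N (x)_k M)] with [N (x)_k (B (x)_A M)]. *)
Definition exchange : {additive tensor (ralg f) (nact g t s) ->
  tensor t (restr g' (bact f s))} := tliftA exchange_balanced.

Lemma exchangeE b n m : exchange (tpure _ _ b (tpure _ _ n m)) =
  tpure t (restr g' (bact f s)) n (tpure (ralg f) s b m).
Proof. by rewrite !tliftAE. Qed.

Lemma unexchange_balanced1 n : balanced (ralg f) s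
  (fun b m => tpure (ralg f) (nact g t s) b (tpure t (restr g s) n m)).
Proof.
split=> [b b' m|b m m'|a b m]; rewrite ?tpureDl ?tpureDr //.
by rewrite tpureZ nactE.
Qed.

Lemma unexchange_balanced : balanced t (restr g' (bact f s))
  (fun n z => tliftA (unexchange_balanced1 n) z).
Proof.
split=> [n n' z|n z z'|c n z].
- by tens_elim z b m; rewrite !tliftAE tpureDl tpureDr.
- exact: raddfD.
- tens_elim z b m; rewrite [restr _ _ _ _]tactE !tliftAE [tpure t _ _ _]tpureZ.
  by rewrite -[restr g s c m]/(s (g c) m) -nactE -tpureZ /= fg.
Qed.

Definition unexchange : {additive tensor t (restr g' (bact f s)) ->
  tensor (ralg f) (nact g t s)} := tliftA unexchange_balanced.

Lemma unexchangeE b n m : unexchange (tpure _ _ n (tpure _ _ b m)) =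
  tpure (ralg f) (nact g t s) b (tpure t (restr g s) n m).
Proof. by rewrite !tliftAE. Qed.

Lemma exchangeK : cancel exchange unexchange.
Proof.
move=> x; elim/tensor_ind: x => [|b z|y z hy hz]; rewrite ?raddf0 //; last first.
  by rewrite !raddfD hy hz.
elim/tensor_ind: z => [|n m|y z hy hz].
- by rewrite (balanced0r (balanced_tpure _ _)) !raddf0.
- by rewrite exchangeE unexchangeE.
- by rewrite tpureDr !raddfD hy hz.
Qed.

Lemma unexchangeK : cancel unexchange exchange.
Proof.
move=> x; elim/tensor_ind: x => [|n z|y z hy hz]; rewrite ?raddf0 //; last first.
  by rewrite !raddfD hy hz.
elim/tensor_ind: z => [|b m|y z hy hz].
- by rewrite (balanced0r (balanced_tpure _ _)) !raddf0.
- by rewrite unexchangeE exchangeE.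
- by rewrite tpureDr !raddfD hy hz.
Qed.

End Exchange.

Section ExchangeComplex.
Variables (k A B : comPzRingType) (g : {rmorphism k -> A}) (f : {rmorphism A -> B}).
Variables (g' : {rmorphism k -> B}) (fg : forall c, f (g c) = g' c).
Variables (N : zmodType) (t : act k N) (P : acx A).

Definition exchange_cmap : cmap (bcx f (ntens g t P)) (ltcr (bcx f P) g' t).
Proof.
exists (fun n => exchange fg t (aca P n)) => n x.
elim/tensor_ind: x => [|b z|y z hy hz]; last by rewrite !raddfD hy hz.
  by rewrite !raddf0.
elim/tensor_ind: z => [|l m|y z hy hz].
- by rewrite (balanced0r (balanced_tpure _ _)) !raddf0.
- by rewrite !tmapE !exchangeE !tmapE.
- by rewrite tpureDr !raddfD hy hz.
Defined.

Definition unexchange_cmap : cmap (ltcr (bcx f P) g' t) (bcx f (ntens g t P)).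
Proof.
exists (fun n => unexchange fg t (aca P n)) => n x.
elim/tensor_ind: x => [|b z|y z hy hz]; last by rewrite !raddfD hy hz.
  by rewrite !raddf0.
elim/tensor_ind: z => [|l m|y z hy hz].
- by rewrite (balanced0r (balanced_tpure _ _)) !raddf0.
- by rewrite !tmapE !unexchangeE !tmapE.
- by rewrite tpureDr !raddfD hy hz.
Defined.

Lemma exchange_qis : qis exchange_cmap.
Proof.
apply: (@qis_iso _ _ _ unexchange_cmap) => n x; [exact: exchangeK|exact: unexchangeK].
Qed.

Variables (Q : acx B) (h : cmap P Q) (hE : semilin f h).

Lemma semilin_equiv_restr n :
  equiv (restr g (aca P n)) (restr g' (aca Q n)) (h n).
Proof. by move=> c x /=; rewrite hE /= fg. Qed.

Definition ntensm : cmap (ntens g t P) (ntens g' t Q) :=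
  @ltcm _ _ t P Q _ _ (fun n => equiv_restr g (acE P n))
    (fun n => equiv_restr g' (acE Q n)) h semilin_equiv_restr.

Lemma ntensm_semilin : semilin f ntensm.
Proof.
move=> n a x; tens_elim x l m.
by rewrite [aca _ _ _ _]nactE !tmapE [restr _ _ _ _]nactE hE.
Qed.

Variable b : nat.
Hypothesis Pflat : forall n, mflat (aca P n).
Hypothesis Qflat : forall n, mflat (aca Q n).
Hypothesis Pbound : forall n, (b <= n)%N -> forall x : P n, x = 0.
Hypothesis Qbound : forall n, (b <= n)%N -> forall x : Q n, x = 0.

(** Up to [exchange] the map is [N (x)_k -] applied to [bcm hE], a quasi-isomorphism between bounded
    complexes of flat [B]-modules. *)
Lemma bcm_ntens_qis : qis (bcm hE) -> qis (bcm ntensm_semilin).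
Proof.
move=> hq.
have Eh n : equiv (aca (bcx f P) n) (aca Q n) (bcm hE n) by exact: bcmap_equiv.
have q1 : qis (ltcrm Eh g' t).
  apply: (@ltcrm_qis _ _ _ _ _ _ _ _ _ b) => // [n|n bn x].
    exact: mflat_base.
  elim/tensor_ind: x => [//|c m|y z -> ->]; last exact: addr0.
  by rewrite [m]Pbound // (balanced0r (balanced_tpure _ _)).
move=> n; apply: (@qis_at_ext _ _ (cmap_comp (ltcrm Eh g' t) exchange_cmap)).
  elim/tensor_ind => [|c z|y z hy hz]; rewrite ?raddf0 //; last first.
    by rewrite !raddfD hy hz.
  elim/tensor_ind: z => [|l m|y z hy hz].
  - by rewrite (balanced0r (balanced_tpure _ _)) !raddf0.
  - by rewrite bcmapE tmapE [RHS]nactE [LHS]/= exchangeE tmapE bcmapE.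
  - by rewrite tpureDr !raddfD hy hz.
apply: qis_at_comp; first exact: exchange_qis.
exact: q1.
Qed.

End ExchangeComplex.

Section BaseChangeTransfer.
Variables (A B : comPzRingType) (f : {rmorphism A -> B}).
Variables (P P' : acx A) (Q Q' : acx B) (h : cmap P Q) (h' : cmap P' Q').
Variables (hE : semilin f h) (hE' : semilin f h').
Variables (u : cmap P P') (v : cmap Q Q').
Hypothesis uE : forall n, equiv (aca P n) (aca P' n) (u n).
Hypothesis vE : forall n, equiv (aca Q n) (aca Q' n) (v n).
Hypothesis uv : forall n x, h' n (u n x) = v n (h n x).
Hypothesis f_flat : mflat (ralg f).
Hypothesis u_qis : qis u.
Hypothesis v_qis : qis v.

Definition bcxm : cmap (bcx f P) (bcx f P') :=
  @ltcm _ _ (ralg f) P P' _ _ (acE P) (acE P') u uE.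

Lemma bcxm_qis : qis bcxm. Proof. exact: ltcm_qis_flat. Qed.

Lemma bcm_square n x : bcm hE' n (bcxm n x) = v n (bcm hE n x).
Proof. by tens_elim x b m; rewrite tmapE !bcmapE uv vE. Qed.

(** Flatness of [f] makes [B (x)_A u] a quasi-isomorphism, and two-out-of-three applies to the
    square it forms with [v]. *)
Lemma bcm_transfer n : qis_at (bcm hE) n -> qis_at (bcm hE') n.
Proof.
move=> q; apply: (qis_at_cancel (@bcxm_qis n)).
apply: (@qis_at_ext _ _ (cmap_comp v (bcm hE))) => [x|]; first exact/esym/bcm_square.
by apply: qis_at_comp => //; exact: v_qis.
Qed.

Lemma bcm_transfer_inv n : qis_at (bcm hE') n -> qis_at (bcm hE) n.
Proof.
move=> q; apply: (qis_at_cancel_left (@v_qis n)).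
apply: (@qis_at_ext _ _ (cmap_comp (bcm hE') bcxm)) => [x|]; first exact: bcm_square.
by apply: qis_at_comp => //; exact: bcxm_qis.
Qed.

End BaseChangeTransfer.

(** * Flabby complexes on a finite space *)

Definition psub (T : Type) (V V' : pred T) := forall x, V x -> V' x.

(** Defined on all predicates rather than on open sets, which keeps openness proofs out of the
    types. *)
Record opcx (X : ringedSpace) := Opcx {
  ocx :> pred X -> cplx;
  ores : forall V V', psub V' V -> cmap (ocx V) (ocx V');
  ores_comp : forall V V' V'' (h : psub V' V) (h' : psub V'' V') (h'' : psub V'' V)
    n x, ores h' n (ores h n x) = ores h'' n x }.

Record flabby (X : ringedSpace) (F : opcx X) : Prop := Flabby {
  flabby_ext : forall V V' (h : psub V' V) n, is_open V -> is_open V' ->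
    forall y, exists x, ores F h n x = y;
  flabby_sep : forall V V1 V2 (h1 : psub V1 V) (h2 : psub V2 V) n,
    is_open V -> is_open V1 -> is_open V2 -> (forall x, V x -> V1 x || V2 x) ->
    forall x, ores F h1 n x = 0 -> ores F h2 n x = 0 -> x = 0;
  flabby_glue : forall V V1 V2 W (h1 : psub V1 V) (h2 : psub V2 V)
    (w1 : psub W V1) (w2 : psub W V2) n,
    is_open V -> is_open V1 -> is_open V2 -> is_open W ->
    (forall x, V x -> V1 x || V2 x) -> (forall x, V1 x -> V2 x -> W x) ->
    forall x1 x2, ores F w1 n x1 = ores F w2 n x2 ->
    exists x, ores F h1 n x = x1 /\ ores F h2 n x = x2;
  flabby_empty : forall V n, is_open V -> (forall x, ~~ V x) -> forall x : F V n, x = 0 }.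

Lemma is_open_le (X : ringedSpace) (x : X) : is_open (le x).
Proof. by move=> p q pq xp; exact: Defs.le_trans xp pq. Qed.

(* Induction on [V]: remove from [V] the class of a minimal point [y], and glue
   along [V = (V - [y]) u U_y] with the Mayer-Vietoris sequence. *)
Lemma flabby_exact (X : ringedSpace) (F : opcx X) : flabby F ->
  (forall x n, exact_at (F (le x)) n) ->
  forall V, is_open V -> forall n, exact_at (F V) n.
Proof.
move=> Ff Fx V; have [m] := ubnP #|V|; elim: m V => // m IHm V Vm oV n x x0.
have [/existsP[y0 Vy0]|] := boolP [exists y, V y]; last first.
  rewrite negb_exists => /forallP V0.
  by rewrite [x](flabby_empty Ff) //; exact: bdry0.
(* A neighbourhood [U_y] of maximal cardinality makes [y] minimal in [V], up to equivalent
   points. *)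
pose y := [arg max_(z > y0 in V) #|le z|].
have [Vy ymax] : V y /\ forall z, V z -> (#|le z| <= #|le y|)%N.
  by rewrite /y; case: arg_maxnP => // z Vz hz; split.
have ymin z : V z -> le z y -> le y z.
  move=> Vz zy; have sub : (le y : {pred X}) \subset le z.
    by apply/fintype.subsetP => w yw; exact: Defs.le_trans zy yw.
  have e : #|le y| = #|le z|.
    by apply/eqP; rewrite eqn_leq (subset_leq_card sub) ymax.
  have /(_ z) h := elimT (subset_cardP e) sub.
  by apply: (etrans h); exact: Defs.le_refl.
pose V1 : pred X := fun z => V z && ~~ le z y.
pose W : pred X := fun z => V1 z && le y z.
have oV1 : is_open V1.
  move=> p q pq /andP[Vp py]; rewrite /V1 (oV _ _ pq Vp) /=.
  by apply: contra py => qy; exact: Defs.le_trans pq qy.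
have oV2 : is_open (le y) := @is_open_le X y.
have oW : is_open W.
  by move=> p q pq /andP[V1p yp]; rewrite /W (oV1 _ _ pq V1p) (oV2 _ _ pq yp).
have h1 : psub V1 V by move=> z /andP[].
have h2 : psub (le y) V by move=> z yz; exact: oV yz Vy.
have w1 : psub W V1 by move=> z /andP[].
have w2 : psub W (le y) by move=> z /andP[].
have cov z : V z -> V1 z || le y z.
  move=> Vz; rewrite /V1 Vz /=; have [zy|//] := boolP (le z y).
  exact: ymin.
have ltV1 : (#|V1| < m)%N.
  rewrite -ltnS; apply: leq_trans Vm; rewrite ltnS; apply: proper_card.
  apply/properP; split; first by apply/fintype.subsetP => z; exact: h1.
  by exists y => //; rewrite /V1 unfold_in /= Defs.le_refl andbF.
have ltW : (#|W| < m)%N.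
  by apply: leq_ltn_trans ltV1; apply/subset_leq_card/fintype.subsetP => z; exact: w1.
have [|a1 ha1] := IHm V1 ltV1 oV1 n (ores F h1 n x); first by rewrite -cmd x0 raddf0.
have [|a2 ha2] := Fx y n (ores F h2 n x); first by rewrite -cmd x0 raddf0.
have h12 : psub W V by move=> z /w1 /h1.
case: n x x0 a1 ha1 a2 ha2 => [|n] x x0 a1 /= ha1 a2 /= ha2.
  rewrite zeroaddE in ha1; rewrite zeroaddE in ha2.
  by rewrite (flabby_sep Ff oV oV1 oV2 cov (esym ha1) (esym ha2)); exact: bdry0.
have [|e he] := IHm W ltW oW n (ores F w1 n a1 - ores F w2 n a2).
  rewrite raddfB -!cmd ha1 ha2 (ores_comp _ _ h12) (ores_comp _ _ h12).
  by rewrite subrr.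
(* The two primitives differ on [W] by the boundary of [e]; flabbiness extends [e] to [U_y], where
   it corrects the second primitive. *)
have [e' he'] : exists e', prevm (ores F w2) n e' = e.
  case: n e {x x0 a1 a2 ha1 ha2 he} => [|n] e; last exact: (flabby_ext Ff).
  by exists 0; exact: zero_groupP.
have covW z : V1 z -> le y z -> W z by move=> V1z yz; rewrite /W V1z.
have eqW : ores F w1 n a1 = ores F w2 n (a2 + prevd _ n e').
  by rewrite raddfD prevmd he' he addrC subrK.
have [a [ra1 ra2]] := flabby_glue Ff h1 h2 oV oV1 oV2 oW cov covW eqW.
exists a; apply/eqP; rewrite -subr_eq0; apply/eqP.
apply: (flabby_sep Ff (h1 := h1) (h2 := h2)) => //; rewrite raddfB /= cmd.
  by rewrite ra1 ha1 subrr.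
by rewrite ra2 raddfD cd_prevd addr0 ha2 subrr.
Qed.

Record opmap (X : ringedSpace) (F G : opcx X) := Opmap {
  om :> forall V, cmap (F V) (G V);
  om_res : forall V V' (h : psub V' V) n x,
    om V' n (ores F h n x) = ores G h n (om V n x) }.

Section ConeFunctor.
Variables (X : ringedSpace) (F G : opcx X) (f : opmap F G).

Lemma prevm_comp (H : opcx X) V V' V'' (h : psub V' V) (h' : psub V'' V')
  (h'' : psub V'' V) n x :
  prevm (ores H h') n (prevm (ores H h) n x) = prevm (ores H h'') n x.
Proof. by case: n x => [|n] x; [exact: zero_groupP | exact: ores_comp]. Qed.

Lemma cone_res_subproof V V' (h : psub V' V) n :
  {morph (fun x : cone (f V) n => (ores F h n x.1, prevm (ores G h) n x.2)
    : cone (f V') n) : x y / x + y}.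
Proof. by move=> [x x'] [y y']; rewrite /= !raddfD. Qed.

Definition cone_res V V' (h : psub V' V) : cmap (cone (f V)) (cone (f V')).
Proof.
exists (fun n => mkadd (@cone_res_subproof V V' h n)) => n x.
by rewrite !mkaddE /= cmd om_res raddfB prevmd.
Defined.

Lemma cone_resE V V' (h : psub V' V) n x :
  cone_res h n x = (ores F h n x.1, prevm (ores G h) n x.2).
Proof. exact: mkaddE. Qed.

Definition cone_opcx : opcx X.
Proof.
exists (fun V => cone (f V)) cone_res => V V' V'' h h' h'' n x.
by rewrite !cone_resE /= (ores_comp _ _ h'') (prevm_comp _ _ h'').
Defined.

Lemma flabby_cone : flabby F -> flabby G -> flabby cone_opcx.
Proof.
move=> Ff Gf; split.
- move=> V V' h n oV oV' [y y'].
  have [x hx] := flabby_ext Ff h oV oV' y.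
  have [x' hx'] : exists x', prevm (ores G h) n x' = y'.
    by case: n y' {y x hx} => [|n] y'; [exists 0; exact: zero_groupP
      | exact: (flabby_ext Gf)].
  by exists (x, x'); rewrite [LHS]cone_resE /= hx hx'.
- move=> V V1 V2 h1 h2 n oV oV1 oV2 cov [x x'].
  rewrite /= !cone_resE /= => -[x1 x1'] [x2 x2'].
  congr pair; first exact: (flabby_sep Ff oV oV1 oV2 cov x1 x2).
  case: n x' x1' x2' {x x1 x2} => [|n] x' x1' x2'; first exact: zero_groupP.
  exact: (flabby_sep Gf oV oV1 oV2 cov x1' x2').
- move=> V V1 V2 W h1 h2 w1 w2 n oV oV1 oV2 oW cov covW [x1 x1'] [x2 x2'].
  rewrite /= !cone_resE /= => -[e e'].
  have [x [hx1 hx2]] := flabby_glue Ff h1 h2 oV oV1 oV2 oW cov covW e.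
  have [x' [hx1' hx2']] : exists x', prevm (ores G h1) n x' = x1' /\
      prevm (ores G h2) n x' = x2'.
    case: n x1' x2' e' {x1 x2 e x hx1 hx2} => [|n] x1' x2' e'.
      by exists 0; split; exact: zero_groupP.
    exact: (flabby_glue Gf h1 h2 oV oV1 oV2 oW cov covW e').
  by exists (x, x'); rewrite !cone_resE /= hx1 hx2 hx1' hx2'.
- move=> V n oV V0 [x x']; congr pair; first exact: (flabby_empty Ff).
  case: n x' {x} => [|n] x'; first exact: zero_groupP.
  exact: (flabby_empty Gf).
Qed.

(** The cone of [f] is flabby and exact on every [U_x], hence exact on every open set. *)
Lemma flabby_qis : flabby F -> flabby G -> (forall x, qis (f (le x))) ->
  forall V, is_open V -> qis (f V).
Proof.
move=> Ff Gf fx V oV; apply: exact_cone.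
apply: (flabby_exact (F := cone_opcx)) => //; first exact: flabby_cone.
by move=> x; exact: cone_exact.
Qed.

End ConeFunctor.

(* [tr V V'] restricts to the intersection of [V] and [V'] and extends by zero;
   it need not commute with the differential. *)
Section SplitFunctor.
Variables (X : ringedSpace) (F : opcx X).
Variable tr : forall V V' n, {additive F V n -> F V' n}.
Hypothesis tr_res : forall V V' (h : psub V' V) n x, ores F h n x = tr V V' n x.
Hypothesis tr_id : forall V n x, tr V V n x = x.
Hypothesis tr_comp : forall (V V' V'' : pred X) n x,
  is_open V -> is_open V' -> is_open V'' -> (forall u, V u -> V'' u -> V' u) -> tr V' V'' n (tr V V' n x) = tr V V'' n x.
Hypothesis tr_cover : forall (V V1 V2 : pred X) n x,
  is_open V -> is_open V1 -> is_open V2 -> psub V1 V -> psub V2 V -> (forall u, V u -> V1 u || V2 u) ->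
  tr V1 V n (tr V V1 n x) + tr V2 V n (tr V V2 n x) =
  x + tr (predI V1 V2) V n (tr V (predI V1 V2) n x).
Hypothesis tr_empty : forall (V : pred X) n (x : F V n), is_open V -> (forall u, ~~ V u) -> x = 0.

Lemma is_open_predI (V1 V2 : pred X) :
  is_open V1 -> is_open V2 -> is_open (predI V1 V2).
Proof. by move=> o1 o2 p q pq /andP[/(o1 _ _ pq) p1 /(o2 _ _ pq) p2]; exact/andP. Qed.

(** The hypotheses are mostly identities between additive maps, which survive tensoring with an
    arbitrary module; injectivity and gluing by themselves would not. *)
Lemma flabby_split : flabby F.
Proof.
split.
- move=> V V' h n oV oV' y; exists (tr V' V n y).
  by rewrite tr_res tr_comp ?tr_id // => u /h.
- move=> V V1 V2 h1 h2 n oV oV1 oV2 cov x; rewrite !tr_res => x1 x2.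
  have oI := is_open_predI oV1 oV2.
  have := tr_cover x oV oV1 oV2 h1 h2 cov; rewrite x1 x2 !raddf0 addr0.
  rewrite -(@tr_comp V V1 (predI V1 V2) n) // ?x1 ?raddf0 ?addr0 //.
  by move=> u _ /andP[].
- move=> V V1 V2 W h1 h2 w1 w2 n oV oV1 oV2 oW cov covW x1 x2; rewrite !tr_res => e.
  exists (tr V1 V n x1 + tr V2 V n x2 - tr W V n (tr V1 W n x1)).
  have hW u : W u -> V u by move=> Wu; exact/h1/w1.
  have covW' u : V2 u -> V1 u -> W u by move=> V2u V1u; exact: covW.
  rewrite !tr_res !raddfB !raddfD; split.
    rewrite e [tr V V1 n (tr V1 V n x1)]tr_comp ?tr_id //; last by move=> u /h1.
    rewrite [tr V V1 n (tr V2 V n x2)]tr_comp //; last by move=> u /h2.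
    rewrite [tr V V1 n (tr W V _ _)]tr_comp //; last by move=> u /hW.
    by rewrite tr_comp // addrK.
  rewrite [tr V V2 n (tr V2 V n x2)]tr_comp ?tr_id //; last by move=> u /h2.
  rewrite [tr V V2 n (tr V1 V n x1)]tr_comp //; last by move=> u /h1.
  rewrite [tr V V2 n (tr W V _ _)]tr_comp //; last by move=> u /hW.
  by rewrite tr_comp // addrAC subrr add0r.
- by move=> V n oV V0 x; exact: tr_empty.
Qed.

End SplitFunctor.

Section TensorFunctor.
Variables (X : ringedSpace) (A : comPzRingType) (L : zmodType) (sL : act A L).
Variables (F : pred X -> acx A).
Variable fres : forall V V', psub V' V -> cmap (F V) (F V').
Hypothesis fres_comp : forall V V' V'' (h : psub V' V) (h' : psub V'' V')
    (h'' : psub V'' V) n x, fres h' n (fres h n x) = fres h'' n x.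
Hypothesis fresE : forall V V' (h : psub V' V) n,
  equiv (aca (F V) n) (aca (F V') n) (fres h n).

Definition base_opcx : opcx X := Opcx fres_comp.

Definition tens_opcx : opcx X.
Proof.
exists (fun V => ltc sL (acE (F V)))
  (fun V V' h => @ltcm _ _ sL (F V) (F V') _ _ (acE (F V)) (acE (F V'))
    (fres h) (fresE h)) => V V' V'' h h' h'' n x.
by tens_elim x l c; rewrite !tmapE (fres_comp _ _ h'').
Defined.

(** The sheaf axiom is the exactness of [0 -> F(V) -> F(V1) x F(V2) -> F(W)], which a flat module
    preserves. *)
Lemma flabby_tens : mflat sL -> flabby base_opcx -> flabby tens_opcx.
Proof.
move=> Lf Ff; split.
- move=> V V' h n oV oV' y; have s := flabby_ext Ff h oV oV' (n := n).
  exact: (lmap_surj (sL := sL) (fresE h (n := n)) s y).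
- move=> V V1 V2 h1 h2 n oV oV1 oV2 cov x x1 x2.
  pose P := actpair (aca (F V1) n) (aca (F V2) n).
  pose p : {additive _ -> (F V1 n * F V2 n)%type} :=
    (pin1 _ _ \o fres h1 n) \+ (pin2 _ _ \o fres h2 n).
  have pV y : p y = (fres h1 n y, fres h2 n y).
    by rewrite /= pin1E pin2E -[LHS]/(_ + _, _ + _) /= addr0 add0r.
  have pE : equiv (aca (F V) n) P p by move=> a y; rewrite !pV !fresE.
  apply: (Lf _ _ _ _ _ pE).
    apply: additive_inj => y; rewrite pV => -[y1 y2].
    exact: (flabby_sep Ff oV oV1 oV2 cov y1 y2).
  have -> : lmap sL pE x = lmap sL (pin1_equiv _ _) (ores tens_opcx h1 n x) +
      lmap sL (pin2_equiv _ _) (ores tens_opcx h2 n x).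
    clear x1 x2; tens_elim x l c.
    by rewrite !tmapE -tpureDr.
  by rewrite x1 x2 !raddf0 addr0.
- move=> V V1 V2 W h1 h2 w1 w2 n oV oV1 oV2 oW cov covW x1 x2 e.
  pose P := actpair (aca (F V1) n) (aca (F V2) n).
  pose p : {additive _ -> (F V1 n * F V2 n)%type} :=
    (pin1 _ _ \o fres h1 n) \+ (pin2 _ _ \o fres h2 n).
  have pV y : p y = (fres h1 n y, fres h2 n y).
    by rewrite /= pin1E pin2E -[LHS]/(_ + _, _ + _) /= addr0 add0r.
  have pE : equiv (aca (F V) n) P p by move=> a y; rewrite !pV !fresE.
  pose d : {additive (F V1 n * F V2 n)%type -> F W n} :=
    (fres w1 n \o pfst _ _) \- (fres w2 n \o psnd _ _).
  have dE : equiv P (aca (F W) n) d by move=> a y; rewrite /= !fresE actB.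
  have pd y : d y = 0 -> exists z, p z = y.
    move=> /eqP; rewrite /= subr_eq0 => /eqP /= yW.
    have [z [z1 z2]] := flabby_glue Ff h1 h2 oV oV1 oV2 oW cov covW yW.
    exists z; apply: etrans (pV z) _.
    by rewrite [fres h1 n z]z1 [fres h2 n z]z2; case: (y).
  pose i1 := lmap sL (pin1_equiv (aca (F V1) n) (aca (F V2) n)).
  pose i2 := lmap sL (pin2_equiv (aca (F V1) n) (aca (F V2) n)).
  pose p1 := lmap sL (pfst_equiv (aca (F V1) n) (aca (F V2) n)).
  pose p2 := lmap sL (psnd_equiv (aca (F V1) n) (aca (F V2) n)).
  have di1 y : lmap sL dE (i1 y) = ores tens_opcx w1 n y.
    by tens_elim y l c; rewrite !tmapE pin1E /= raddf0 subr0.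
  have di2 y : lmap sL dE (i2 y) + ores tens_opcx w2 n y = 0.
    elim/tensor_ind: y => [|l c|y z hy hz]; first by rewrite !raddf0 addr0.
      rewrite !tmapE -tpureDr pin2E /= raddf0 sub0r addNr.
      by rewrite (balanced0r (balanced_tpure _ _)).
    by rewrite !raddfD addrACA hy hz addr0.
  have p1i1 x : p1 (i1 x) = x by tens_elim x l c; rewrite !tmapE pin1E.
  have p2i2 x : p2 (i2 x) = x by tens_elim x l c; rewrite !tmapE pin2E.
  have p1i2 x : p1 (i2 x) = 0.
    by tens_elim x l c; rewrite !tmapE pin2E (balanced0r (balanced_tpure _ _)).
  have p2i1 x : p2 (i1 x) = 0.
    by tens_elim x l c; rewrite !tmapE pin1E (balanced0r (balanced_tpure _ _)).
  have p1p y : p1 (lmap sL pE y) = ores tens_opcx h1 n y.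
    by tens_elim y l c; rewrite !tmapE pV.
  have p2p y : p2 (lmap sL pE y) = ores tens_opcx h2 n y.
    by tens_elim y l c; rewrite !tmapE pV.
  have [|z hz] := @flat_exact _ _ _ _ _ _ _ _ _ _ _ pE dE Lf pd (i1 x1 + i2 x2).
    by rewrite raddfD di1 e addrC di2.
  by exists z; rewrite -p1p -p2p hz !raddfD p1i1 p1i2 p2i1 p2i2 addr0 add0r.
- move=> V n oV V0 x; elim/tensor_ind: x => [//|l c|y z -> ->]; last exact: addr0.
  by rewrite [c](flabby_empty Ff) // (balanced0r (balanced_tpure _ _)).
Qed.

End TensorFunctor.

(** * Products of stalks *)

Section ProductModule.
Variables (X : finType) (P : pred X) (F : X -> zmodType).

(* Products over [P] are total functions vanishing outside [P], so that all
   families of indices share one type of functions. *)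
Record pmod := Pmod { pv :> forall u, F u; pv0 : forall u, ~~ P u -> pv u = 0 }.

Implicit Types x y z : pmod.

Lemma pmod_ext x y : (forall u, P u -> x u = y u) -> x = y.
Proof.
case: x y => [x x0] [y y0] /= xy; have e : x = y.
  apply: functional_extensionality_dep => u.
  by have [/xy//|Pu] := boolP (P u); rewrite x0 ?y0.
by subst y; congr Pmod; exact: Prop_irrelevance.
Qed.

HB.instance Definition _ := gen_eqMixin pmod.
HB.instance Definition _ := gen_choiceMixin pmod.

Definition pmk (f : forall u, F u) : pmod.
Proof. by exists (fun u => if P u then f u else 0) => u /negPf ->. Defined.

Lemma pmkE f u : P u -> pmk f u = f u.
Proof. by move=> /= ->. Qed.

Lemma pmkE_if f u : pmk f u = if P u then f u else 0.
Proof. by []. Qed.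

Definition padd x y := pmk (fun u => x u + y u).
Definition popp x := pmk (fun u => - x u).
Definition pzero := pmk (fun u => 0).

Lemma paddA : associative padd.
Proof. by move=> x y z; apply: pmod_ext => u Pu; rewrite !pmkE // addrA. Qed.
Lemma paddC : commutative padd.
Proof. by move=> x y; apply: pmod_ext => u Pu; rewrite !pmkE // addrC. Qed.
Lemma padd0 : left_id pzero padd.
Proof. by move=> x; apply: pmod_ext => u Pu; rewrite !pmkE // add0r. Qed.
Lemma paddN : left_inverse pzero popp padd.
Proof. by move=> x; apply: pmod_ext => u Pu; rewrite !pmkE // addNr. Qed.

HB.instance Definition _ := GRing.isZmodule.Build pmod paddA paddC padd0 paddN.

Lemma paddE x y u : (x + y) u = x u + y u.
Proof.
rewrite [LHS]pmkE_if; case: ifPn => // Pu.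
by rewrite !pv0 ?addr0.
Qed.

Lemma pmod0E u : (0 : pmod) u = 0.
Proof. by rewrite [LHS]pmkE_if; case: ifP. Qed.

Definition peval u : {additive pmod -> F u} :=
  @mkadd pmod (F u) (fun x => x u) (fun x y => paddE x y u).

Lemma pevalE u x : peval u x = x u. Proof. exact: mkaddE. Qed.

Definition pmap (M : zmodType) (f : forall u, {additive M -> F u}) :
  {additive M -> pmod}.
Proof.
apply: (@mkadd M pmod (fun m => pmk (fun u => f u m))) => m m'.
by apply: pmod_ext => u Pu; rewrite paddE !pmkE // raddfD.
Defined.

Lemma pmapE (M : zmodType) (f : forall u, {additive M -> F u}) m u :
  P u -> pmap f m u = f u m.
Proof. by move=> Pu; rewrite mkaddE pmkE. Qed.

Section Action.
Variables (A : comPzRingType) (s : forall u, P u -> act A (F u)).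

Definition pact_op a x : pmod :=
  pmk (fun u => if idP is ReflectT Pu then @s u Pu a (x u) else 0).

Lemma pact_opE a x u (Pu : P u) : pact_op a x u = s Pu a (x u).
Proof.
rewrite pmkE //; case: {-}_ / idP => [Pu'|//].
by rewrite (bool_irrelevance Pu Pu').
Qed.

Definition pact : act A pmod.
Proof.
exists pact_op => [a b x|a x y|a b x|x]; apply: pmod_ext => u Pu;
  rewrite ?paddE !(pact_opE _ _ Pu) ?paddE.
- exact: actDl.
- exact: actDr.
- exact: actM.
- exact: act1.
Defined.

Lemma pactE a x u (Pu : P u) : pact a x u = s Pu a (x u).
Proof. exact: pact_opE. Qed.

Definition psingle u : {additive F u -> pmod}.
Proof.
pose f (c : F u) v : F v := if u =P v is ReflectT e then eq_rect u F c v e else 0.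
apply: (@mkadd (F u) pmod (fun c => pmk (f c))) => c c'.
apply: pmod_ext => v Pv; rewrite paddE !pmkE // /f.
case: eqP => [e|_]; last by rewrite addr0.
by case: v / e {Pv}.
Defined.

Lemma psingle_eq u c : P u -> psingle u c u = c.
Proof.
move=> Pu; rewrite mkaddE pmkE //; case: eqP => // e.
by rewrite (eq_axiomK e).
Qed.

Lemma psingle_neq u v c : u != v -> psingle u c v = 0.
Proof.
by move=> uv; rewrite mkaddE pmkE_if; case: ifP => // _; case: eqP uv => // ->; rewrite eqxx.
Qed.

Lemma pmod_flat : (forall u (Pu : P u), mflat (s Pu)) -> mflat pact.
Proof.
move=> sf; pose I : finType := {u : X | P u}.
apply: (@mflat_split _ _ _ I (fun i => F (val i)) (fun i => s (valP i))
  (fun i => peval (val i)) (fun i => psingle (val i))).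
- by move=> i a x; rewrite !pevalE (pactE _ _ (valP i)).
- move=> i a c; apply: pmod_ext => v Pv; rewrite (pactE _ _ Pv).
  have [e|ne] := eqVneq (val i) v; last by rewrite !psingle_neq // act0.
  subst v; rewrite !psingle_eq //.
  by rewrite (bool_irrelevance Pv (valP i)).
- move=> x; apply: pmod_ext => v Pv; rewrite -[RHS]pevalE raddf_sum.
  rewrite (bigD1 (Sub v Pv : I)) //= big1 ?addr0.
    by rewrite [RHS]pevalE /= psingle_eq ?pevalE.
  by move=> i iv; rewrite [LHS]pevalE psingle_neq //; apply: contra iv.
- by move=> i; exact: sf.
Qed.

End Action.
End ProductModule.

Section Transfer.
Variables (X : finType) (F : X -> zmodType).

Definition ptr (P Q : pred X) : {additive pmod P F -> pmod Q F} :=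
  pmap Q (fun u => peval P F u).

Lemma ptrE (P Q : pred X) (x : pmod P F) u : Q u -> ptr P Q x u = x u.
Proof. by move=> Qu; rewrite pmapE // pevalE. Qed.

End Transfer.

Fact mklin_key (R : pzRingType) (U : lmodType R) (V : zmodType) (s : R -> V -> V)
  (f : U -> V) : {morph f : x y / x + y} -> (forall a x, f (a *: x) = s a (f x)) ->
  {g : {linear U -> V | s} | forall x, g x = f x}.
Proof.
move=> fD fZ.
pose mD := GRing.isZmodMorphism.Build U V f (additive_of_morph fD).
pose mZ := GRing.isScalable.Build R U V s f fZ.
by exists (HB.pack f mD mZ : {linear U -> V | s}).
Qed.

Definition mklin (R : pzRingType) (U : lmodType R) (V : zmodType) (s : R -> V -> V)
  (f : U -> V) (fD : {morph f : x y / x + y})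
  (fZ : forall a x, f (a *: x) = s a (f x)) : {linear U -> V | s} :=
  sval (mklin_key fD fZ).

Lemma mklinE (R : pzRingType) (U : lmodType R) (V : zmodType) (s : R -> V -> V)
  (f : U -> V) fD fZ x : @mklin R U V s f fD fZ x = f x.
Proof. exact: (svalP (mklin_key fD fZ)). Qed.

(** * The Godement resolution *)

Section Godement.
Variable X : ringedSpace.
Implicit Types (p q u : X).

(* [le] is only a preorder: products are taken over one point of each class. *)
Definition rep p : X := odflt p [pick q | le p q && le q p].

Lemma le_rep p : le p (rep p).
Proof. by rewrite /rep; case: pickP => [q /andP[]|_] //; exact: Defs.le_refl. Qed.

Lemma rep_le p : le (rep p) p.
Proof. by rewrite /rep; case: pickP => [q /andP[]|_] //; exact: Defs.le_refl. Qed.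

Lemma rep_eq p q : le p q -> le q p -> rep p = rep q.
Proof.
move=> pq qp; rewrite /rep.
have e : [pred u | le p u && le u p] =1 [pred u | le q u && le u q].
  move=> u /=; apply/andP/andP=> -[h h']; split.
  - exact: Defs.le_trans qp h.
  - exact: Defs.le_trans h' pq.
  - exact: Defs.le_trans pq h.
  - exact: Defs.le_trans h' qp.
rewrite (eq_pick e); case: pickP => //= /(_ q).
by rewrite /= !Defs.le_refl.
Qed.

Definition is_rep p := rep p == p.

Lemma is_rep_rep p : is_rep (rep p).
Proof. by apply/eqP; rewrite (rep_eq (rep_le p) (le_rep p)). Qed.

(** Restriction maps made total, zero when [p <= u] fails, so that families over all points can be
    formed. *)
Definition lmres (M : omodule X) p u : {additive M p -> M u} :=
  if @idP (le p u) is ReflectT h then mres M h : {additive M p -> M u}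
  else zeroadd _ _.

Lemma lmresE (M : omodule X) p u (h : le p u) m : lmres M p u m = mres M h m.
Proof.
rewrite /lmres; case: {-}_ / idP => [h'|//].
by rewrite (bool_irrelevance h h').
Qed.

Lemma lmres_id (M : omodule X) p m : lmres M p p m = m.
Proof. by rewrite (lmresE (Defs.le_refl p)) mres_id. Qed.

Lemma lmres_comp (M : omodule X) p q r m :
  le p q -> le q r -> lmres M q r (lmres M p q m) = lmres M p r m.
Proof.
move=> pq qr; rewrite (lmresE pq) (lmresE qr) (lmresE (Defs.le_trans pq qr)).
exact: mres_comp.
Qed.

Lemma lmresZ (M : omodule X) p u (h : le p u) a m :
  lmres M p u (a *: m) = res h a *: lmres M p u m.
Proof. by rewrite !(lmresE h) linearZ. Qed.

Definition above p : pred X := fun u => le p u && is_rep u.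
Definition sabove p : pred X := fun u => le p u && is_rep u && ~~ le u p.

Lemma above_le p u : above p u -> le p u. Proof. by case/andP. Qed.
Lemma sabove_above p u : sabove p u -> above p u. Proof. by case/andP. Qed.
Lemma sabove_le p u : sabove p u -> le p u. Proof. by move=> /sabove_above /above_le. Qed.

Lemma above_rep p : above p (rep p).
Proof. by rewrite /above le_rep is_rep_rep. Qed.

Lemma above_trans p q u : le p q -> above q u -> above p u.
Proof. by move=> pq /andP[qu ru]; rewrite /above ru (Defs.le_trans pq qu). Qed.

Lemma sabove_trans p q u : le p q -> sabove q u -> sabove p u.
Proof.
move=> pq /andP[qu uq]; rewrite /sabove (above_trans pq qu : _ && _) /=.
by apply: contra uq => up; exact: Defs.le_trans up pq.
Qed.

Lemma sabove_rep p : sabove p (rep p) = false.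
Proof. by rewrite /sabove rep_le andbF. Qed.

Definition pstalk (F : forall u, lmodType (stalk u)) (P : pred X) p
    (PU : forall u, P u -> le p u) : act (stalk p) (pmod P F) :=
  pact (fun u Pu => restr (res (PU u Pu)) (lact (F u))).

Lemma pstalkE (F : forall u, lmodType (stalk u)) (P : pred X) p (PU : forall u, P u -> le p u) a (x : pmod P F) u (h : le p u) :
  pstalk F PU a x u = res h a *: x u.
Proof.
have [Pu|Pu] := boolP (P u); last by rewrite !pv0 // scaler0.
by rewrite (pactE _ _ _ Pu) /= (bool_irrelevance (PU u Pu) h).
Qed.

Section Coinduced.
Variable F : forall u, lmodType (stalk u).

Definition gC_stalk p : lmodType (stalk p) :=
  modof (pstalk F (@above_le p)).

Lemma gC_res_scale p q (h : le p q) a (x : gC_stalk p) :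
  ptr F (above p) (above q) (a *: x) =
  (res h a *: (ptr F (above p) (above q) x : gC_stalk q)).
Proof.
apply: pmod_ext => u qu; have hu := above_le qu.
rewrite ptrE // !(pstalkE _ _ _ hu, pstalkE _ _ _ (Defs.le_trans h hu)) ptrE //.
by rewrite (res_comp h hu (Defs.le_trans h hu)).
Qed.

(** Godement's sheaf of discontinuous sections. The family [F] is arbitrary, since injective sheaves
    are built in the same way from injective modules. *)
Definition gC : omodule X.
Proof.
refine (@OModule X gC_stalk (fun p q h =>
  @mklin _ (gC_stalk p) (gC_stalk q) (res h \; *:%R)
    (fun x => ptr F (above p) (above q) x) (raddfD _) (gC_res_scale h)) _ _).
- move=> p h x; rewrite mklinE; apply: pmod_ext => u Pu.
  by rewrite ptrE.
- move=> p q r pq qr pr x; rewrite !mklinE; apply: pmod_ext => u Pu.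
  by rewrite !ptrE //; exact: above_trans Pu.
Defined.

Lemma gC_resE p q (h : le p q) (x : gC p) u : above q u ->
  (mres gC h x : pmod _ _) u = (x : pmod _ _) u.
Proof. by move=> qu; rewrite [mres _ _]lock /= -lock mklinE ptrE. Qed.

End Coinduced.
Section Delta.
Variable M : omodule X.

(* The cokernel of [M -> gC M] is realized as the product over the points
   strictly above [p], by subtracting the restrictions of the component at [p]. *)
Definition pdelta (P : pred X) p : {additive pmod P (mstalk M) -> pmod (sabove p) (mstalk M)} :=
  pmap (sabove p) (fun u =>
    peval P (mstalk M) u \- (lmres M (rep p) u \o peval P (mstalk M) (rep p))).

Lemma pdeltaE (P : pred X) p (c : pmod P (mstalk M)) u : sabove p u ->
  pdelta P p c u = c u - lmres M (rep p) u (c (rep p)).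
Proof. by move=> pu; rewrite pmapE //= !pevalE. Qed.

(** The restrictions of the entry at [rep p] cancel between the entries at [u] and at [rep q]. If
    [rep q] is not strictly above [p], then [rep q = rep p] and both sides subtract the same
    entry. *)
Lemma pdelta_comp (P : pred X) p q (c : pmod P (mstalk M)) : le p q ->
  pdelta (sabove p) q (pdelta P p c) = pdelta P q c.
Proof.
move=> pq; apply: pmod_ext => u qu; rewrite !(pdeltaE _ qu).
rewrite (pdeltaE _ (sabove_trans pq qu)).
have rq : le (rep p) (rep q).
  exact: Defs.le_trans (rep_le p) (Defs.le_trans pq (le_rep q)).
have ru : le (rep q) u by exact: Defs.le_trans (rep_le q) (sabove_le qu).
have [pr|pr] := boolP (sabove p (rep q)).
  by rewrite (pdeltaE _ pr) raddfB /= lmres_comp // opprB addrA subrK.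
rewrite (pv0 _ pr) raddf0 subr0; suff -> : rep p = rep q by [].
move: pr; rewrite /sabove (above_trans pq (above_rep q) : _ && _) /= negbK => rp.
by apply: rep_eq => //; exact: Defs.le_trans (le_rep q) rp.
Qed.

Lemma pdelta_ptr (P Q : pred X) q (c : pmod P (mstalk M)) :
  (forall u, above q u -> Q u) -> pdelta Q q (ptr (mstalk M) P Q c) = pdelta P q c.
Proof.
move=> qQ; apply: pmod_ext => u qu; rewrite !(pdeltaE _ qu) !ptrE //.
  exact/qQ/above_rep.
exact/qQ/sabove_above.
Qed.

Lemma pdelta_id p (z : pmod (sabove p) (mstalk M)) : pdelta (sabove p) p z = z.
Proof.
apply: pmod_ext => u pu; have z0 : z (rep p) = 0 by apply: pv0; rewrite sabove_rep.
by rewrite (pdeltaE _ pu) z0 raddf0 subr0.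
Qed.

Definition gZ_stalk p : lmodType (stalk p) := modof (pstalk (mstalk M) (@sabove_le p)).

Lemma pdelta_scale (P : pred X) p q (PU : forall u, P u -> le p u) (h : le p q) a
    (c : pmod P (mstalk M)) :
  pdelta P q (pstalk (mstalk M) PU a c) = (res h a *: (pdelta P q c : gZ_stalk q)).
Proof.
apply: pmod_ext => u qu; have hu := sabove_le qu.
have rq : le p (rep q) := Defs.le_trans h (le_rep q).
have ru : le (rep q) u := Defs.le_trans (rep_le q) hu.
rewrite [RHS](pstalkE _ _ _ hu) !(pdeltaE _ qu).
rewrite (pstalkE _ _ _ (Defs.le_trans h hu)) (pstalkE _ _ _ rq) (lmresZ ru).
rewrite (res_comp h hu (Defs.le_trans h hu)).
by rewrite (res_comp rq ru (Defs.le_trans h hu)) scalerBr.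
Qed.

Definition gZ : omodule X.
Proof.
refine (@OModule X gZ_stalk (fun p q h =>
  @mklin _ (gZ_stalk p) (gZ_stalk q) (res h \; *:%R)
    (fun x => pdelta (sabove p) q x) (raddfD _) (pdelta_scale _ h)) _ _).
- by move=> p h x; rewrite mklinE pdelta_id.
- by move=> p q r pq qr pr x; rewrite !mklinE pdelta_comp.
Defined.

Lemma gZ_resE p q (h : le p q) (x : gZ p) : mres gZ h x = pdelta (sabove p) q x.
Proof. by rewrite [mres _ _]lock /= -lock mklinE. Qed.

Lemma gq_scale p a (c : gC (mstalk M) p) :
  pdelta (above p) p (a *: c) = a *: (pdelta (above p) p c : gZ_stalk p).
Proof. by rewrite pdelta_scale ?Defs.le_refl // => h; rewrite res_id. Qed.

Definition gq : omorphism (gC (mstalk M)) gZ.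
Proof.
refine (@OMorphism X (gC (mstalk M)) gZ (fun p => @mklin _ (gC (mstalk M) p) (gZ p) *:%R
  (fun c => pdelta (above p) p c) (raddfD _) (@gq_scale p)) _).
by move=> p q h c; rewrite !mklinE pdelta_comp // pdelta_ptr.
Defined.

Lemma gqE p (c : gC (mstalk M) p) : gq p c = pdelta (above p) p c.
Proof. exact: mklinE. Qed.

Lemma gi_scale p a (m : M p) :
  pmap (above p) (lmres M p) (a *: m) =
  a *: (pmap (above p) (lmres M p) m : gC (mstalk M) p).
Proof.
apply: pmod_ext => u pu; have hu := above_le pu.
by rewrite [RHS](pstalkE _ _ _ hu) !pmapE // (lmresZ hu).
Qed.

Definition gi : omorphism M (gC (mstalk M)).
Proof.
refine (@OMorphism X M (gC (mstalk M)) (fun p => @mklin _ (M p) (gC (mstalk M) p) *:%R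
  (fun m => pmap (above p) (lmres M p) m) (raddfD _) (@gi_scale p)) _).
move=> p q h m; rewrite !mklinE; apply: pmod_ext => u qu.
rewrite ptrE // !pmapE //; last exact: above_trans qu.
by rewrite -lmresE lmres_comp //; exact: above_le.
Defined.

Lemma giE p (m : M p) u : above p u -> (gi p m : pmod _ _) u = lmres M p u m.
Proof. by move=> pu; rewrite /= mklinE pmapE. Qed.

(** A family in the kernel is the image of its entry at [rep p], brought back to [p]. *)
Lemma gq_gi : oexact gi gq.
Proof.
move=> p c; rewrite gqE; split=> [c0|[m <-]]; last first.
  apply: pmod_ext => u pu; have au := sabove_above pu.
  rewrite (pdeltaE _ pu) pmod0E !giE ?above_rep // lmres_comp ?subrr ?le_rep //.
  exact: Defs.le_trans (rep_le p) (sabove_le pu).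
exists (lmres M (rep p) p (c (rep p))); apply: pmod_ext => u pu.
have pu' := above_le pu.
rewrite giE // lmres_comp ?rep_le //.
have [su|su] := boolP (sabove p u).
  have := congr1 (fun c : pmod _ (mstalk M) => c u) c0.
  by rewrite (pdeltaE _ su) pmod0E => /eqP; rewrite subr_eq0 => /eqP.
have up : le u p.
  by move: su; rewrite /sabove (pu : _ && _) /= negbK.
have -> : u = rep p.
  by case/andP: pu => _ /eqP <-; exact: rep_eq.
exact: lmres_id.
Qed.

End Delta.

(** The successive cokernels [Z^n]; the [n]-th term of the Godement resolution is [gC (gZn M n)]. *)
Fixpoint gZn (M : omodule X) n : omodule X :=
  if n is m.+1 then gZ (gZn M m) else M.

(** Each cokernel only involves points strictly above the previous one, so the number of points
    strictly above [p] bounds the nonzero degrees. *)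
Lemma gZn_bound M n p : (#|[pred u | le p u && ~~ le u p]| < n)%N ->
  forall z : gZn M n p, z = 0.
Proof.
elim: n p => // n IHn p hn z; apply: pmod_ext => u pu.
rewrite pmod0E; apply: IHn; rewrite -ltnS; apply: leq_trans hn; rewrite ltnS.
apply: proper_card; apply/properP; split.
  apply/fintype.subsetP => v /andP[uv vu]; apply/andP; split.
    exact: Defs.le_trans (sabove_le pu) uv.
  by apply: contra vu => vp; exact: Defs.le_trans vp (sabove_le pu).
exists u; first by case/andP: pu => /andP[up _] pu; apply/andP.
by rewrite inE Defs.le_refl.
Qed.

End Godement.

(** * Sections of the Godement resolution over open sets *)

Section GodementSections.
Variables (X : ringedSpace) (M : omodule X).
Implicit Types (V : pred X).

(* The interior of [V]: it makes the sections of the Godement resolution a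
   complex for every predicate [V], open or not. *)
Definition intr V : pred X := fun u => [forall w, le u w ==> V w].

Definition KP V : pred X := fun u => intr V u && is_rep u.

Lemma KP_up V u w : KP V u -> le u w -> is_rep w -> KP V w.
Proof.
move=> /andP[/forallP Vu _] uw rw; apply/andP; split=> //; apply/forallP => v.
by apply/implyP => wv; apply: (implyP (Vu v)); exact: Defs.le_trans uw wv.
Qed.

Lemma KP_sub V u : KP V u -> V u.
Proof. by case/andP => /forallP/(_ u)/implyP h _; apply: h; exact: Defs.le_refl. Qed.

Lemma KP_mono V V' u : psub V' V -> KP V' u -> KP V u.
Proof.
move=> h /andP[/forallP V'u ru]; apply/andP; split=> //; apply/forallP => w.
by apply/implyP => uw; apply: h; exact: (implyP (V'u w)).
Qed.

Lemma KP_open V u : is_open V -> V u -> is_rep u -> KP V u.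
Proof.
move=> oV Vu ru; apply/andP; split=> //; apply/forallP => w.
by apply/implyP => uw; exact: oV uw Vu.
Qed.

Lemma KP_above V u w : KP V u -> above u w -> KP V w.
Proof. by move=> Vu /andP[uw rw]; exact: KP_up uw rw. Qed.

Notation Zn n := (gZn M n).
Notation Kob V n := (pmod (KP V) (mstalk (Zn n))).

(** A section of the [n]-th term over [V] is a family of elements of the stalks of [Z^n]; the
    differential takes, in each stalk, its class in the cokernel [Z^(n+1)]. *)
Definition Kd V n : {additive Kob V n -> Kob V n.+1} :=
  @pmap X (KP V) (mstalk (Zn n.+1)) (Kob V n) (fun u => pdelta (Zn n) (KP V) u).

Lemma KdE V n (c : Kob V n) u : KP V u -> Kd V n c u = pdelta (Zn n) (KP V) u c.
Proof. by move=> Vu; rewrite pmapE. Qed.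

Lemma Kdd V n (c : Kob V n) : Kd V n.+1 (Kd V n c) = 0.
Proof.
apply: pmod_ext => u Vu; rewrite KdE // pmod0E; apply: pmod_ext => w uw.
have Vw : KP V w := KP_above Vu (sabove_above uw).
have Vr : KP V (rep u) := KP_above Vu (above_rep u).
have ruw : le (rep u) w := Defs.le_trans (rep_le u) (sabove_le uw).
rewrite (pdeltaE _ uw) !KdE // (lmresE ruw) gZ_resE pdelta_comp // subrr.
by rewrite pmod0E.
Qed.

Definition Kcx V : cplx := Cplx (Kdd (V := V)).

Section Action.
Variables (A : comPzRingType) (V : pred X).
Variable al : forall u, KP V u -> {rmorphism A -> stalk u}.
Hypothesis al_res : forall u w (h : le u w) (Vu : KP V u) (Vw : KP V w) a,
  res h (al Vu a) = al Vw a.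

Definition Kact n : act A (Kob V n) :=
  pact (fun u Vu => restr (al Vu) (lact (Zn n u))).

Lemma KactE n a (c : Kob V n) u (Vu : KP V u) : Kact n a c u = al Vu a *: c u.
Proof. by rewrite (pactE _ _ _ Vu). Qed.

Lemma Kd_equiv n : equiv (Kact n) (Kact n.+1) (Kd V n).
Proof.
move=> a c; apply: pmod_ext => u Vu; rewrite (KactE _ _ Vu) !KdE //.
apply: pmod_ext => w uw; have hu := sabove_le uw.
have Vw : KP V w := KP_above Vu (sabove_above uw).
have Vr : KP V (rep u) := KP_above Vu (above_rep u).
have ruw : le (rep u) w := Defs.le_trans (rep_le u) hu.
rewrite [RHS](pstalkE _ _ _ hu) !(pdeltaE _ uw) (KactE _ _ Vw) (KactE _ _ Vr).
by rewrite (lmresZ ruw) (al_res _ _ Vw) (al_res _ _ Vw) scalerBr.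
Qed.

Definition Kacx : acx A := @Acx A (Kcx V) Kact Kd_equiv.

(** Unfolding [Z^n] gives iterated finite products of stalks of [M], over rings related by flat
    restriction maps. *)
Lemma Kact_flat n : finite_space X ->
  (forall u, mflat (lact (M u))) -> (forall u (Vu : KP V u), mflat (ralg (al Vu))) ->
  mflat (Kact n).
Proof.
move=> Xf Mf alf; apply: pmod_flat => u Vu; apply: mflat_trans; first exact: alf.
elim: n u {Vu} => [|n IHn] u; first exact: Mf.
apply: pmod_flat => w uw; apply: mflat_trans; last exact: IHn.
exact/flat_mflat/Xf.
Qed.

End Action.

Lemma Kcx_bound V n : (#|X| < n)%N -> forall c : Kcx V n, c = 0.
Proof.
move=> hn c; apply: pmod_ext => u _; rewrite pmod0E; apply: gZn_bound.
exact: leq_ltn_trans (max_card _) hn.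
Qed.

Definition Kres V V' (h : psub V' V) : cmap (Kcx V) (Kcx V').
Proof.
exists (fun n => ptr (mstalk (Zn n)) (KP V) (KP V')) => n c.
apply: pmod_ext => u Vu; rewrite ptrE // !KdE ?(KP_mono h) //.
by rewrite pdelta_ptr // => w; exact: KP_above.
Defined.

Lemma KresE V V' (h : psub V' V) n (c : Kcx V n) u : KP V' u -> Kres h n c u = c u.
Proof. by move=> Vu; rewrite /= ptrE. Qed.

Lemma Kres_comp V V' V'' (h : psub V' V) (h' : psub V'' V') (h'' : psub V'' V)
  n (c : Kcx V n) : Kres h' n (Kres h n c) = Kres h'' n c.
Proof.
by apply: pmod_ext => u Vu; rewrite !KresE //; exact: KP_mono Vu.
Qed.

Definition Ktr V V' n : {additive Kcx V n -> Kcx V' n} :=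
  ptr (mstalk (Zn n)) (KP V) (KP V').

Lemma KtrE V V' n (c : Kcx V n) u : KP V' u -> Ktr V V' n c u = c u.
Proof. by move=> Vu; rewrite ptrE. Qed.

Lemma Ktr_id V n (c : Kcx V n) : Ktr V V n c = c.
Proof. by apply: pmod_ext => u Vu; rewrite KtrE. Qed.

Lemma Ktr_comp (V V' V'' : pred X) n (c : Kcx V n) :
  is_open V -> is_open V' -> is_open V'' -> (forall u, V u -> V'' u -> V' u) ->
  Ktr V' V'' n (Ktr V V' n c) = Ktr V V'' n c.
Proof.
move=> oV oV' oV'' h; apply: pmod_ext => u Vu; rewrite KtrE // [RHS]KtrE //.
have [V'u|V'u] := boolP (KP V' u); first by rewrite KtrE.
rewrite (pv0 (Ktr V V' n c)) //; apply/esym/pv0; apply: contra V'u => V1u.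
by apply: KP_open => //; [apply: h; exact: KP_sub | case/andP: Vu].
Qed.

Lemma Ktr_cover (V V1 V2 : pred X) n (c : Kcx V n) :
  is_open V -> is_open V1 -> is_open V2 ->
  psub V1 V -> psub V2 V -> (forall u, V u -> V1 u || V2 u) ->
  Ktr V1 V n (Ktr V V1 n c) + Ktr V2 V n (Ktr V V2 n c) =
  c + Ktr (predI V1 V2) V n (Ktr V (predI V1 V2) n c).
Proof.
move=> oV oV1 oV2 h1 h2 cov; have oI := is_open_predI oV1 oV2.
apply: pmod_ext => u Vu; rewrite !paddE !(@KtrE _ V) //.
have ru : is_rep u by case/andP: Vu.
have val (W : pred X) : is_open W -> Ktr V W n c u = if W u then c u else 0.
  move=> oW; case: ifPn => Wu; first by rewrite KtrE //; exact: KP_open.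
  by apply: pv0; apply: contra Wu; exact: KP_sub.
rewrite !val //=; have := cov u (KP_sub Vu).
by case: (V1 u); case: (V2 u); rewrite //= ?addr0 ?add0r.
Qed.

Lemma Ktr_empty (V : pred X) n (c : Kcx V n) : is_open V -> (forall u, ~~ V u) -> c = 0.
Proof.
by move=> _ V0; apply: pmod_ext => u /KP_sub; rewrite (negPf (V0 u)).
Qed.

(* On [U_p] the complex is contractible onto the stalk [M_p]. *)
Section Contraction.
Variable p : X.

Lemma KP_le u : KP (le p) u = above p u.
Proof.
apply/idP/idP => [Vu|pu]; last first.
  by apply: KP_open; [exact: is_open_le | exact: above_le | case/andP: pu].
by rewrite /above (KP_sub Vu); case/andP: Vu.
Qed.

Lemma above_sabove_rep u : above p u -> ~~ sabove (rep p) u -> u = rep p.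
Proof.
move=> /andP[pu ru]; rewrite /sabove ru (Defs.le_trans (rep_le p) pu) negbK => ur.
rewrite -(eqP ru); apply: rep_eq; first exact: Defs.le_trans ur (rep_le p).
exact: pu.
Qed.

Definition Kaug : {additive M p -> Kcx (le p) 0} := pmap (KP (le p)) (lmres M p).

Lemma KaugE m u : above p u -> Kaug m u = lmres M p u m.
Proof. by move=> pu; rewrite pmapE // KP_le. Qed.

Definition Kev : {additive Kcx (le p) 0 -> M p} :=
  lmres M (rep p) p \o peval (KP (le p)) (mstalk M) (rep p).

Lemma KevE c : Kev c = lmres M (rep p) p (c (rep p)).
Proof. by rewrite /= pevalE. Qed.

(** The contracting homotopy: the entry of a cochain at [rep p] lies in a stalk of [Z^(n+1)], thus
    is a family over the points strictly above [p]; it is extended by zero at [rep p]. *)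
Definition Khom n : {additive Kcx (le p) n.+1 -> Kcx (le p) n} :=
  ptr (mstalk (Zn n)) (sabove (rep p)) (KP (le p)) \o
  peval (KP (le p)) (mstalk (Zn n.+1)) (rep p).

Lemma Khom_ptr n (c : Kcx (le p) n.+1) :
  Khom n c = ptr (mstalk (Zn n)) (sabove (rep p)) (KP (le p)) (c (rep p)).
Proof. by rewrite -pevalE. Qed.

Lemma KhomE n c u : above p u ->
  Khom n c u = (c (rep p) : pmod (sabove (rep p)) (mstalk (Zn n))) u.
Proof. by move=> pu; rewrite /= ptrE ?pevalE // KP_le. Qed.

Lemma Kd_aug m : Kd (le p) 0 (Kaug m) = 0.
Proof.
apply: pmod_ext => u; rewrite KP_le => pu; rewrite KdE ?KP_le // pmod0E.
apply: pmod_ext => w uw; rewrite (pdeltaE _ uw) pmod0E !KaugE; first last.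
- exact: above_trans (above_le pu) (sabove_above uw).
- exact: above_trans (above_le pu) (above_rep u).
rewrite lmres_comp ?subrr //; first exact: Defs.le_trans (above_le pu) (le_rep u).
exact: Defs.le_trans (rep_le u) (sabove_le uw).
Qed.

Lemma Khom0 c : Khom 0 (Kd (le p) 0 c) + Kaug (Kev c) = c.
Proof.
apply: pmod_ext => u; rewrite KP_le => pu; rewrite paddE KhomE // KaugE //.
have pr := above_rep p; have up := above_le pu.
rewrite KdE ?KP_le // KevE lmres_comp ?rep_le //.
have rr : rep (rep p) = rep p by apply/eqP/is_rep_rep.
have [su|su] := boolP (sabove (rep p) u).
  by rewrite (pdeltaE _ su) rr subrK.
rewrite (pv0 (pdelta _ _ _ _) su) add0r.
by rewrite (above_sabove_rep pu su) lmres_id.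
Qed.

Lemma KhomS n c : Khom n.+1 (Kd (le p) n.+1 c) + Kd (le p) n (Khom n c) = c.
Proof.
apply: pmod_ext => u; rewrite KP_le => pu; rewrite paddE KhomE //.
have pr := above_rep p; have up := above_le pu.
have rpu : le (rep p) u := Defs.le_trans (rep_le p) up.
have rr : rep (rep p) = rep p by apply/eqP/is_rep_rep.
have -> : Kd (le p) n (Khom n c) u = lmres (Zn n.+1) (rep p) u (c (rep p)).
  rewrite KdE ?KP_le // (lmresE rpu) gZ_resE Khom_ptr pdelta_ptr // => v uv.
  by rewrite KP_le; exact: above_trans up uv.
rewrite KdE ?KP_le //.
have [su|su] := boolP (sabove (rep p) u).
  by rewrite (pdeltaE _ su) rr subrK.
rewrite (pv0 (pdelta _ _ _ _) su) add0r.
by rewrite (above_sabove_rep pu su) lmres_id.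
Qed.

End Contraction.
End GodementSections.

Lemma mflat_self (A : comPzRingType) : mflat (mulact A).
Proof.
move=> N N' t t' u uE u_inj x ux0.
have pureE P (r : act A P) (z : tensor (mulact A) r) : exists n, z = tpure _ _ 1 n.
  elim/tensor_ind: z => [|a n|y z [n ->] [n' ->]].
  - by exists 0; rewrite (balanced0r (balanced_tpure _ _)).
  - by exists (r a n); rewrite -tpureZ /= mulr1.
  - by exists (n + n'); rewrite tpureDr.
have mb P (r : act A P) : balanced (mulact A) r (fun a n => r a n).
  split=> [a b n|a n n'|a b n]; first exact: actDl.
    exact: actDr.
  by rewrite actM /= mulrC.
have [n xn] := pureE _ _ x; rewrite xn.
suff -> : n = 0 by rewrite (balanced0r (balanced_tpure _ _)).
apply: u_inj; rewrite raddf0.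
have := congr1 (tliftA (mb _ t')) ux0.
by rewrite xn tmapE raddf0 tliftAE act1.
Qed.

(** * The Godement complex of the structure sheaf and its tensor products over [k] *)

Section StructureGodement.
Variables (k : comPzRingType) (X : overSpace k).
Notation M := (structure_sheaf X).

Lemma Kk_al_res (V : pred X) u w (h : le u w) (Vu : KP V u) (Vw : KP V w) c :
  res h (kmor u c) = kmor w c.
Proof. exact: kmor_res. Qed.

Definition Kk (V : pred X) : acx k :=
  @Kacx X M k V (fun u _ => kmor u) (@Kk_al_res V).

Lemma KO_al_res x (V : pred X) (Vx : psub V (le x)) u w (h : le u w)
  (Vu : KP V u) (Vw : KP V w) a :
  res h (res (Vx u (KP_sub Vu)) a) = res (Vx w (KP_sub Vw)) a.
Proof. exact: res_comp. Qed.

(** The same complex as [Kk V], over [O_x] instead of [k], for [V] inside [U_x]: the action over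
    [O_x] is the one with flat terms. *)
Definition KO x (V : pred X) (Vx : psub V (le x)) : acx (stalk x) :=
  @Kacx X M (stalk x) V (fun u Vu => res (Vx u (KP_sub Vu))) (@KO_al_res x V Vx).

Lemma KO_actE x (V : pred X) (Vx : psub V (le x)) n a (c : Kcx M V n) u
  (Vu : KP V u) (h : le x u) :
  (aca (KO Vx) n a c : pmod _ (mstalk (gZn M n))) u =
  res h a *: (c : pmod (KP V) (mstalk (gZn M n))) u.
Proof.
by rewrite (KactE _ _ _ Vu) (bool_irrelevance (Vx u (KP_sub Vu)) h).
Qed.

Lemma Kk_actE (V : pred X) n a (c : Kcx M V n) u (Vu : KP V u) :
  (aca (Kk V) n a c : pmod _ (mstalk (gZn M n))) u =
  kmor u a *: (c : pmod (KP V) (mstalk (gZn M n))) u.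
Proof. by rewrite (KactE _ _ _ Vu). Qed.

Lemma KO_flat x (V : pred X) (Vx : psub V (le x)) n :
  finite_space X -> mflat (aca (KO Vx) n).
Proof.
move=> Xf; apply: Kact_flat => // [u|u Vu]; last exact/flat_mflat/Xf.
exact: mflat_self.
Qed.

Section Restriction.
Variables (x x'' : X) (hx : le x x'') (U U'' : pred X).
Variables (Ux : psub U (le x)) (Ux'' : psub U'' (le x'')) (hU : psub U'' U).

Lemma KO_semilin : @semilin _ _ (res hx) (KO Ux) (KO Ux'') (Kres M hU).
Proof.
move=> n a c; apply: pmod_ext => u Vu.
have xu := Ux'' (KP_sub Vu); have Vu' := KP_mono hU Vu.
rewrite [RHS](KO_actE _ _ _ Vu xu) !KresE //.
rewrite (KO_actE _ _ _ Vu' (Defs.le_trans hx xu)).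
by rewrite (res_comp hx xu (Defs.le_trans hx xu)).
Qed.

End Restriction.

Lemma Kres_k_equiv V V' (h : psub V' V) n :
  equiv (aca (Kk V) n) (aca (Kk V') n) (Kres M h n).
Proof.
move=> a c; apply: pmod_ext => u Vu.
by rewrite Kk_actE // !KresE // Kk_actE //; exact: KP_mono Vu.
Qed.

Section Tensored.
Variables (N : zmodType) (t : act k N).

Definition NK : opcx X :=
  @tens_opcx X k N t Kk (Kres M) (@Kres_comp X M) Kres_k_equiv.

Lemma Ktr_equiv (V V' : pred X) n :
  equiv (aca (Kk V) n) (aca (Kk V') n) (Ktr M V V' n).
Proof.
move=> a c; apply: pmod_ext => u Vu; rewrite Kk_actE // !KtrE //.
have [Wu|Wu] := boolP (KP V u); first by rewrite Kk_actE.
by rewrite (pv0 c Wu) scaler0 [LHS]pv0.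
Qed.

(** [N] is an arbitrary [k]-module, so flabbiness is not inherited by exactness; it holds because
    the maps [Ktr] witnessing it are [k]-linear. *)
Lemma flabby_NK : flabby NK.
Proof.
pose tr V V' n : {additive NK V n -> NK V' n} := lmap t (@Ktr_equiv V V' n).
apply: (@flabby_split X NK tr).
- by move=> V V' h n x; tens_elim x l c; rewrite !tmapE.
- by move=> V n x; tens_elim x l c; rewrite !tmapE Ktr_id.
- by move=> V V' V'' n x o o' o'' h; tens_elim x l c; rewrite !tmapE Ktr_comp.
- move=> V V1 V2 n x oV oV1 oV2 h1 h2 cov.
  elim/tensor_ind: x => [|l c|y z hy hz]; first by rewrite !raddf0.
    by rewrite !tmapE -!tpureDr Ktr_cover.
  by rewrite !raddfD addrACA hy hz addrACA.
- move=> V n x oV V0; elim/tensor_ind: x => [//|l c|y z -> ->]; last exact: addr0.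
  by rewrite (Ktr_empty c) // (balanced0r (balanced_tpure _ _)).
Qed.

Section Stalk.
Variable p : X.

Lemma Kaug_equiv : equiv (ralg (kmor p)) (aca (Kk (le p)) 0) (Kaug M p).
Proof.
move=> a m; apply: pmod_ext => u Vu; rewrite Kk_actE //.
move: Vu; rewrite KP_le => pu; rewrite !KaugE // (lmresZ (above_le pu)).
by rewrite kmor_res.
Qed.

Lemma Kev_equiv : equiv (aca (Kk (le p)) 0) (ralg (kmor p)) (Kev M p).
Proof.
move=> a c; rewrite !KevE Kk_actE ?KP_le ?above_rep // (lmresZ (rep_le p)).
by rewrite kmor_res.
Qed.

Lemma Khom_equiv n : equiv (aca (Kk (le p)) n.+1) (aca (Kk (le p)) n) (Khom M p n).
Proof.
move=> a c; apply: pmod_ext => u Vu; rewrite Kk_actE //.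
move: Vu; rewrite KP_le => pu; rewrite !KhomE // Kk_actE ?KP_le ?above_rep //.
have h : le (rep p) u := Defs.le_trans (rep_le p) (above_le pu).
by rewrite [LHS](pstalkE _ _ _ h) kmor_res.
Qed.

(** The contracting homotopy is [k]-linear, hence survives tensoring with [N]. *)
Lemma NK_stalk_exact n : exact_at (NK (le p)) n.+1.
Proof.
move=> x x0; exists (lmap t (@Khom_equiv n) x).
have h : lmap t (@Khom_equiv n.+1) (cd (NK (le p)) n.+1 x) +
    cd (NK (le p)) n (lmap t (@Khom_equiv n) x) = x.
  elim/tensor_ind: x {x0} => [|l c|y z hy hz]; first by rewrite !raddf0 addr0.
    by rewrite !tmapE -tpureDr KhomS.
  by rewrite !raddfD addrACA hy hz.
by rewrite x0 raddf0 add0r in h.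
Qed.

Lemma NK_stalk_aug (x : NK (le p) 0) : cd (NK (le p)) 0 x = 0 ->
  lmap t Kaug_equiv (lmap t Kev_equiv x) = x.
Proof.
move=> x0; have h : lmap t (@Khom_equiv 0) (cd (NK (le p)) 0 x) +
    lmap t Kaug_equiv (lmap t Kev_equiv x) = x.
  elim/tensor_ind: x {x0} => [|l c|y z hy hz]; first by rewrite !raddf0 addr0.
    by rewrite !tmapE -tpureDr Khom0.
  by rewrite !raddfD addrACA hy hz.
by rewrite x0 raddf0 add0r in h.
Qed.

Lemma NK_aug_closed z : cd (NK (le p)) 0 (lmap t Kaug_equiv z) = 0.
Proof.
elim/tensor_ind: z => [|l c|y z hy hz]; first by rewrite !raddf0.
  by rewrite !tmapE [cd _ _ _]Kd_aug (balanced0r (balanced_tpure _ _)).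
by rewrite !raddfD hy hz addr0.
Qed.

End Stalk.

Section Slice.
Variables (S : opcx X) (ka : opmap NK S).
Hypothesis S_flabby : flabby S.
Hypothesis ka_stalk : forall p, qis (ka (le p)).
Variables (x x'' : X) (hx : le x x'') (U U'' : pred X).
Variables (Ux : psub U (le x)) (Ux'' : psub U'' (le x'')) (hU : psub U'' U).
Hypotheses (oU : is_open U) (oU'' : is_open U'').
Hypothesis Xf : finite_space X.
Variables (s : forall n, act (stalk x) (S U n)) (s'' : forall n, act (stalk x'') (S U'' n)).
Hypothesis sE : forall n, equiv (s n) (s n.+1) (cd (S U) n).
Hypothesis sE'' : forall n, equiv (s'' n) (s'' n.+1) (cd (S U'') n).
Hypothesis ss : @semilin _ _ (res hx) (Acx sE) (Acx sE'') (ores S hU).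
Hypothesis ka_s : forall n a l c,
  ka U n (tpure t _ l (aca (KO Ux) n a c)) = s n a (ka U n (tpure t _ l c)).
Hypothesis ka_s'' : forall n a l c,
  ka U'' n (tpure t _ l (aca (KO Ux'') n a c)) = s'' n a (ka U'' n (tpure t _ l c)).

Definition idcmap (C : cplx) : cmap C C :=
  @Cmap C C (fun n => idadd (C n)) (fun n x => erefl).

Lemma KO_Kk_equiv y (V : pred X) (Vy : psub V (le y)) n :
  equiv (restr (kmor y) (aca (KO Vy) n)) (aca (Kk V) n) (idadd (Kcx M V n)).
Proof.
move=> a c; apply: pmod_ext => u Vu.
have yu := Vy _ (KP_sub Vu).
by rewrite [RHS](Kk_actE _ _ Vu) [LHS](KO_actE _ _ _ Vu yu) kmor_res.
Qed.

Lemma Kk_KO_equiv y (V : pred X) (Vy : psub V (le y)) n :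
  equiv (aca (Kk V) n) (restr (kmor y) (aca (KO Vy) n)) (idadd (Kcx M V n)).
Proof. by move=> a c; rewrite [RHS](@KO_Kk_equiv y V Vy n). Qed.

Definition NKO_cmap y (V : pred X) (Vy : psub V (le y)) :
  cmap (ntens (kmor y) t (KO Vy)) (NK V) :=
  @ltcm _ _ t (KO Vy) (Kk V) _ _ (fun n => equiv_restr (kmor y) (acE (KO Vy) n))
    (acE (Kk V)) (idcmap _) (@KO_Kk_equiv y V Vy).

Lemma NKO_qis y (V : pred X) (Vy : psub V (le y)) : qis (NKO_cmap Vy).
Proof.
pose g : cmap (NK V) (ntens (kmor y) t (KO Vy)) :=
  @ltcm _ _ t (Kk V) (KO Vy) _ _ (acE (Kk V))
    (fun n => equiv_restr (kmor y) (acE (KO Vy) n)) (idcmap _) (@Kk_KO_equiv y V Vy).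
by apply: (@qis_iso _ _ _ g) => n z; tens_elim z l c; rewrite !tmapE.
Qed.

(** [N (x)_k K] inherits base change from [K], and [ka], a quasi-isomorphism on every open set since
    both sides are flabby, carries it over to [S]. *)
Lemma slice_bc : qis (bcm (@KO_semilin _ _ hx _ _ Ux Ux'' hU)) -> qis (bcm ss).
Proof.
move=> q; have kq V : is_open V -> qis (ka V).
  exact: flabby_qis flabby_NK S_flabby ka_stalk V.
have fg c : res hx (kmor x c) = kmor x'' c by exact: kmor_res.
(* The bound [#|X|.+1] comes from [Kcx_bound], where the Godement complex vanishes in degrees above
   [#|X|]. *)
have q' := @bcm_ntens_qis _ _ _ (kmor x) _ _ fg N t _ _ _
  (@KO_semilin _ _ hx _ _ Ux Ux'' hU) #|X|.+1 _ _ _ _ q.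
have {}q' := q' (fun n => @KO_flat x U Ux n Xf) (fun n => @KO_flat x'' U'' Ux'' n Xf)
  (fun n hn => @Kcx_bound X M U n hn) (fun n hn => @Kcx_bound X M U'' n hn).
pose u := cmap_comp (ka U) (NKO_cmap Ux); pose v := cmap_comp (ka U'') (NKO_cmap Ux'').
move=> n; apply: (@bcm_transfer _ _ _ _ (Acx sE) _ (Acx sE'') _ _ _ ss u v) (q' n).
- move=> m a y; tens_elim y l c.
  by rewrite [aca _ _ _ _]nactE /= !tmapE ka_s.
- move=> m a y; tens_elim y l c.
  by rewrite [aca _ _ _ _]nactE /= !tmapE ka_s''.
- move=> m y; rewrite -[LHS]/(ores S hU m (ka U m (NKO_cmap Ux m y))) -om_res.
  congr (ka U'' m _).
  by tens_elim y l c; rewrite !tmapE.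
- exact/flat_mflat/Xf.
- by move=> m; apply: qis_at_comp; [exact: NKO_qis | exact: kq].
- by move=> m; apply: qis_at_comp; [exact: NKO_qis | exact: kq].
Qed.

End Slice.
End Tensored.
End StructureGodement.

(** * Sections of complexes of modules *)

Section SubModule.
Variables (X : ringedSpace) (M : omodule X).

Record submodule := Submodule {
  sm_at :> forall p : X, subgroup (M p);
  sm_scale : forall p (a : stalk p) m, sm_at p m -> sm_at p (a *: m);
  sm_res : forall p q (h : le p q) m, sm_at p m -> sm_at q (mres M h m) }.

Variable S : submodule.

Definition subom_stalk p : lmodType (stalk p) :=
  modof (subact (s := lact (M p)) (@sm_scale S p)).

Definition subom_val p (x : subom_stalk p) : M p := sgval (S p) x.

Lemma subom_val_inj p : injective (@subom_val p).
Proof. exact: sgval_inj. Qed.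

Lemma subom_valP p (x : subom_stalk p) : S p (subom_val x).
Proof. exact: sgvalP. Qed.

Lemma subom_valD p (x y : subom_stalk p) :
  subom_val (x + y) = subom_val x + subom_val y.
Proof. exact: raddfD. Qed.

Lemma subom_valZ p a (x : subom_stalk p) : subom_val (a *: x) = a *: subom_val x.
Proof. by []. Qed.

Definition subom_mk p m (Sm : S p m) : subom_stalk p := sgmk Sm.

Lemma subom_mkK p m (Sm : S p m) : subom_val (subom_mk Sm) = m.
Proof. by []. Qed.

Definition subom_res p q (h : le p q) (x : subom_stalk p) : subom_stalk q :=
  subom_mk (sm_res h (subom_valP x)).

Lemma subom_res_val p q (h : le p q) (x : subom_stalk p) :
  subom_val (subom_res h x) = mres M h (subom_val x).
Proof. by []. Qed.

Lemma subom_resD p q (h : le p q) : {morph subom_res h : x y / x + y}.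
Proof.
move=> x y; apply: subom_val_inj.
by rewrite subom_valD !subom_res_val subom_valD raddfD.
Qed.

Lemma subom_resZ p q (h : le p q) a x : subom_res h (a *: x) = res h a *: subom_res h x.
Proof.
by apply: subom_val_inj; rewrite subom_valZ !subom_res_val subom_valZ linearZ.
Qed.

Definition subom : omodule X.
Proof.
refine (@OModule X subom_stalk (fun p q h =>
  @mklin _ (subom_stalk p) (subom_stalk q) (res h \; *:%R)
    (@subom_res p q h) (subom_resD h) (subom_resZ h)) _ _).
- move=> p h x; rewrite mklinE; apply: subom_val_inj.
  by rewrite subom_res_val mres_id.
- move=> p q r pq qr pr x; rewrite !mklinE; apply: subom_val_inj.
  by rewrite !subom_res_val; exact: mres_comp.
Defined.

Lemma subom_mresE p q (h : le p q) (x : subom p) :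
  subom_val (mres subom h x) = mres M h (subom_val x).
Proof. by rewrite [mres _ _]lock /= -lock mklinE. Qed.

Definition subom_in : omorphism subom M.
Proof.
refine (@OMorphism X subom M (fun p => @mklin _ (subom_stalk p) (M p) *:%R
  (@subom_val p) (@subom_valD p) (@subom_valZ p)) _).
by move=> p q h x; rewrite !mklinE.
Defined.

Lemma subom_inE p (x : subom p) : subom_in p x = subom_val x.
Proof. exact: mklinE. Qed.

Lemma subom_in_mono : omono subom_in.
Proof. by move=> p x y; rewrite !subom_inE; exact: subom_val_inj. Qed.

Section Corestriction.
Variables (L : omodule X) (f : omorphism L M) (fS : forall p x, S p (f p x)).

Lemma subom_cor_subD p : {morph (fun x => subom_mk (fS x) : subom p) : x y / x + y}.
Proof. by move=> x y; apply: subom_val_inj; rewrite subom_valD !subom_mkK raddfD. Qed.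

Lemma subom_cor_subZ p (a : stalk p) x :
  (subom_mk (fS (a *: x)) : subom p) = a *: (subom_mk (fS x) : subom p).
Proof. by apply: subom_val_inj; rewrite subom_valZ !subom_mkK linearZ. Qed.

Definition subom_cor : omorphism L subom.
Proof.
refine (@OMorphism X L subom (fun p => @mklin _ (L p) (subom p) *:%R
  (fun x => subom_mk (fS x)) (@subom_cor_subD p) (@subom_cor_subZ p)) _).
move=> p q h x; rewrite !mklinE; apply: subom_val_inj.
by rewrite subom_res_val !subom_mkK omor_res.
Defined.

Lemma subom_corE p x : subom_val (subom_cor p x) = f p x.
Proof. by rewrite /= mklinE. Qed.

End Corestriction.
End SubModule.

Section SectionMaps.
Variable X : ringedSpace.

Definition sec_map_fun (M N : omodule X) (u : omorphism M N) (V : pred X) (s : sections M V) :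
  sections N V.
Proof.
exists (fun x hx => u x (germ s hx)) => x x' h hx hx'.
by rewrite omor_res (germ_res s h hx hx').
Defined.

Lemma sec_map_funD (M N : omodule X) (u : omorphism M N) (V : pred X) :
  {morph @sec_map_fun M N u V : s t / s + t}.
Proof. by move=> s t; apply: sections_ext => x hx; rewrite /= raddfD. Qed.

Definition sec_map (M N : omodule X) (u : omorphism M N) (V : pred X) :
  {additive sections M V -> sections N V} := mkadd (@sec_map_funD M N u V).

Lemma sec_mapE (M N : omodule X) (u : omorphism M N) (V : pred X) (s : sections M V) x (hx : V x) :
  germ (sec_map u V s) hx = u x (germ s hx).
Proof. by rewrite mkaddE. Qed.

Definition sec_res_fun (M : omodule X) (V V' : pred X) (h : psub V' V)
  (s : sections M V) : sections M V'.
Proof.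
exists (fun x hx => germ s (h x hx)) => x x' e hx hx'; exact: germ_res.
Defined.

Lemma sec_res_funD (M : omodule X) (V V' : pred X) (h : psub V' V) :
  {morph @sec_res_fun M V V' h : s t / s + t}.
Proof. by move=> s t; apply: sections_ext. Qed.

Definition sec_res (M : omodule X) (V V' : pred X) (h : psub V' V) :
  {additive sections M V -> sections M V'} := mkadd (sec_res_funD h).

Lemma sec_resE (M : omodule X) (V V' : pred X) (h : psub V' V) (s : sections M V) x
  (hx : V' x) (hx' : V x) : germ (sec_res M h s) hx = germ s hx'.
Proof. by rewrite mkaddE /= (bool_irrelevance (h x hx) hx'). Qed.

Variables (E : nat -> omodule X) (d : forall n, omorphism (E n) (E n.+1)).
Hypothesis dd : forall n (p : X) m, d n.+1 p (d n p m) = 0.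

Definition Gcx (V : pred X) : cplx.
Proof.
exists (fun n => sections (E n) V) (fun n => sec_map (d n) V) => n s.
by apply: sections_ext => x hx; rewrite !sec_mapE dd.
Defined.

Definition Gres (V V' : pred X) (h : psub V' V) : cmap (Gcx V) (Gcx V').
Proof.
exists (fun n => sec_res (E n) h) => n s.
by apply: sections_ext => x hx; rewrite !(sec_mapE, sec_resE _ _ _ (h x hx)).
Defined.

Lemma Gres_comp (V V' V'' : pred X) (h : psub V' V) (h' : psub V'' V')
  (h'' : psub V'' V) n (s : Gcx V n) : Gres h' n (Gres h n s) = Gres h'' n s.
Proof.
apply: sections_ext => x hx.
by rewrite (sec_resE _ _ _ (h'' x hx)) (sec_resE _ _ _ (h' x hx)) (sec_resE _ _ _ (h'' x hx)).
Qed.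

Definition Gopcx : opcx X := @Opcx X Gcx Gres Gres_comp.

End SectionMaps.

(** * Injective sheaves are flasque, and their sections form flabby complexes *)

Definition flasque (X : ringedSpace) (M : omodule X) := forall (V : pred X),
  is_open V -> forall s : sections M V,
  exists t : sections M predT, forall x (hx : V x), germ t (isT : predT x) = germ s hx.

Section Flasque.
Variable X : ringedSpace.

Section ExtensionByZero.
Variable V : pred X.
Hypothesis oV : is_open V.

(** The extension by zero of [O_V], as the subsheaf of [O] vanishing outside of [V]; the section [s]
    of [E] over [V] defines a morphism from it to [E]. *)
Definition zext_sub (p : X) : subgroup (structure_sheaf X p).
Proof.
exists (fun a => ~~ V p -> a = 0) => [//|a b ha hb Vp].
by rewrite ha ?hb ?subrr.
Defined.

Definition zext : submodule (structure_sheaf X).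
Proof.
exists zext_sub => [p a m h Vp|p q h m hm Vq]; first by rewrite h ?scaler0.
rewrite hm ?raddf0 //; apply: contra Vq; exact: oV.
Defined.

Variables (E : omodule X) (s : sections E V).

Definition zext_fun p (a : subom zext p) : E p :=
  if @idP (V p) is ReflectT hp then (subom_val a : stalk p) *: germ s hp else 0.

Lemma zext_funE p (a : subom zext p) (hp : V p) :
  zext_fun a = (subom_val a : stalk p) *: germ s hp.
Proof.
rewrite /zext_fun; case: {-}_ / idP => [hp'|//].
by rewrite (bool_irrelevance hp hp').
Qed.

Lemma zext_fun0 p (a : subom zext p) : ~~ V p -> zext_fun a = 0.
Proof. by move=> Vp; rewrite /zext_fun; case: {-}_ / idP => // hp; rewrite hp in Vp. Qed.

Lemma zext_funD p : {morph @zext_fun p : a b / a + b}.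
Proof.
move=> a b; have [hp|hp] := boolP (V p); last by rewrite !zext_fun0 ?addr0.
by rewrite !(zext_funE _ hp) subom_valD scalerDl.
Qed.

Lemma zext_funZ p c (a : subom zext p) : zext_fun (c *: a) = c *: zext_fun a.
Proof.
have [hp|hp] := boolP (V p); last by rewrite !zext_fun0 ?scaler0.
by rewrite !(zext_funE _ hp) subom_valZ scalerA.
Qed.

Definition zext_mor : omorphism (subom zext) E.
Proof.
refine (@OMorphism X (subom zext) E (fun p => @mklin _ (subom zext p) (E p) *:%R
  (@zext_fun p) (@zext_funD p) (@zext_funZ p)) _).
move=> p q h a; rewrite !mklinE.
have [hp|hp] := boolP (V p).
  have hq := oV h hp; rewrite (zext_funE _ hp) (zext_funE _ hq) linearZ_LR /=.
  by rewrite (germ_res s h hp hq).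
have a0 : a = 0.
  by apply: subom_val_inj; rewrite (subom_valP a hp).
rewrite zext_fun0 // raddf0 a0.
have -> : subom_res h (0 : subom zext p) = 0.
  by apply: subom_val_inj; rewrite subom_res_val [subom_val _]/(0 : stalk p) raddf0.
have [hq|hq] := boolP (V q); last by rewrite zext_fun0.
by rewrite (zext_funE _ hq) [subom_val _]/(0 : stalk q) scale0r.
Defined.

(** A morphism from the extension by zero of [O_V] extends to [O] by injectivity, and the image of 1
    is the wanted global section. *)
Lemma injective_extend : injective_omodule E ->
  exists t : sections E predT, forall x (hx : V x), germ t (isT : predT x) = germ s hx.
Proof.
move=> Einj; have [v vE] := Einj _ _ _ zext_mor (subom_in_mono (S := zext)).
have vc x x' (h : le x x') (hx hx' : true) :
    mres E h (v x (1 : stalk x)) = v x' (1 : stalk x').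
  by rewrite omor_res; congr (v x' _); rewrite /= /sheaf_res rmorph1.
exists (@Sections X E predT (fun x _ => v x (1 : stalk x)) vc) => x hx /=.
have h1 : zext x (1 : stalk x) by move=> /=; rewrite hx.
have := vE x (subom_mk h1); rewrite subom_inE subom_mkK => ->.
by rewrite /= mklinE (zext_funE _ hx) subom_mkK scale1r.
Qed.

End ExtensionByZero.

Lemma injective_flasque (E : omodule X) : injective_omodule E -> flasque E.
Proof. by move=> Einj V oV s; exact: injective_extend. Qed.

Variables (E : nat -> omodule X) (d : forall n, omorphism (E n) (E n.+1)).
Hypothesis dd : forall n (p : X) m, d n.+1 p (d n p m) = 0.

Lemma flabby_sections : (forall n, flasque (E n)) -> flabby (Gopcx dd).
Proof.
move=> Ef; split.
- move=> V V' h n oV oV' s; have [t ht] := Ef n V' oV' s.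
  have hT : psub V predT by [].
  exists (sec_res (E n) hT t); apply: sections_ext => x hx.
  by rewrite (sec_resE _ _ _ (h x hx)) (sec_resE _ _ _ isT) ht.
- move=> V V1 V2 h1 h2 n _ _ _ cov s s1 s2; apply: sections_ext => x hx.
  have /orP[hx'|hx'] := cov x hx.
    have := congr1 (fun t : sections (E n) V1 => germ t hx') s1.
    by rewrite (sec_resE _ _ _ hx).
  have := congr1 (fun t : sections (E n) V2 => germ t hx') s2.
  by rewrite (sec_resE _ _ _ hx).
- move=> V V1 V2 W h1 h2 w1 w2 n oV oV1 oV2 oW cov covW s1 s2 e.
  have e12 x (hx1 : V1 x) (hx2 : V2 x) : germ s1 hx1 = germ s2 hx2.
    have hW := covW x hx1 hx2.
    have := congr1 (fun t : sections (E n) W => germ t hW) e.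
    by rewrite (sec_resE _ _ _ hx1) (sec_resE _ _ _ hx2).
  pose g x (hx : V x) : E n x := if @idP (V1 x) is ReflectT hx1 then germ s1 hx1
    else if @idP (V2 x) is ReflectT hx2 then germ s2 hx2 else 0.
  have g1 x (hx : V x) (hx1 : V1 x) : g x hx = germ s1 hx1.
    rewrite /g; case: {-}_ / idP => [hx1'|//].
    by rewrite (bool_irrelevance hx1 hx1').
  have g2 x (hx : V x) (hx2 : V2 x) : g x hx = germ s2 hx2.
    rewrite /g; case: {-}_ / idP => [hx1'|_]; first exact: e12.
    case: {-}_ / idP => [hx2'|//].
    by rewrite (bool_irrelevance hx2 hx2').
  have gr x x' (h : le x x') (hx : V x) (hx' : V x') :
      mres (E n) h (g x hx) = g x' hx'.
    have /orP[hi|hi] := cov x hx.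
      by rewrite (g1 _ _ hi) (g1 _ _ (oV1 _ _ h hi)); exact: germ_res.
    by rewrite (g2 _ _ hi) (g2 _ _ (oV2 _ _ h hi)); exact: germ_res.
  exists (@Sections X (E n) V g gr); split; apply: sections_ext => x hx.
    by rewrite (sec_resE _ _ _ (h1 x hx)) /= (g1 _ _ hx).
  by rewrite (sec_resE _ _ _ (h2 x hx)) /= (g2 _ _ hx).
- by move=> V n _ V0 s; apply: sections_ext => x hx; have := V0 x; rewrite hx.
Qed.

(** A section over [U_p] is determined by its germ at [p], and every element of the stalk at [p] is
    such a germ. *)
Lemma sections_stalk_exact (p : X) n : oexact (d n) (d n.+1) -> exact_at (Gopcx dd (le p)) n.+1.
Proof.
move=> de s s0; have pp := Defs.le_refl p.
have [|m hm] := (de p (germ s pp)).1.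
  by rewrite -sec_mapE; have -> : sec_map (d n.+1) (le p) s = 0 by exact: s0.
have mr x x' (h : le x x') (hx : le p x) (hx' : le p x') :
    mres (E n) h (mres (E n) hx m) = mres (E n) hx' m by exact: mres_comp.
exists (@Sections X (E n) (le p) (fun x hx => mres (E n) hx m) mr).
apply: sections_ext => x hx; rewrite [LHS]sec_mapE /= -omor_res hm.
exact: germ_res.
Qed.

End Flasque.

(** * Injective resolutions *)

Section InjectiveHull.
Variables (R : comPzRingType) (M : lmodType R) (S : subgroup M).
Hypothesis SZ : forall (a : R) m, S m -> S (a *: m).

Record character := Character {
  char_map :> {additive M -> ratmodZ};
  char_sub : forall m, S m -> char_map m = 0 }.

(* The coinduced modules [Hom_Z(R, Q/Z)], one for each character of [M / S]. *)
Definition hull_fun := (character -> R -> ratmodZ) : zmodType.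

Definition hull_sub : subgroup hull_fun.
Proof.
exists (fun h => forall c r r', h c (r + r') = h c r + h c r').
  by move=> c r r'; rewrite -[LHS]/0 -[RHS]/(0 + 0) addr0.
move=> h h' hD hD' c r r'.
rewrite -[LHS]/(h c (r + r') - h' c (r + r')) hD hD'.
by rewrite -[RHS]/((h c r - h' c r) + (h c r' - h' c r')) opprD addrACA.
Defined.

Definition hull_act_fun (a : R) (h : subg hull_sub) : subg hull_sub.
Proof.
apply: (@sgmk _ hull_sub (fun c r => sgval _ h c (r * a))) => c r r'.
by rewrite mulrDl; exact: (sgvalP h).
Defined.

Lemma hull_actE a h c r : sgval _ (hull_act_fun a h) c r = sgval _ h c (r * a).
Proof. by []. Qed.

Definition hull_act : act R (subg hull_sub).
Proof.
exists hull_act_fun => [a b h|a h h'|a b h|h]; apply: sgval_inj;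
  apply: funext => c; apply: funext => r.
- rewrite hull_actE mulrDr; exact: (sgvalP h).
- by [].
- by rewrite !hull_actE mulrA.
- by rewrite hull_actE mulr1.
Defined.

Definition hull : lmodType R := modof hull_act.

(** A linear map into [Hom_Z(R, Q/Z)] amounts to an additive map to [Q/Z], by evaluation at 1, and
    the latter extends to [N']. *)
Lemma hull_injective (N N' : lmodType R) (i : {linear N -> N'})
  (u : {linear N -> hull}) : injective i ->
  exists v : {linear N' -> hull}, forall n, v (i n) = u n.
Proof.
move=> i_inj.
pose uu n c r : ratmodZ := sgval hull_sub (u n) c r.
have uuB n n' c r : uu (n - n') c r = uu n c r - uu n' c r.
  by rewrite /uu raddfB.
have ex c : exists f : {additive N' -> ratmodZ}, forall n, f (i n) = uu n c 1.
  pose G p := exists n, p = (i n, uu n c 1).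
  have [|f fE] := @partial_hom_extend N' G.
    split; first by exists 0; rewrite raddf0 /uu raddf0.
    - by move=> _ _ [n ->] [n' ->]; exists (n - n'); rewrite raddfB uuB.
    - move=> a [n [/esym n0 ->]].
      have -> : n = 0 by apply: i_inj; rewrite n0 raddf0.
      by rewrite /uu raddf0.
  by exists f => n; apply: fE; exists n.
have [f fE] := choice ex.
have vS n' : hull_sub (fun c r => f c (r *: n')).
  by move=> c r r'; rewrite scalerDl raddfD.
pose v n' : hull := sgmk (vS n').
have vD : {morph v : x y / x + y}.
  move=> x y; apply: sgval_inj; apply: funext => c; apply: funext => r.
  by rewrite -[LHS]/(f c (r *: (x + y))) scalerDr raddfD.
have vZ a x : v (a *: x) = a *: v x.
  apply: sgval_inj; apply: funext => c; apply: funext => r.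
  by rewrite -[LHS]/(f c (r *: (a *: x))) scalerA.
exists (mklin vD vZ) => n; rewrite mklinE.
apply: sgval_inj; apply: funext => c; apply: funext => r.
rewrite -[LHS]/(f c (r *: i n)) -linearZ fE /uu linearZ /=.
by rewrite -[LHS]/(sgval hull_sub (u n) c (1 * r)) mul1r.
Qed.

Definition hull_emb_fun (m : M) : hull.
Proof.
apply: (@sgmk _ hull_sub (fun c r => c (r *: m))) => c r r'.
by rewrite scalerDl raddfD.
Defined.

Lemma hull_emb_funE m c r : sgval hull_sub (hull_emb_fun m) c r = c (r *: m).
Proof. by []. Qed.

Lemma hull_embD : {morph hull_emb_fun : x y / x + y}.
Proof.
move=> x y; apply: sgval_inj; apply: funext => c; apply: funext => r.
by rewrite hull_emb_funE scalerDr raddfD.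
Qed.

Lemma hull_embZ a m : hull_emb_fun (a *: m) = a *: hull_emb_fun m.
Proof.
apply: sgval_inj; apply: funext => c; apply: funext => r.
by rewrite hull_emb_funE scalerA.
Qed.

Definition hull_emb : {linear M -> hull} := mklin hull_embD hull_embZ.

(** Characters vanishing on [S] separate points from [S], so [M / S] embeds into an injective module
    without being formed. *)
Lemma hull_emb_kernel m : hull_emb m = 0 <-> S m.
Proof.
rewrite mklinE; split=> [m0|Sm]; last first.
  apply: sgval_inj; apply: funext => c; apply: funext => r.
  by rewrite hull_emb_funE (char_sub c) //; exact: SZ.
apply: contrapT => Sm.
have [f f0 fm] := ratmodZ_cogenerator (subgroup0 S) (@subgroupB _ S) Sm.
apply: fm; have := congr1 (fun h => sgval hull_sub h (Character f0) 1) m0.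
by rewrite hull_emb_funE scale1r.
Qed.

End InjectiveHull.

Section Resolution.
Variable X : ringedSpace.

(** A morphism from [M] to [gC J] amounts to linear maps from [M_u] to [J_u] at the representatives
    [u], which are extended one by one. *)
Lemma gC_injective (J : forall u : X, lmodType (stalk u)) :
  (forall u (N N' : lmodType (stalk u)) (i : {linear N -> N'})
    (w : {linear N -> J u}), injective i ->
    exists v : {linear N' -> J u}, forall n, v (i n) = w n) ->
  injective_omodule (gC J).
Proof.
move=> Jinj M N i w i_mono.
pose F := (fun u => J u : zmodType).
pose ev u (m : M u) : J u := (w u m : pmod (above u) F) u.
have evD u : {morph @ev u : x y / x + y} by move=> x y; rewrite /ev raddfD [LHS]paddE.
have evZ u a (m : M u) : ev u (a *: m) = a *: ev u m.
  by rewrite /ev linearZ [LHS](pstalkE _ _ _ (Defs.le_refl u)) res_id.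
pose f u := projT1 (cid (Jinj u _ _ (i u) (mklin (@evD u) (@evZ u)) (@i_mono u))).
have fE u m : f u (i u m) = ev u m.
  by rewrite /f; case: cid => v /= ->; rewrite mklinE.
pose v p (n : N p) : gC J p := pmap (above p) (fun u => f u \o lmres N p u) n.
have vE p (n : N p) u : above p u -> (v p n : pmod (above p) F) u = f u (lmres N p u n).
  by move=> pu; rewrite /v pmapE.
have vD p : {morph @v p : x y / x + y} by move=> x y; exact: raddfD.
have vZ p a (n : N p) : v p (a *: n) = a *: v p n.
  apply: pmod_ext => u pu; have hu := above_le pu.
  by rewrite [RHS](pstalkE _ _ _ hu) !vE // (lmresZ hu) linearZ.
have vr p q (h : le p q) (n : N p) :
    mres (gC J) h (mklin (@vD p) (@vZ p) n) = mklin (@vD q) (@vZ q) (mres N h n).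
  apply: pmod_ext => u qu; have pu := above_trans h qu.
  rewrite gC_resE // !(mklinE (@vD _)) !vE // -lmresE lmres_comp //.
  exact: above_le.
exists (@OMorphism X N (gC J) (fun p => mklin (@vD p) (@vZ p)) vr) => p m.
apply: pmod_ext => u pu; have hu := above_le pu.
rewrite [LHS](congr1 (fun z : pmod (above p) F => z u) (mklinE (@vD p) (@vZ p) _)).
rewrite vE // (lmresE hu) omor_res fE /ev -omor_res gC_resE //.
by case/andP: pu => _ ru; rewrite /above Defs.le_refl.
Qed.

Section Step.
Variables (M : omodule X) (S : submodule M).

Definition inj_step : omodule X := gC (fun u => hull (S u)).

Notation F := (fun u => hull (S u) : zmodType).

Definition inj_step_fun p (m : M p) : inj_step p :=
  pmap (F := F) (above p) (fun u => hull_emb (S u) \o lmres M p u) m.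

Lemma inj_step_funE p (m : M p) u : above p u ->
  (inj_step_fun m : pmod (above p) F) u = hull_emb (S u) (lmres M p u m).
Proof. by move=> pu; rewrite /inj_step_fun pmapE. Qed.

Lemma inj_step_funD p : {morph @inj_step_fun p : x y / x + y}.
Proof. by move=> x y; exact: raddfD. Qed.

Lemma inj_step_funZ p (a : stalk p) m : inj_step_fun (a *: m) = a *: inj_step_fun m.
Proof.
apply: pmod_ext => u pu; have hu := above_le pu.
by rewrite [RHS](pstalkE _ _ _ hu) !inj_step_funE // (lmresZ hu) linearZ.
Qed.

Definition inj_step_map : omorphism M inj_step.
Proof.
refine (@OMorphism X M inj_step (fun p => mklin (@inj_step_funD p) (@inj_step_funZ p)) _).
move=> p q h m; rewrite !(mklinE (@inj_step_funD _)); apply: pmod_ext => u qu.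
have pu := above_trans h qu.
rewrite gC_resE // !inj_step_funE // -lmresE lmres_comp //; exact: above_le.
Defined.

Lemma inj_step_mapE p m : inj_step_map p m = inj_step_fun m.
Proof. exact: mklinE. Qed.

Lemma inj_step_kernel p m : inj_step_map p m = 0 <-> S p m.
Proof.
rewrite inj_step_mapE; split=> [m0|Sm].
  have := congr1 (fun z : pmod (above p) F => z (rep p)) m0.
  rewrite inj_step_funE ?above_rep // pmod0E.
  move=> /(hull_emb_kernel (fun a m => @sm_scale _ _ S _ a m)).
  rewrite (lmresE (le_rep p)) => /(sm_res (rep_le p)).
  by rewrite (mres_comp _ _ (Defs.le_refl p)) mres_id.
apply: pmod_ext => u pu; rewrite inj_step_funE // pmod0E.
apply/(hull_emb_kernel (fun a m => @sm_scale _ _ S _ a m)).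
by rewrite (lmresE (above_le pu)); exact: sm_res.
Qed.

Lemma inj_step_injective : injective_omodule inj_step.
Proof. by apply: gC_injective => u; exact: hull_injective. Qed.

End Step.

Definition om_image (M N : omodule X) (f : omorphism M N) : submodule N.
Proof.
exists (fun p => img (f p)) => [p a _ [m <-]|p q h _ [m <-]].
  by exists (a *: m); exact: (linearZ_LR (f p) a m).
by exists (mres M h m); rewrite omor_res.
Defined.

Definition om_zero (M : omodule X) : submodule M.
Proof.
exists (fun p => kerg (idadd (M p))) => [p a m /= ->|p q h m /= ->].
  by rewrite scaler0.
by rewrite raddf0.
Defined.

(** [inj_step] is iterated on pairs of a sheaf and a submodule. The new submodule is the image of
    the map just built, so it becomes the kernel of the next map; the start is the zero submodule of
    [M]. *)
Lemma injective_resolution_exists (M : omodule X) :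
  exists E e d, @injective_resolution X M E e d.
Proof.
pose st : Type := {N : omodule X & submodule N}.
pose nx (z : st) : st := existT _ (inj_step (projT2 z)) (om_image (inj_step_map (projT2 z))).
pose z0 : st := existT _ M (om_zero M).
pose z n := iter n.+1 nx z0.
exists (fun n => projT1 (z n)), (inj_step_map (om_zero M)),
  (fun n => inj_step_map (projT2 (z n))).
split=> [n||n].
- exact: inj_step_injective.
- split=> [p|p m]; last exact: inj_step_kernel.
  by apply: additive_inj => m /inj_step_kernel.
- by move=> p m; exact: inj_step_kernel.
Qed.

End Resolution.

(** * Inverse images of the Godement resolution *)

Section Pullback.
Variables (Z W : ringedSpace) (pi : ringedMor Z W).

Section Module.
Variable G : omodule W.

Definition pb_act z : act (stalk z) (tensor (ralg (comor pi z)) (lact (G (pi z)))) :=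
  bact (comor pi z) (lact (G (pi z))).

Definition pb_stalk z : lmodType (stalk z) := modof (pb_act z).

Definition pbpure z (b : stalk z) (g : G (pi z)) : pb_stalk z :=
  tpure (ralg (comor pi z)) (lact (G (pi z))) b g.

Lemma pbpureZ z a b g : a *: pbpure (z := z) b g = pbpure (a * b) g.
Proof. by rewrite [LHS]tactE. Qed.

Lemma pb_res_balanced z z' (h : le z z') :
  balanced (ralg (comor pi z)) (lact (G (pi z)))
    (fun b g => pbpure (res h b) (mres G (mor_le pi h) g)).
Proof.
split=> [b b' g|b g g'|a b g].
- by rewrite rmorphD [LHS]tpureDl.
- by rewrite raddfD [LHS]tpureDr.
- have e : mres G (mor_le pi h) (lact (G (pi z)) a g) =
      lact (G (pi z')) (res (mor_le pi h) a) (mres G (mor_le pi h) g).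
    exact: linearZ_LR.
  rewrite e rmorphM comor_res.
  exact: (tpureZ (ralg (comor pi z')) (lact (G (pi z')))).
Qed.

Definition pb_res z z' (h : le z z') : {additive pb_stalk z -> pb_stalk z'} :=
  tliftA (pb_res_balanced h).

Lemma pb_resE z z' (h : le z z') b g :
  pb_res h (pbpure b g) = pbpure (res h b) (mres G (mor_le pi h) g).
Proof. exact: tliftAE. Qed.

Lemma pb_ind z (P : pb_stalk z -> Prop) :
  P 0 -> (forall b g, P (pbpure b g)) -> (forall x y, P x -> P y -> P (x + y)) ->
  forall x, P x.
Proof. exact: tensor_ind. Qed.

Lemma pb_resZ z z' (h : le z z') a x : pb_res h (a *: x) = res h a *: pb_res h x.
Proof.
elim/pb_ind: x => [|b g|x y hx hy].
- by rewrite scaler0 !raddf0.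
- by rewrite pbpureZ !pb_resE pbpureZ rmorphM.
- by rewrite scalerDr !raddfD hx hy.
Qed.

(** The inverse image of [G], whose stalk at [z] is [G_(pi z)] tensored with [O_z] over
    [O_(pi z)]. *)
Definition pb : omodule Z.
Proof.
refine (@OModule Z pb_stalk (fun z z' h => mklin (raddfD (pb_res h)) (pb_resZ h)) _ _).
- move=> z h x; rewrite mklinE; elim/pb_ind: x => [|b g|x y hx hy].
  + exact: raddf0.
  + by rewrite pb_resE res_id mres_id.
  + by rewrite raddfD hx hy.
- move=> z z' z'' h h' h'' x; rewrite !mklinE; elim/pb_ind: x => [|b g|x y hx hy].
  + by rewrite !raddf0.
  + by rewrite !pb_resE (res_comp h h' h'') (mres_comp _ _ (mor_le pi h'')).
  + by rewrite !raddfD hx hy.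
Defined.

Lemma pb_mresE z z' (h : le z z') b g :
  mres pb h (pbpure b g) = pbpure (res h b) (mres G (mor_le pi h) g).
Proof. by rewrite [mres _ _]lock /= -lock mklinE pb_resE. Qed.

End Module.

Lemma lin_equiv (A : comPzRingType) (M N : lmodType A) (u : {linear M -> N}) :
  equiv (lact M) (lact N) u.
Proof. by move=> a x; exact: linearZ_LR. Qed.

Definition pb_map (G H : omodule W) z (u : {linear G (pi z) -> H (pi z)}) :
  {additive pb_stalk G z -> pb_stalk H z} :=
  lmap (ralg (comor pi z)) (lin_equiv u).

Lemma pb_mapE (G H : omodule W) z (u : {linear G (pi z) -> H (pi z)}) b g :
  pb_map u (pbpure b g) = pbpure b (u g).
Proof. exact: tmapE. Qed.

Lemma pb_mapD (G H : omodule W) z (u : {linear G (pi z) -> H (pi z)}) (x y : pb_stalk G z) :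
  pb_map u (x + y) = (pb_map u x : pb_stalk H z) + (pb_map u y : pb_stalk H z).
Proof. exact: raddfD. Qed.

Lemma pb_mapZ (G H : omodule W) z (u : {linear G (pi z) -> H (pi z)})
  (a : stalk z) (x : pb_stalk G z) :
  pb_map u (a *: x) = a *: (pb_map u x : pb_stalk H z).
Proof.
elim/pb_ind: x => [|b g|x y hx hy].
- by rewrite scaler0 !raddf0.
- by rewrite pbpureZ !pb_mapE pbpureZ.
- by rewrite scalerDr !raddfD hx hy.
Qed.

Definition pb_mor (G H : omodule W) (u : omorphism G H) : omorphism (pb G) (pb H).
Proof.
refine (@OMorphism Z (pb G) (pb H)
  (fun z => mklin (raddfD (pb_map (u (pi z)))) (pb_mapZ (u (pi z)))) _).
move=> z z' h x; rewrite !(mklinE (raddfD (pb_map _))).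
elim/pb_ind: x => [|b g|x y hx hy]; first by rewrite !raddf0.
  by rewrite pb_mapE !pb_mresE pb_mapE omor_res.
by rewrite raddfD !linearD raddfD hx hy.
Defined.

Lemma pb_morE (G H : omodule W) (u : omorphism G H) z x :
  pb_mor u z x = pb_map (u (pi z)) x.
Proof. exact: mklinE. Qed.

Definition gev_fun (M : omodule W) p (c : gC M p) : M p :=
  lmres M (rep p) p ((c : pmod (above p) (mstalk M)) (rep p)).

Lemma gev_scale (M : omodule W) p a (c : gC M p) :
  gev_fun (a *: c) = a *: gev_fun c.
Proof.
rewrite /gev_fun [X in lmres _ _ _ X](pstalkE _ _ _ (le_rep p)) (lmresZ (rep_le p)).
by rewrite (res_comp _ _ (Defs.le_refl p)) res_id.
Qed.

Lemma gev_add (M : omodule W) p (x y : gC M p) :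
  gev_fun (x + y) = gev_fun x + gev_fun y.
Proof. by rewrite /gev_fun [X in lmres _ _ _ X]paddE raddfD. Qed.

(* The stalkwise (not natural) splitting of [M -> C M -> Z M]. *)
Definition gev (M : omodule W) p : {linear gC M p -> M p} :=
  mklin (@gev_add M p) (@gev_scale M p).

Lemma gev_gi (M : omodule W) p m : gev M p (gi M p m) = m.
Proof.
rewrite mklinE /gev_fun giE ?above_rep // lmres_comp ?lmres_id ?le_rep //.
exact: rep_le.
Qed.

Lemma gsec_scale (M : omodule W) p a (z : gZ M p) :
  ptr (mstalk M) (sabove p) (above p) (a *: z) =
  a *: (ptr (mstalk M) (sabove p) (above p) z : gC M p).
Proof.
apply: pmod_ext => u pu; have hu := above_le pu.
rewrite ptrE // [LHS](pstalkE _ _ _ hu) [RHS](pstalkE _ _ _ hu).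
by rewrite ptrE.
Qed.

Definition gsec (M : omodule W) p : {linear gZ M p -> gC M p} :=
  @mklin _ (gZ M p) (gC M p) *:%R (fun z => ptr (mstalk M) (sabove p) (above p) z)
    (raddfD _) (@gsec_scale M p).

Lemma gq_gsec (M : omodule W) p z : gq M p (gsec M p z) = z.
Proof. by rewrite gqE mklinE pdelta_ptr // pdelta_id. Qed.

Lemma gsec_gq (M : omodule W) p c : exists m, c = gsec M p (gq M p c) + gi M p m.
Proof.
have [|m hm] := (@gq_gi _ M p (c - gsec M p (gq M p c))).1.
  by rewrite linearB gq_gsec subrr.
by exists m; rewrite hm addrC subrK.
Qed.

(** [gsec] does not commute with restriction, but the defect lies in [M], which is killed by the
    maps to which this is applied. *)
Lemma gsec_res (M : omodule W) p q (h : le p q) z :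
  exists m, mres (gC M) h (gsec M p z) = gsec M q (mres (gZ M) h z) + gi M q m.
Proof.
have [m hm] := gsec_gq (mres (gC M) h (gsec M p z)).
by exists m; rewrite {1}hm -omor_res gq_gsec.
Qed.

(** Inverse images do not preserve injections in general; here the stalkwise splitting [gev] does
    it. *)
Lemma pb_gi_mono (M : omodule W) : omono (pb_mor (gi M)).
Proof.
move=> z; apply: (can_inj (g := pb_map (gev M (pi z)))) => x; rewrite pb_morE.
elim/pb_ind: x => [|b g|x y hx hy]; first by rewrite !raddf0.
  by rewrite !pb_mapE gev_gi.
by rewrite !raddfD hx hy.
Qed.

Section Lift.
Variables (E : nat -> omodule Z) (d : forall n, omorphism (E n) (E n.+1)).
Variable e : omorphism (structure_sheaf Z) (E 0).
Hypothesis Eres : injective_resolution e d.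

Notation M := (structure_sheaf W).

Lemma resolution_dd n z m : d n.+1 z (d n z m) = 0.
Proof. by apply/(resolution_exact Eres); exists m. Qed.

Lemma resolution_de z m : d 0 z (e z m) = 0.
Proof. by have [_ h] := resolution_aug Eres; apply/h; exists m. Qed.

(** The inductive datum: a morphism from the inverse image of [Z^n] to the cycles of [E n], which
    injectivity of [E n] extends in [lift_C] to the inverse image of the [n]-th Godement term. *)
Record lift_state n := LiftState {
  ls_map :> omorphism (pb (gZn M n)) (E n);
  ls_closed : forall z x, d n z (ls_map z x) = 0 }.

Definition lift_C n (s : lift_state n) : omorphism (pb (gC (gZn M n))) (E n) :=
  projT1 (cid (resolution_injective Eres s (@pb_gi_mono (gZn M n)))).

Lemma lift_CE n (s : lift_state n) z m :
  lift_C s z (pb_mor (gi (gZn M n)) z m) = s z m.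
Proof. by rewrite /lift_C; case: cid => v /= ->. Qed.

Lemma lift_C_kill n (s : lift_state n) z m :
  d n z (lift_C s z (pb_map (gi (gZn M n) (pi z)) m)) = 0.
Proof. by rewrite -pb_morE lift_CE ls_closed. Qed.

(** The composite of [lift_C s] with [d n] kills the inverse image of [Z^n], so it factors through
    that of [Z^(n+1)]: [gsec] supplies preimages on stalks, and by [gsec_res] the result commutes
    with restrictions. *)
Definition lift_next_fun n (s : lift_state n) z (x : pb (gZn M n.+1) z) : E n.+1 z :=
  d n z (lift_C s z (pb_map (gsec (gZn M n) (pi z)) x)).

Lemma lift_next_add n (s : lift_state n) z :
  {morph @lift_next_fun n s z : x y / x + y}.
Proof. by move=> x y; rewrite /lift_next_fun pb_mapD !linearD. Qed.

Lemma lift_next_scale n (s : lift_state n) z a x :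
  lift_next_fun s (a *: x) = a *: @lift_next_fun n s z x.
Proof. by rewrite /lift_next_fun pb_mapZ !linearZ. Qed.

Lemma lift_next_res n (s : lift_state n) z z' (h : le z z') x :
  mres (E n.+1) h (lift_next_fun s x) = lift_next_fun s (mres (pb (gZn M n.+1)) h x).
Proof.
elim/pb_ind: x => [|b g|x y hx hy].
- by rewrite !raddf0 /lift_next_fun !raddf0.
- rewrite /lift_next_fun pb_mapE !omor_res !pb_mresE pb_mapE.
  have [m hm] := gsec_res (mor_le pi h) g.
  rewrite hm.
  have -> : pbpure (res h b) (gsec (gZn M n) (pi z') (mres (gZ (gZn M n)) (mor_le pi h) g)
      + gi (gZn M n) (pi z') m) =
    pbpure (res h b) (gsec (gZn M n) (pi z') (mres (gZ (gZn M n)) (mor_le pi h) g))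
    + pb_map (gi (gZn M n) (pi z')) (pbpure (res h b) m).
    by rewrite pb_mapE [LHS]tpureDr.
  by rewrite !linearD lift_C_kill addr0.
- by rewrite lift_next_add linearD hx hy [in RHS]linearD lift_next_add.
Qed.

Definition lift_next n (s : lift_state n) : lift_state n.+1.
Proof.
pose u : omorphism (pb (gZn M n.+1)) (E n.+1) := @OMorphism Z (pb (gZn M n.+1)) (E n.+1)
  (fun z => mklin (@lift_next_add n s z) (@lift_next_scale n s z)) (fun z z' h x =>
    etrans (congr1 _ (mklinE _ _ x)) (etrans (lift_next_res s h x) (esym (mklinE _ _ _)))).
exists u => z x; rewrite [u z x]mklinE; exact: resolution_dd.
Defined.

Lemma lift_nextE n (s : lift_state n) z x :
  lift_next s z x = d n z (lift_C s z (pb_map (gsec (gZn M n) (pi z)) x)).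
Proof. by rewrite [LHS]mklinE. Qed.

Lemma lift_C_next n (s : lift_state n) z x :
  lift_C (lift_next s) z (pb_map (gi (gZn M n.+1) (pi z)) (pb_map (gq (gZn M n) (pi z)) x))
  = d n z (lift_C s z x).
Proof.
rewrite -pb_morE lift_CE lift_nextE.
elim/pb_ind: x => [|b g|x y hx hy]; first by rewrite !raddf0.
  rewrite !pb_mapE; have [m hm] := gsec_gq g.
  rewrite [in RHS]hm.
  have -> : pbpure b (gsec (gZn M n) (pi z) (gq (gZn M n) (pi z) g) + gi (gZn M n) (pi z) m)
    = pbpure b (gsec (gZn M n) (pi z) (gq (gZn M n) (pi z) g))
      + pb_map (gi (gZn M n) (pi z)) (pbpure b m).
    by rewrite pb_mapE [LHS]tpureDr.
  by rewrite !linearD lift_C_kill addr0.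
by rewrite !pb_mapD !linearD hx hy.
Qed.

Lemma lift0_equiv z : equiv (lact (M (pi z))) (restr (comor pi z) (mulact (stalk z)))
  (comor pi z : {additive M (pi z) -> stalk z}).
Proof. by move=> a x; rewrite [LHS]rmorphM. Qed.

Definition lift0_mul z : {additive pb_stalk M z -> structure_sheaf Z z} :=
  bcmap (@lift0_equiv z).

Lemma lift0_mulE z (b : stalk z) (a : stalk (pi z)) :
  lift0_mul z (pbpure (G := M) b a) = b * comor pi z a :> stalk z.
Proof. by rewrite [LHS]bcmapE. Qed.

Lemma lift0_add z : {morph (fun x : pb M z => e z (lift0_mul z x)) : x y / x + y}.
Proof. by move=> x y; rewrite [lift0_mul _ _]raddfD linearD. Qed.

Lemma lift0_scale z (a : stalk z) (x : pb M z) :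
  e z (lift0_mul z (a *: x)) = a *: e z (lift0_mul z x).
Proof.
rewrite -linearZ; congr (e z _); elim/pb_ind: x => [|b g|x y hx hy].
- by rewrite scaler0 !raddf0.
- by rewrite pbpureZ !lift0_mulE -mulrA.
- by rewrite scalerDr !raddfD hx hy.
Qed.

Lemma lift0_res z z' (h : le z z') (x : pb M z) :
  mres (E 0) h (e z (lift0_mul z x)) = e z' (lift0_mul z' (mres (pb M) h x)).
Proof.
rewrite omor_res; congr (e z' _); elim/pb_ind: x => [|b g|x y hx hy].
- by rewrite !raddf0.
- by rewrite pb_mresE !lift0_mulE /= /sheaf_res rmorphM comor_res.
- by rewrite [lift0_mul _ _]raddfD !linearD hx hy raddfD.
Qed.

Definition lift0 : lift_state 0.
Proof.
pose u : omorphism (pb M) (E 0) := @OMorphism Z (pb M) (E 0)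
  (fun z => mklin (@lift0_add z) (@lift0_scale z)) (fun z z' h x =>
    etrans (congr1 _ (mklinE _ _ x)) (etrans (lift0_res h x) (esym (mklinE (@lift0_add z') (@lift0_scale z') _)))).
exists u => z x; rewrite [u z x]mklinE; exact: resolution_de.
Defined.

Lemma lift0E z x : lift0 z x = e z (lift0_mul z x).
Proof. by rewrite [LHS]mklinE. Qed.

Fixpoint lift n : lift_state n :=
  if n is m.+1 then lift_next (lift m) else lift0.

(** The comparison of the inverse image of the Godement resolution with [E], compatible with the
    differentials by [kappa_d] and with the augmentations by [kappa_aug]. *)
Definition kappa n : omorphism (pb (gC (gZn M n))) (E n) := lift_C (lift n).

Lemma kappa_d n z x :
  kappa n.+1 z (pb_map (gi (gZn M n.+1) (pi z)) (pb_map (gq (gZn M n) (pi z)) x)) =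
  d n z (kappa n z x).
Proof. exact: lift_C_next. Qed.

Lemma kappa_aug z (b : stalk z) (a : stalk (pi z)) :
  kappa 0 z (pb_map (gi M (pi z)) (pbpure (G := M) b a)) = e z (b * comor pi z a : stalk z).
Proof. by rewrite -pb_morE [LHS]lift_CE lift0E lift0_mulE. Qed.

End Lift.
End Pullback.

(** * Comparison of resolutions *)

Section SectionAction.
Variables (Z : ringedSpace) (R : comPzRingType) (P : pred Z).
Variable al : forall z, P z -> {rmorphism R -> stalk z}.
Hypothesis al_res : forall z z' (h : le z z') (Pz : P z) (Pz' : P z') a,
  res h (al Pz a) = al Pz' a.

Definition sec_act_fun (M : omodule Z) (a : R) (s : sections M P) : sections M P.
Proof.
exists (fun z hz => al hz a *: germ s hz) => z z' h hz hz'.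
by rewrite linearZ_LR /= (germ_res s h hz hz') (al_res h hz hz').
Defined.

Definition sec_act (M : omodule Z) : act R (sections M P).
Proof.
exists (@sec_act_fun M) => [a b s|a s t|a b s|s]; apply: sections_ext => z hz /=.
- by rewrite rmorphD scalerDl.
- by rewrite scalerDr.
- by rewrite scalerA rmorphM.
- by rewrite rmorph1 scale1r.
Defined.

Lemma sec_actE (M : omodule Z) a (s : sections M P) z (hz : P z) :
  germ (sec_act M a s) hz = al hz a *: germ s hz.
Proof. by []. Qed.

End SectionAction.

Section DirectImageComplex.
Variables (Z W : ringedSpace) (pi : ringedMor Z W).
Variables (E : nat -> omodule Z) (d : forall n, omorphism (E n) (E n.+1)).
Hypothesis dd : forall n (p : Z) m, d n.+1 p (d n p m) = 0.

Section Acx.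
Variables (x : W) (P : pred Z) (Px : psub P (fun z => le x (pi z))).

Definition GO_al z (hz : P z) : {rmorphism stalk x -> stalk z} :=
  comor pi z \o res (Px hz).

Lemma GO_al_res z z' (h : le z z') (Pz : P z) (Pz' : P z') a :
  res h (GO_al Pz a) = GO_al Pz' a.
Proof. by rewrite /GO_al /= comor_res (res_comp _ _ (Px Pz')). Qed.

Lemma GO_equiv n : equiv (sec_act GO_al_res (E n)) (sec_act GO_al_res (E n.+1))
  (cd (Gcx dd P) n).
Proof.
move=> a s; apply: sections_ext => z hz.
by rewrite [LHS]sec_mapE !sec_actE sec_mapE linearZ_LR.
Qed.

Definition GO : acx (stalk x) :=
  @Acx _ (Gcx dd P) (fun n => sec_act GO_al_res (E n)) GO_equiv.

Lemma GO_actE n a (s : GO n) z (hz : P z) (h : le x (pi z)) :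
  germ (aca GO n a s : sections _ _) hz = comor pi z (res h a) *: germ (s : sections _ _) hz.
Proof. by rewrite [LHS]sec_actE /GO_al /= (bool_irrelevance (Px hz) h). Qed.

End Acx.

Lemma GO_semilin (x x'' : W) (hx : le x x'') (P P'' : pred Z)
  (Px : psub P (fun z => le x (pi z))) (Px'' : psub P'' (fun z => le x'' (pi z)))
  (hP : psub P'' P) : @semilin _ _ (res hx) (GO Px) (GO Px'') (Gres dd hP).
Proof.
move=> n a s; apply: sections_ext => z hz.
rewrite [LHS](sec_resE _ _ _ (hP z hz)) (GO_actE _ _ _ (Defs.le_trans hx (Px'' z hz))).
rewrite [RHS](GO_actE _ _ _ (Px'' z hz)) (sec_resE _ _ _ (hP z hz)).
by rewrite (res_comp _ _ (Defs.le_trans hx (Px'' z hz))).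
Qed.

(** All proofs are quantified inside, so that the property depends only on points and sets and can
    be rewritten along equalities of sets. *)
Definition base_change (n : nat) (x x'' : W) (P P'' : pred Z) :=
  forall (hx : le x x'') (Px : psub P (fun z => le x (pi z)))
    (Px'' : psub P'' (fun z => le x'' (pi z))) (hP : psub P'' P),
  qis_at (bcm (@GO_semilin x x'' hx P P'' Px Px'' hP)) n.

End DirectImageComplex.

Lemma flabby_pull (Z W : ringedSpace) (pl : pred W -> pred Z)
  (pl_mono : forall V V', psub V' V -> psub (pl V') (pl V)) (F : opcx Z)
  (S : opcx W) (SE : S = @Opcx W (fun V => F (pl V)) (fun V V' h => ores F (pl_mono V V' h))
     (fun V V' V'' h h' h'' n x =>
       @ores_comp Z F _ _ _ (pl_mono _ _ h) (pl_mono _ _ h') (pl_mono _ _ h'') n x)) :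
  (forall V, is_open V -> is_open (pl V)) ->
  (forall V V1 V2, is_open V -> is_open V1 -> is_open V2 ->
    (forall x, V x -> V1 x || V2 x) -> forall z, pl V z -> pl V1 z || pl V2 z) ->
  (forall V1 V2 W', is_open V1 -> is_open V2 -> is_open W' ->
    (forall x, V1 x -> V2 x -> W' x) -> forall z, pl V1 z -> pl V2 z -> pl W' z) ->
  (forall V, is_open V -> (forall x, ~~ V x) -> forall z, ~~ pl V z) ->
  flabby F -> flabby S.
Proof.
move=> plo plc pli ple Ff; rewrite SE; split => /=.
- by move=> V V' h n oV oV'; apply: (flabby_ext Ff); exact: plo.
- move=> V V1 V2 h1 h2 n oV oV1 oV2 cov.
  by apply: (flabby_sep Ff); [exact: plo.. | exact: plc cov].
- move=> V V1 V2 W' h1 h2 w1 w2 n oV oV1 oV2 oW cov covW.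
  by apply: (flabby_glue Ff); [exact: plo.. | exact: plc cov | exact: pli covW].
- by move=> V n oV V0; apply: (flabby_empty Ff); [exact: plo | exact: ple].
Qed.

Section Comparison.
Variables (k : comPzRingType) (W : overSpace k) (Z : ringedSpace) (pi : ringedMor Z W).
Variables (E : nat -> omodule Z) (d : forall n, omorphism (E n) (E n.+1)).
Variables (e : omorphism (structure_sheaf Z) (E 0)) (Eres : injective_resolution e d).
Variables (N : zmodType) (t : act k N) (Q : pred Z).
Variable al : forall z, Q z -> {additive N -> stalk z}.
Hypothesis al_res : forall z z' (h : le z z') (Qz : Q z) (Qz' : Q z') l,
  res h (al Qz l) = al Qz' l.
Hypothesis al_t : forall z (Qz : Q z) r l,
  al Qz (t r l) = comor pi z (kmor (pi z) r) * al Qz l.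
Notation M := (structure_sheaf W).
Notation dd := (resolution_dd Eres).

(** [N] maps to the stalks over [Q], and [N (x)_k K(V)] is compared with sections over the preimage
    of [V] in [Q]; the interior matches [KP]. There are three uses: [N = O_y] over the preimage of
    [U_y], [N = O(U)] over the preimage of [U], and [N = k] over the whole space. *)
Definition cbox (V : pred W) : pred Z := fun z => intr V (pi z) && Q z.

Lemma intr_open (V : pred W) : is_open V -> intr V = V.
Proof.
move=> oV; apply: funext => u; apply/forallP/idP => [/(_ u)/implyP h|Vu w].
  by apply: h; exact: Defs.le_refl.
by apply/implyP => uw; exact: oV Vu.
Qed.

Lemma intr_up (V : pred W) u w : intr V u -> le u w -> intr V w.
Proof.
move=> /forallP Vu uw; apply/forallP => v; apply/implyP => wv.
by apply: (implyP (Vu v)); exact: Defs.le_trans uw wv.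
Qed.

Lemma intr_mono (V V' : pred W) : psub V' V -> psub (intr V') (intr V).
Proof. by move=> h u /forallP V'u; apply/forallP => w; apply/implyP => /(implyP (V'u w)) /h. Qed.

Lemma cbox_mono V V' : psub V' V -> psub (cbox V') (cbox V).
Proof. by move=> /intr_mono h z /andP[/h V1 V2]; apply/andP. Qed.

Lemma cboxQ V z : cbox V z -> Q z. Proof. by case/andP. Qed.
Lemma cbox_intr V z : cbox V z -> intr V (pi z). Proof. by case/andP. Qed.

Definition cS : opcx W := @Opcx W (fun V => Gcx dd (cbox V))
  (fun V V' h => Gres dd (cbox_mono h))
  (fun V V' V'' h h' h'' n x =>
    @ores_comp Z (Gopcx dd) _ _ _ (cbox_mono h) (cbox_mono h') (cbox_mono h'') n x).

Lemma flabby_cS : is_open Q -> flabby cS.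
Proof.
move=> oQ; apply: (@flabby_pull Z W cbox cbox_mono (Gopcx dd)) => //.
- move=> V oV z z' zz' /andP[Vz Qz]; apply/andP; split; last exact: oQ Qz.
  exact: intr_up Vz (mor_le pi zz').
- move=> V V1 V2 oV oV1 oV2 cov z; rewrite /cbox !intr_open // => /andP[/cov].
  by case/orP=> -> ->; rewrite ?orbT.
- move=> V1 V2 W' oV1 oV2 oW h z; rewrite /cbox !intr_open //.
  by case/andP=> z1 -> /andP[z2 _]; rewrite h.
- by move=> V oV V0 z; rewrite /cbox intr_open // (negPf (V0 _)).
- apply: flabby_sections => n; apply: injective_flasque; exact: (resolution_injective Eres).
Qed.

Definition kptr (V : pred W) n (c : Kcx M V n) (w : W) : gC (gZn M n) w :=
  ptr (mstalk (gZn M n)) (KP V) (above w) c.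

Lemma kptr_res (V : pred W) n (c : Kcx M V n) w w' (h : le w w') :
  mres (gC (gZn M n)) h (kptr c w) = kptr c w'.
Proof.
apply: pmod_ext => u wu; rewrite gC_resE // /kptr !ptrE //.
exact: above_trans wu.
Qed.

Definition ksec_fun V n (l : N) (c : Kcx M V n) : sections (E n) (cbox V).
Proof.
exists (fun z hz => kappa pi Eres n z (pbpure (al (cboxQ hz) l) (kptr c (pi z)))).
move=> z z' h hz hz'; rewrite omor_res pb_mresE kptr_res.
by rewrite (al_res h (cboxQ hz) (cboxQ hz')).
Defined.

Lemma kptr_k (V : pred W) n r (c : Kcx M V n) w :
  kptr (aca (Kk V) n r c) w = kmor w r *: kptr c w.
Proof.
apply: pmod_ext => u wu; have hu := above_le wu.
rewrite [RHS](pstalkE _ _ _ hu) /kptr !ptrE // kmor_res.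
have [Vu|Vu] := boolP (KP V u); first by rewrite Kk_actE.
by rewrite (pv0 c Vu) scaler0 [LHS]pv0.
Qed.

Lemma pbpure_scale n z b a (g : gC (gZn M n) (pi z)) :
  pbpure b (a *: g) = comor pi z a *: pbpure b g.
Proof.
rewrite pbpureZ; apply/esym.
exact: (tpureZ (ralg (comor pi z)) (lact (gC (gZn M n) (pi z)))).
Qed.

Lemma ksec_balanced V n : balanced t (aca (Kk V) n) (@ksec_fun V n).
Proof.
split=> [l l' c|l c c'|r l c]; apply: sections_ext => z hz /=.
- by rewrite raddfD [pbpure _ _]tpureDl linearD.
- rewrite -linearD; congr (kappa _ _ _ _ _); rewrite -[RHS]tpureDr; congr pbpure.
  exact: raddfD.
- rewrite kptr_k pbpure_scale pbpureZ -/(pi z).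
  by rewrite al_t.
Qed.

(** The comparison map: [l (x) c] goes to [kappa] of the germs of [c], with [l] as a scalar through
    [al]. *)
Definition kcmp V n : {additive tensor t (aca (Kk V) n) -> sections (E n) (cbox V)} :=
  tliftA (@ksec_balanced V n).

Lemma kcmpE V n l c z (hz : cbox V z) :
  germ (kcmp V n (tpure t (aca (Kk V) n) l c)) hz =
  kappa pi Eres n z (pbpure (al (cboxQ hz) l) (kptr c (pi z))).
Proof. by rewrite /kcmp tliftAE. Qed.

Lemma kptr_d (V : pred W) n (c : Kcx M V n) w : intr V w ->
  kptr (Kd M V n c) w = gi (gZn M n.+1) w (gq (gZn M n) w (kptr c w)).
Proof.
move=> Vw; apply: pmod_ext => u wu; have hu := above_le wu.
have Vu : KP V u by apply/andP; split; [exact: intr_up Vw hu | case/andP: wu].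
rewrite giE // (lmresE hu) gZ_resE gqE /kptr ptrE // KdE //.
rewrite pdelta_comp // pdelta_ptr // => v uv; exact: above_trans hu uv.
Qed.

Lemma kcmp_d V n x : kcmp V n.+1 (cd (NK W t V) n x) = cd (Gcx dd (cbox V)) n (kcmp V n x).
Proof.
tens_elim x l c; rewrite tmapE; apply: sections_ext => z hz.
rewrite kcmpE [RHS]sec_mapE kcmpE -kappa_d !pb_mapE; congr (kappa _ _ _ _ (pbpure _ _)).
by apply: kptr_d; exact: cbox_intr hz.
Qed.

Definition kcmp_map V : cmap (NK W t V) (cS V) := @Cmap (NK W t V) (cS V) (kcmp V) (@kcmp_d V).

Definition kcmp_opmap : opmap (NK W t) cS.
Proof.
exists kcmp_map => V V' h n x; tens_elim x l c; apply: sections_ext => z hz.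
rewrite [RHS](sec_resE _ _ _ (cbox_mono h hz)) [ores (NK W t) _ _ _]tmapE.
rewrite [LHS]kcmpE [RHS]kcmpE (bool_irrelevance (cboxQ (cbox_mono h hz)) (cboxQ hz)).
congr (kappa _ _ _ _ (pbpure _ _)); apply: pmod_ext => u wu.
have Vu : KP V' u.
  apply/andP; split; last by case/andP: wu.
  exact: intr_up (cbox_intr hz) (above_le wu).
by rewrite /kptr ptrE // [RHS]ptrE // KresE.
Defined.

Lemma kcmp_equiv x (V : pred W) (Vx : psub V (le x))
  (Px : psub (cbox V) (fun z => le x (pi z))) n a l c :
  kcmp_opmap V n (tpure t (aca (Kk V) n) l (aca (KO Vx) n a c)) =
  aca (GO dd Px) n a (kcmp_opmap V n (tpure t (aca (Kk V) n) l c)).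
Proof.
apply: sections_ext => z hz; have h := Px z hz.
rewrite [RHS](GO_actE _ _ _ h) [LHS]kcmpE [X in _ *: X]kcmpE -linearZ.
congr (kappa _ _ _ _ _); rewrite -pbpure_scale; congr pbpure.
apply: pmod_ext => u wu; have hu := above_le wu.
have Vu : KP V u.
  apply/andP; split; last by case/andP: wu.
  exact: intr_up (cbox_intr hz) hu.
rewrite [RHS](pstalkE _ _ _ hu) /kptr !ptrE //.
by rewrite (KO_actE _ _ _ Vu (Defs.le_trans h hu)) (res_comp _ _ (Defs.le_trans h hu)).
Qed.

Lemma kcmp_aug p l m z (hz : cbox (le p) z) (h : le p (pi z)) :
  germ (kcmp (le p) 0 (tpure t (aca (Kk (le p)) 0) l (Kaug M p m))) hz =
  e z (al (cboxQ hz) l * comor pi z (res h m)).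
Proof.
rewrite kcmpE -(kappa_aug Eres) pb_mapE; congr (kappa _ _ _ _ (pbpure _ _)).
apply: pmod_ext => u wu; have hu := above_le wu.
rewrite giE // /kptr ptrE // KaugE; last exact: above_trans h wu.
by rewrite (lmresE hu) (lmresE (Defs.le_trans h hu)) /= /sheaf_res (res_comp _ _ (Defs.le_trans h hu)).
Qed.

End Comparison.

Lemma exact_qis_at (C D : cplx) (f : cmap C D) n :
  exact_at C n -> exact_at D n -> qis_at f n.
Proof.
move=> Ce De; split=> [x x0 _|y y0]; first exact: Ce.
by exists 0; rewrite raddf0 ?subr0 //; exact: De.
Qed.

Section StalkComparison.
Variables (k : comPzRingType) (W : overSpace k) (Z : ringedSpace) (pi : ringedMor Z W).
Variables (E : nat -> omodule Z) (d : forall n, omorphism (E n) (E n.+1)).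
Variables (e : omorphism (structure_sheaf Z) (E 0)) (Eres : injective_resolution e d).
Variables (N : zmodType) (t : act k N) (Q : pred Z).
Variable al : forall z, Q z -> {additive N -> stalk z}.
Hypothesis al_res : forall z z' (h : le z z') (Qz : Q z) (Qz' : Q z') l,
  res h (al Qz l) = al Qz' l.
Hypothesis al_t : forall z (Qz : Q z) r l,
  al Qz (t r l) = comor pi z (kmor (pi z) r) * al Qz l.
Notation dd := (resolution_dd Eres).

Lemma stalk_mul_balanced z (Qz : Q z) :
  balanced t (ralg (kmor (pi z))) (fun l m => al Qz l * comor pi z m).
Proof.
split=> [l l' m|l m m'|r l m]; rewrite ?raddfD ?mulrDl ?mulrDr //.
by rewrite al_t /= rmorphM mulrAC mulrC mulrA [al _ _ * _]mulrC.
Qed.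

Definition stalk_mul z (Qz : Q z) : {additive tensor t (ralg (kmor (pi z))) -> stalk z} :=
  tliftA (stalk_mul_balanced Qz).

Lemma kcmp_aug_mul z (Qz : Q z) (hz : cbox pi Q (le (pi z)) z) x :
  germ (kcmp Eres al_res al_t (le (pi z)) 0 (lmap t (@Kaug_equiv _ _ (pi z)) x)) hz =
  e z (stalk_mul Qz x).
Proof.
elim/tensor_ind: x => [|l m|x y hx hy]; first by rewrite !raddf0.
  rewrite tmapE (kcmp_aug Eres al_res al_t _ _ hz (Defs.le_refl (pi z))) res_id.
  by rewrite tliftAE (bool_irrelevance (cboxQ hz) Qz).
by rewrite !raddfD /= hx hy.
Qed.

(** Both sides are exact in positive degrees: the left one is contractible onto [N (x)_k O_(pi z)],
    and the right one resolves [O_z]. On the augmentations the comparison is multiplication, which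
    is bijective by hypothesis. *)
Lemma kcmp_qis_stalk z (Qz : Q z) : cbox pi Q (le (pi z)) = le z ->
  injective (stalk_mul Qz) -> (forall a, exists x, stalk_mul Qz x = a) ->
  qis (kcmp_opmap Eres al_res al_t (le (pi z))).
Proof.
move=> eP mul_inj mul_surj; have hz : cbox pi Q (le (pi z)) z by rewrite eP Defs.le_refl.
have Ge n : exact_at (Gcx dd (cbox pi Q (le (pi z)))) n.+1.
  rewrite eP; apply: sections_stalk_exact; exact: (resolution_exact Eres).
case=> [|n]; last by apply: exact_qis_at; [exact: NK_stalk_exact | exact: Ge].
have [e_mono e_exact] := resolution_aug Eres.
split=> [x /NK_stalk_aug xE [b /= bx]|s s0].
  rewrite zeroaddE in bx; exists 0; rewrite raddf0 -xE; apply/esym.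
  suff -> : lmap t (@Kev_equiv _ _ (pi z)) x = 0 by rewrite raddf0.
  apply: mul_inj; apply: e_mono; rewrite -(kcmp_aug_mul Qz hz) xE.
  by have := congr1 (fun u : sections _ _ => germ u hz) (esym bx); rewrite !raddf0.
have [a ha] : exists a, e z a = germ (s : sections _ _) hz.
  apply/e_exact; rewrite -sec_mapE.
  by have := congr1 (fun u : sections _ _ => germ u hz) s0.
have [x hx] := mul_surj a.
exists (lmap t (@Kaug_equiv _ _ (pi z)) x); first exact: NK_aug_closed.
exists 0; rewrite raddf0; apply/esym/eqP; rewrite subr_eq0; apply/eqP.
apply: sections_ext => u hu.
have zu : le z u by rewrite -eP.
rewrite -[LHS](germ_res (s : sections _ _) zu hz hu) -ha -hx.
by rewrite -(kcmp_aug_mul Qz hz) (germ_res _ zu hz hu).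
Qed.

End StalkComparison.

(** Products are described by their projections, not as [prod_space], so that the two factors can be
    exchanged. *)
Record is_product (k : comPzRingType) (W1 W2 : overSpace k) (Z : ringedSpace)
    (p1 : ringedMor Z W1) (p2 : ringedMor Z W2) : Prop := IsProduct {
  prod_pt : forall w1 w2, exists z, p1 z = w1 /\ p2 z = w2;
  prod_leE : forall z u, le z u = le (p1 z) (p1 u) && le (p2 z) (p2 u);
  prod_k : forall z c, comor p1 z (kmor (p1 z) c) = comor p2 z (kmor (p2 z) c);
  prod_inj : forall z (b : balanced (ralg (kmor (p2 z))) (ralg (kmor (p1 z)))
      (fun l m => comor p2 z l * comor p1 z m)), injective (tliftA b);
  prod_surj : forall z (b : balanced (ralg (kmor (p2 z))) (ralg (kmor (p1 z)))
      (fun l m => comor p2 z l * comor p1 z m)) a, exists x, tliftA b x = a }.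

Lemma is_product_sym (k : comPzRingType) (W1 W2 : overSpace k) (Z : ringedSpace)
    (p1 : ringedMor Z W1) (p2 : ringedMor Z W2) :
  is_product p1 p2 -> is_product p2 p1.
Proof.
case=> hpt hle hk hi hs.
have bal z : balanced (ralg (kmor (p2 z))) (ralg (kmor (p1 z)))
    (fun l m => comor p2 z l * comor p1 z m).
  split=> [l l' m|l m m'|r l m]; rewrite ?rmorphD ?mulrDl ?mulrDr //=.
  by rewrite !rmorphM hk mulrAC mulrC mulrA [comor p2 z l * _]mulrC.
have swapE z (b : balanced (ralg (kmor (p1 z))) (ralg (kmor (p2 z)))
      (fun l m => comor p1 z l * comor p2 z m)) x :
    tliftA b (tswap _ _ x) = tliftA (bal z) x.
  by tens_elim x l m; rewrite tswapE !tliftAE mulrC.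
split=> //.
- by move=> w1 w2; have [z [<- <-]] := hpt w2 w1; exists z.
- by move=> z u; rewrite hle andbC.
- move=> z b; apply: additive_inj => x.
  rewrite -[x]tswapK swapE -{1}[0](raddf0 (tliftA (bal z))) => /hi ->.
  exact: raddf0.
- move=> z b a; have [x hx] := hs z (bal z) a.
  by exists (tswap _ _ x); rewrite swapE.
Qed.

(** * Base change for sections over boxes in a product *)

Section Product.
Variables (k : comPzRingType) (W1 W2 : overSpace k) (Z : ringedSpace).
Variables (p1 : ringedMor Z W1) (p2 : ringedMor Z W2) (Zp : is_product p1 p2).
Variables (E : nat -> omodule Z) (d : forall n, omorphism (E n) (E n.+1)).
Variables (e : omorphism (structure_sheaf Z) (E 0)) (Eres : injective_resolution e d).
Notation dd := (resolution_dd Eres).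

Definition box (U : pred W1) (V : pred W2) : pred Z := fun z => U (p1 z) && V (p2 z).

Section Slice.
Variable y : W2.
Notation Q := (fun z : Z => le y (p2 z)).

Definition slice_al z (h : Q z) : {additive stalk y -> stalk z} :=
  (comor p2 z \o res h : {rmorphism stalk y -> stalk z}).

Lemma slice_al_res z z' (h : le z z') (Qz : Q z) (Qz' : Q z') l :
  res h (slice_al Qz l) = slice_al Qz' l.
Proof. by rewrite /slice_al /= comor_res (res_comp _ _ Qz'). Qed.

Lemma slice_al_k z (Qz : Q z) r l :
  slice_al Qz (ralg (kmor y) r l) = comor p1 z (kmor (p1 z) r) * slice_al Qz l.
Proof. by rewrite /slice_al /= !rmorphM kmor_res (prod_k Zp). Qed.

Definition slice_kcmp := kcmp_opmap Eres slice_al_res slice_al_k.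

Lemma slice_box U : is_open U -> cbox p1 Q U = box U (le y).
Proof. by move=> oU; apply: funext => z; rewrite /cbox intr_open. Qed.

Lemma slice_open : is_open Q.
Proof. by move=> z z' h yz; exact: Defs.le_trans yz (mor_le p2 h). Qed.

End Slice.

Lemma prod_balanced z : balanced (ralg (kmor (p2 z))) (ralg (kmor (p1 z)))
    (fun l m => comor p2 z l * comor p1 z m).
Proof.
split=> [l l' m|l m m'|r l m]; rewrite ?rmorphD ?mulrDl ?mulrDr //=.
by rewrite !rmorphM (prod_k Zp) mulrAC mulrC mulrA [comor p2 z l * _]mulrC.
Qed.

Lemma slice_mulE z (Qz : le (p2 z) (p2 z)) x :
  stalk_mul (@slice_al_k (p2 z)) Qz x = tliftA (prod_balanced z) x.
Proof. by tens_elim x l m; rewrite !tliftAE /slice_al /= res_id. Qed.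

(** For [z] over [p] and [y], the box on [U_p] and [U_y] is [U_z], and [O_z] is the tensor product
    of the two stalks. *)
Lemma slice_stalk y p : qis (slice_kcmp y (le p)).
Proof.
have [z [<- <-]] := prod_pt Zp p y.
have Qz : le (p2 z) (p2 z) by exact: Defs.le_refl.
apply: (@kcmp_qis_stalk _ _ _ _ _ _ _ Eres _ _ _ _ (@slice_al_res _) (@slice_al_k _) z Qz).
- rewrite slice_box; last exact: is_open_le.
  by apply: funext => u; rewrite (prod_leE Zp).
- move=> x x'; rewrite !slice_mulE; exact: (prod_inj Zp).
- move=> a; have [x <-] := prod_surj Zp (prod_balanced z) a.
  by exists x; rewrite slice_mulE.
Qed.

Lemma box_psub1 x U V : psub U (le x) -> psub (box U V) (fun z => le x (p1 z)).
Proof. by move=> h z /andP[/h]. Qed.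

Lemma box_mono U U' V V' : psub U' U -> psub V' V -> psub (box U' V') (box U V).
Proof. by move=> h h' z /andP[/h a /h' b]; apply/andP. Qed.

Section BoxBaseChange.
Variables (x x'' : W1) (hx : le x x'') (U U'' : pred W1).
Hypotheses (oU : is_open U) (oU'' : is_open U'').
Variables (Ux : psub U (le x)) (Ux'' : psub U'' (le x'')) (hU : psub U'' U).
Hypothesis W1f : finite_space W1.
Hypothesis KU : qis (bcm (@KO_semilin _ _ _ _ hx _ _ Ux Ux'' hU)).

Lemma slice_base_change y n :
  base_change p1 dd n x x'' (box U (le y)) (box U'' (le y)).
Proof.
rewrite -!slice_box // => hx' Px Px'' hP.
rewrite (bool_irrelevance hx' hx) (Prop_irrelevance hP (cbox_mono hU)).
pose ss := @GO_semilin _ _ _ _ _ dd _ _ hx _ _ Px Px'' (cbox_mono hU).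
have h := (@slice_bc k W1 _ (ralg (kmor y)) _ (slice_kcmp y)
  (flabby_cS p1 Eres (@slice_open y)) (slice_stalk y) x x'' hx U U'' Ux Ux'' hU oU oU'' W1f
  (aca (GO dd Px)) (aca (GO dd Px'')) (acE (GO dd Px)) (acE (GO dd Px'')) ss
  (@kcmp_equiv k W1 Z p1 _ _ _ Eres _ _ _ _ (@slice_al_res y) (@slice_al_k y) x U Ux Px)
  (@kcmp_equiv k W1 Z p1 _ _ _ Eres _ _ _ _ (@slice_al_res y) (@slice_al_k y) x'' U'' Ux'' Px'') KU n).

apply h.
Qed.

Lemma flabby_box V0 rc : is_open V0 -> flabby (@Opcx W2 (fun V => Gcx dd (box V0 V))
  (fun V V' h => Gres dd (box_mono (fun _ => id) h)) rc).
Proof.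
have {rc}-> : rc = (fun V V' V'' h h' h'' n x => @ores_comp Z (Gopcx dd) _ _ _
     (box_mono (fun _ => id) h) (box_mono (fun _ => id) h') (box_mono (fun _ => id) h'') n x).
  exact: Prop_irrelevance.
move=> oV0; apply: (@flabby_pull Z W2 (box V0) (fun V V' => @box_mono V0 V0 V V' (fun _ => id)) (Gopcx dd)) => //.
- move=> V oV z z' zz' /andP[z1 z2]; apply/andP; split.
    exact: oV0 (mor_le p1 zz') z1.
  exact: oV (mor_le p2 zz') z2.
- by move=> V V1 V2 oV oV1 oV2 cov z /andP[z1 /cov]; rewrite /box z1.
- by move=> V1 V2 W' oV1 oV2 oW h z /andP[z1 z2] /andP[_ z2']; rewrite /box z1 h.
- by move=> V oV V' z; rewrite /box (negPf (V' _)) andbF.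
- apply: flabby_sections => n; apply: injective_flasque; exact: (resolution_injective Eres).
Qed.

(** For fixed [U] and [U''], both sides of the base change map are flabby complexes in the second
    factor, the source because the restriction from [x] to [x''] is flat; the slices [V = U_y] then
    decide. *)
Lemma box_base_change V0 n : is_open V0 ->
  base_change p1 dd n x x'' (box U V0) (box U'' V0).
Proof.
move=> oV hx' Px Px'' hP; rewrite (bool_irrelevance hx' hx).
pose PxV V' := @box_psub1 x U V' Ux; pose PxV'' V' := @box_psub1 x'' U'' V' Ux''.
pose F V' := GO dd (PxV V'); pose F'' V' := GO dd (PxV'' V').
pose r (V V' : pred W2) (h : psub V' V) : cmap (F V) (F V') :=
  Gres dd (box_mono (fun _ => id) h).
pose r'' (V V' : pred W2) (h : psub V' V) : cmap (F'' V) (F'' V') :=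
  Gres dd (box_mono (fun _ => id) h).
have rE V V' (h : psub V' V) m : equiv (aca (F V) m) (aca (F V') m) (r V V' h m).
  move=> a s; apply: sections_ext => z hz.
  have hz' := box_mono (fun _ => id) h hz.
  rewrite (sec_resE _ _ _ hz') !(GO_actE _ _ _ (PxV V z hz')).
  by rewrite (sec_resE _ _ _ hz').
have rc V V' V'' (h : psub V' V) (h' : psub V'' V') (h'' : psub V'' V) m s :
    r V' V'' h' m (r V V' h m s) = r V V'' h'' m s.
  exact: (@ores_comp Z (Gopcx dd)).
have rc'' V V' V'' (h : psub V' V) (h' : psub V'' V') (h'' : psub V'' V) m s :
    r'' V' V'' h' m (r'' V V' h m s) = r'' V V'' h'' m s.
  exact: (@ores_comp Z (Gopcx dd)).
pose T := @tens_opcx W2 _ _ (ralg (res hx)) F r rc rE.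
pose G := @base_opcx W2 _ F'' r'' rc''.
have hPV V : psub (box U'' V) (box U V) by apply: box_mono.
pose bc V := bcm (@GO_semilin _ _ _ _ _ dd _ _ hx _ _ (PxV V) (PxV'' V) (hPV V)).
have bc_res V V' (h : psub V' V) m s : bc V' m (ores T h m s) = ores G h m (bc V m s).
  tens_elim s b c; rewrite [ores T h m _]tmapE [LHS]bcmapE [X in ores G h m X]bcmapE.
  apply: sections_ext => z hz.
  have hz' : box U'' V z := box_mono (fun _ => id) h hz.
  have hz1 : box U V' z := hPV V' z hz; have hz2 : box U V z := hPV V z hz'.
  rewrite [RHS](sec_resE _ _ _ hz') !(GO_actE _ _ _ (PxV'' V z hz')).
  by rewrite !(sec_resE _ _ _ hz1) !(sec_resE _ _ _ hz2).
pose bcV : opmap T G := @Opmap W2 T G bc bc_res.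
have fl : mflat (ralg (res hx)) by exact/flat_mflat/W1f.
have q : qis (bcV V0).
  apply: (flabby_qis (f := bcV)) => // [||y].
  - apply: flabby_tens => //; exact: flabby_box.
  - exact: flabby_box.
  - move=> m; exact: slice_base_change.
have := q n; rewrite /bcV /= /bc.
by rewrite (Prop_irrelevance (PxV V0) Px) (Prop_irrelevance (PxV'' V0) Px'')
  (Prop_irrelevance (hPV V0) hP).
Qed.

End BoxBaseChange.
End Product.

Lemma exact_at_qis (C D : cplx) (f : cmap C D) n :
  qis_at f n -> exact_at C n -> exact_at D n.
Proof.
move=> [_ fs] Ce y y0; have [x x0 h] := fs y y0.
by rewrite -[y](subrK (f n x)); apply: bdry_add => //; exact/cmap_bdry/Ce.
Qed.

(** * Acyclicity of boxes with acyclic factors *)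

Section ClosedSections.
Variables (X : ringedSpace) (M : omodule X) (U : pred X).
Hypothesis oU : is_open U.
Variables (c : Kcx M U 0) (c0 : cd (Kcx M U) 0 c = 0).

Lemma closed_rep w w' : U w -> le w w' -> c (rep w') = lmres M (rep w) (rep w') (c (rep w)).
Proof.
move=> Uw ww'.
have Ur : U (rep w) := oU (le_rep w) Uw.
have Kr : KP U (rep w) by apply: KP_open => //; exact: is_rep_rep.
have rr : le (rep w) (rep w').
  exact: Defs.le_trans (rep_le w) (Defs.le_trans ww' (le_rep w')).
have rK : rep (rep w) = rep w by apply/eqP/is_rep_rep.
have aw : above (rep w) (rep w') by rewrite /above rr is_rep_rep.
have [sw|sw] := boolP (sabove (rep w) (rep w')); last first.
  by rewrite (above_sabove_rep aw) ?rK ?lmres_id.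
have := congr1 (fun z : pmod (KP U) (mstalk (gZ M)) =>
  (z (rep w) : pmod (sabove (rep w)) (mstalk M)) (rep w')) (c0 : Kd M U 0 c = 0).
rewrite KdE // (pdeltaE _ sw) !pmod0E rK => /eqP.
by rewrite subr_eq0 => /eqP.
Qed.

(** A 0-cycle of the Godement complex is a section of [M] over [U]; this is its germ at [w]. *)
Definition closed_ev w : M w := lmres M (rep w) w (c (rep w)).

Lemma closed_ev_res w w' (h : le w w') : U w -> mres M h (closed_ev w) = closed_ev w'.
Proof.
move=> Uw; rewrite /closed_ev (closed_rep Uw h) -(lmresE h) !lmres_comp ?rep_le //.
  by exact: Defs.le_trans (rep_le w) (Defs.le_trans h (le_rep w')).
Qed.

Lemma closed_kptr w u : U w -> above w u -> c u = lmres M w u (closed_ev w).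
Proof.
move=> Uw /andP[wu /eqP ru]; rewrite /closed_ev lmres_comp ?rep_le //.
by have := closed_rep Uw wu; rewrite ru.
Qed.

End ClosedSections.

Section BoxExact.
Variables (k : comPzRingType) (W1 W2 : overSpace k) (Z : ringedSpace).
Variables (p1 : ringedMor Z W1) (p2 : ringedMor Z W2) (Zp : is_product p1 p2).
Variables (E : nat -> omodule Z) (d : forall n, omorphism (E n) (E n.+1)).
Variables (e : omorphism (structure_sheaf Z) (E 0)) (Eres : injective_resolution e d).
Notation dd := (resolution_dd Eres).
Notation M := (structure_sheaf W1).
Variables (x : W1) (U : pred W1) (oU : is_open U) (Ux : psub U (le x)).
Hypothesis W1f : finite_space W1.
Hypothesis Uexact : forall n, exact_at (Kcx M U) n.+1.

Notation T := (KO Ux).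
Notation Tf := (fun n => @KO_flat _ _ x U Ux n W1f).
Notation Tb := (fun n (hn : (#|W1|.+1 <= n)%N) => @Kcx_bound W1 M U n hn).

Lemma Texact n : (0 < n)%N -> exact_at T n.
Proof. by case: n. Qed.

Section OneSlice.
Variable y : W2.
Notation t := (ralg (kmor y)).

Definition slice_map : cmap (ntens (kmor x) t T) (cS p1 Eres (fun z => le y (p2 z)) U) :=
  cmap_comp (slice_kcmp Zp Eres y U) (NKO_cmap t Ux).

Lemma slice_mapE n l c :
  slice_map n (tpure t (restr (kmor x) (aca T n)) l c) =
  kcmp Eres (@slice_al_res _ _ _ p2 y) (slice_al_k Zp (y := y)) U n (tpure t (aca (Kk U) n) l c).
Proof. by rewrite [LHS]/= tmapE. Qed.

Lemma slice_map_qis : qis slice_map.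
Proof.
move=> n; apply: qis_at_comp; first exact: NKO_qis.
apply: (flabby_qis (f := slice_kcmp Zp Eres y)) => //.
- exact: flabby_NK.
- exact: (flabby_cS p1 Eres (@slice_open _ _ _ p2 y)).
- by move=> p m; exact: slice_stalk.
Qed.

(** [K(U)] is bounded and flat over [O_x], so its acyclicity in positive degrees survives tensoring
    with [O_y] over [k]. *)
Lemma slice_exact n : exact_at (Gcx dd (box p1 p2 U (le y))) n.+1.
Proof.
rewrite -slice_box //; apply: (exact_at_qis (slice_map_qis n.+1)).
exact: (@ltcr_exact _ T 0 #|W1|.+1 Tf Tb Texact _ (kmor x) _ t n.+1).
Qed.

End OneSlice.

Notation Zc := (kerg (cd T 0)).
Notation Zact := (subact (kerg_act (acE T 0))).

(** [O(U)] as a [k]-module, in the guise of 0-cycles; it plays the role of [N] for the projection to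
    [W2]. *)
Definition cyc_act : act k (subg Zc) := restr (kmor x) Zact.

Definition cyc_fun z (c : subg Zc) : stalk z :=
  comor p1 z (closed_ev (sgval Zc c : Kcx M U 0) (p1 z)).

Lemma cyc_funD z : {morph @cyc_fun z : c c' / c + c'}.
Proof.
move=> c c'; rewrite /cyc_fun /closed_ev raddfD.
by rewrite [X in lmres _ _ _ X]paddE raddfD rmorphD.
Qed.

Definition cyc_al z (_ : U (p1 z)) : {additive subg Zc -> stalk z} := mkadd (@cyc_funD z).

Lemma cyc_al_res z z' (h : le z z') (Qz : U (p1 z)) (Qz' : U (p1 z')) c :
  res h (cyc_al Qz c) = cyc_al Qz' c.
Proof.
rewrite !mkaddE /cyc_fun comor_res; congr (comor p1 z' _).
exact: (closed_ev_res oU (sgvalP c) (mor_le p1 h) Qz).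
Qed.

Lemma cyc_al_k z (Qz : U (p1 z)) r c :
  cyc_al Qz (cyc_act r c) = comor p2 z (kmor (p2 z) r) * cyc_al Qz c.
Proof.
rewrite !mkaddE /cyc_fun -(prod_k Zp) -rmorphM; congr (comor p1 z _).
have Ur : U (rep (p1 z)) := oU (le_rep _) Qz.
have Kr : KP U (rep (p1 z)) by apply: KP_open => //; exact: is_rep_rep.
rewrite /closed_ev [X in lmres _ _ _ X](KO_actE Ux _ _ Kr (Ux Ur)).
by rewrite (lmresZ (rep_le _)) !kmor_res.
Qed.

Notation cyc_kcmp := (kcmp_opmap Eres cyc_al_res cyc_al_k).

Lemma cyc_open : is_open (fun z : Z => U (p1 z)).
Proof. by move=> z z' h; exact: oU (mor_le p1 h). Qed.

Lemma cyc_box V : is_open V -> cbox p2 (fun z : Z => U (p1 z)) V = box p1 p2 U V.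
Proof. by move=> oV; apply: funext => z; rewrite /cbox intr_open // andbC. Qed.

Section CycleSlice.
Variable y : W2.
Notation t := (ralg (kmor y)).
Notation Zincl := (lmap t (equiv_restr (kmor x) (sgval_equiv (kerg_act (acE T 0))))).

(** In degree 0 the comparisons along [p1] and along [p2] agree on [O(U) (x)_k O_y]: both are
    multiplication of functions followed by the augmentation [e]. *)
Lemma cyc_slice_germ w z (hz : cbox p2 (fun z => U (p1 z)) (le y) z)
    (hz' : cbox p1 (fun z => le y (p2 z)) U z) :
  germ (cyc_kcmp (le y) 0 (lmap cyc_act (@Kaug_equiv _ _ y) w) : sections _ _) hz =
  germ (slice_map y 0 (Zincl (tswap _ _ w)) : sections _ _) hz'.
Proof.
elim/tensor_ind: w => [|c l|w w' hw hw']; first by rewrite !raddf0.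
  have yz : le y (p2 z) by case/andP: hz'.
  have Uz : U (p1 z) by case/andP: hz.
  rewrite tmapE [LHS](kcmp_aug Eres cyc_al_res cyc_al_k _ _ hz yz).
  rewrite tswapE tmapE slice_mapE [RHS]kcmpE.
  have -> : kptr (sgval Zc c : Kcx M U 0) (p1 z) =
      gi M (p1 z) (closed_ev (sgval Zc c : Kcx M U 0) (p1 z)).
    apply: pmod_ext => u pu; rewrite giE // /kptr ptrE //.
    exact: (closed_kptr oU (sgvalP c)).
  rewrite -(pb_mapE (gi M (p1 z))) [RHS](kappa_aug Eres); congr (e z _).
  by rewrite mkaddE mulrC /slice_al /= (bool_irrelevance (cboxQ hz') yz).
by rewrite !raddfD /= hw hw'.
Qed.

Lemma slice_incl_closed w : cd (ltcr T (kmor x) t) 0 (Zincl w) = 0.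
Proof.
elim/tensor_ind: w => [|l c|w w' hw hw']; first by rewrite !raddf0.
  by rewrite !tmapE [cd T 0 _](sgvalP c) (balanced0r (balanced_tpure _ _)).
by rewrite !raddfD hw hw' addr0.
Qed.

(** In positive degrees both sides are exact. In degree 0, flatness of the cycles identifies
    [O(U) (x)_k O_y] with the 0-cycles of [K(U) (x)_k O_y], which are those of [E] over the box by
    [slice_map_qis]. *)
Lemma cyc_stalk : qis (cyc_kcmp (le y)).
Proof.
have oy := @is_open_le W2 y.
have sub : psub (cbox p2 (fun z => U (p1 z)) (le y)) (cbox p1 (fun z => le y (p2 z)) U).
  by move=> z; rewrite cyc_box // slice_box.
have sub' : psub (cbox p1 (fun z => le y (p2 z)) U) (cbox p2 (fun z => U (p1 z)) (le y)).
  by move=> z; rewrite cyc_box // slice_box.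
case=> [|n]; last first.
  apply: exact_qis_at; first exact: NK_stalk_exact.
  rewrite -[exact_at _ _]/(exact_at (Gcx dd (cbox p2 (fun z => U (p1 z)) (le y))) n.+1).
  by rewrite cyc_box //; exact: slice_exact.
have [si ss] := slice_map_qis y 0.
split=> [w /NK_stalk_aug wE /bdry_zero bw|s s0].
  rewrite -wE; set v := lmap _ _ w in wE *; suff -> : v = 0 by rewrite raddf0; exact: bdry0.
  rewrite -[v]tswapK; suff -> : tswap _ _ v = 0 by rewrite raddf0.
  apply: (@cycles_inj _ T 0 #|W1|.+1 Tf Tb Texact _ (kmor x) _ t 0) => //.
  apply: (@bdry_zero (ltcr T (kmor x) t)); apply: si; first exact: slice_incl_closed.
  have -> : slice_map y 0 (Zincl (tswap _ _ v)) = 0; last exact: bdry0.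
  apply: sections_ext => z hz.
  by rewrite -(cyc_slice_germ v (sub' z hz) hz) wE bw.
have [|w0 w00 /bdry_zero wE] := ss (sec_res (E 0) sub' s).
  have := congr1 (sec_res (E 1) sub') (s0 : sec_map (d 0) _ s = 0).
  move=> h; apply: etrans (etrans h (raddf0 _)).
  by apply: sections_ext => z hz; rewrite sec_mapE !(sec_resE _ _ _ (sub' z hz)) sec_mapE.
have {}wE : sec_res (E 0) sub' s = slice_map y 0 w0 by apply/eqP; rewrite -subr_eq0 wE.
have [|w hw] := @cycles_surj _ T 0 #|W1|.+1 Tf Tb Texact _ (kmor x) _ t 0 _ w0 w00 => //.
exists (lmap cyc_act (@Kaug_equiv _ _ y) (tswap _ _ w)); first exact: (@NK_aug_closed _ W2 _ cyc_act y).
apply: eq_bdry; apply: sections_ext => z hz.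
by rewrite (cyc_slice_germ _ hz (sub z hz)) tswapK hw -wE (sec_resE _ _ _ hz).
Qed.

End CycleSlice.

(** Sections of [E] over the box are computed by [O(U) (x)_k K(V)], and [K(V)], bounded, flat over
    [O_y] and exact in positive degrees, stays exact there after tensoring. *)
Lemma box_exact y V n : is_open V -> psub V (le y) -> finite_space W2 ->
  (forall n, exact_at (Kcx (structure_sheaf W2) V) n.+1) ->
  exact_at (Gcx dd (box p1 p2 U V)) n.+1.
Proof.
move=> oV Vy W2f Vexact; rewrite -cyc_box //.
have q : qis (cyc_kcmp V).
  apply: flabby_qis => //.
  - exact: flabby_NK.
  - exact: (flabby_cS p2 Eres cyc_open).
  - exact: cyc_stalk.
apply: (exact_at_qis (q n.+1)); apply: (exact_at_qis (NKO_qis cyc_act Vy n.+1)).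
apply: (@ltcr_exact _ (KO Vy) 0 #|W2|.+1 _ _ _ _ (kmor y) _ cyc_act n.+1) => //.
- by move=> m; exact: KO_flat.
- by move=> m hm; exact: Kcx_bound.
- by case.
Qed.
End BoxExact.

(** * Quasi-coherence and base change *)

Lemma ltc_bdry_lift (A : comPzRingType) (L : zmodType) (sL : act A L) (C : acx A) n
  (pE : equiv (preva C n) (aca C n) (prevd C n)) x :
  @bdry (ltc sL (acE C)) n x -> exists w, lmap sL pE w = x.
Proof.
case: n pE x => [|n] pE x [a <-]; first by exists 0; rewrite raddf0 /= zeroaddE.
by exists a => /=; tens_elim a l c; rewrite !tmapE.
Qed.

Section CohomologyBaseChange.
Variables (A B : comPzRingType) (f : {rmorphism A -> B}).
Variables (P : acx A) (Q : acx B) (h : cmap P Q) (hE : semilin f h) (n : nat).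
Notation ZP := (kerg (cd P n)).
Notation ZQ := (kerg (cd Q n)).
Notation sZP := (subact (kerg_act (acE P n))).
Notation sZQ := (subact (kerg_act (acE Q n))).
Variables (HP HQ : zmodType) (sP : act A HP) (sQ : act B HQ).
Variables (qP : {additive subg ZP -> HP}) (qPE : equiv sZP sP qP).
Variables (qQ : {additive subg ZQ -> HQ}) (qQE : equiv sZQ sQ qQ).
Hypothesis qP_surj : forall y, exists z, qP z = y.
Hypothesis qQ_surj : forall y, exists z, qQ z = y.
Hypothesis qP0 : forall z, qP z = 0 <-> bdry (sgval ZP z).
Hypothesis qQ0 : forall z, qQ z = 0 <-> bdry (sgval ZQ z).
Variables (eta : {additive HP -> HQ}) (etaE : equiv sP (restr f sQ) eta).
Hypothesis eta_q : forall z w, sgval ZQ w = h n (sgval ZP z) -> eta (qP z) = qQ w.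
Hypothesis f_flat : mflat (ralg f).

Lemma cmap_cycle (z : subg ZP) : ZQ (h n (sgval ZP z)).
Proof. by rewrite /= -cmd [cd P n _](sgvalP z) raddf0. Qed.

Definition hZ : {additive subg ZP -> subg ZQ} :=
  @sgcod _ ZQ _ (h n \o sgval ZP : {additive _ -> _}) cmap_cycle.

Lemma hZE z : sgval ZQ (hZ z) = h n (sgval ZP z). Proof. exact: sgcodE. Qed.

Lemma hZ_equiv : equiv sZP (restr f sZQ) hZ.
Proof.
move=> a z; apply: sgval_inj; rewrite hZE.
by rewrite -[RHS]/(aca Q n (f a) (sgval ZQ (hZ z))) hZE -[RHS]hE.
Qed.

Notation Zincl := (lmap (ralg f) (sgval_equiv (kerg_act (acE P n)))).

Lemma hZ_incl w : sgval ZQ (bcmap hZ_equiv w) = bcm hE n (Zincl w).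
Proof.
elim/tensor_ind: w => [|b z|w w' hw hw']; first by rewrite !raddf0.
  by rewrite tmapE !bcmapE -[LHS]/(aca Q n b (sgval ZQ (hZ z))) hZE.
by rewrite !raddfD hw hw'.
Qed.

Lemma qQ_hZ w : qQ (bcmap hZ_equiv w) = bcmap etaE (lmap (ralg f) qPE w).
Proof.
elim/tensor_ind: w => [|b z|w w' hw hw']; first by rewrite !raddf0.
  by rewrite tmapE !bcmapE qQE (eta_q (hZE z)).
by rewrite !raddfD hw hw'.
Qed.

Definition prevZ : {additive prevt P n -> subg ZP} := @sgcod _ ZP _ (prevd P n) (@cd_prevd P n).

Lemma prevZ_equiv : equiv (preva P n) sZP prevZ.
Proof. exact/sgcod_equiv/prevd_equiv. Qed.

Lemma qP_exact z : qP z = 0 -> exists y, prevZ y = z.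
Proof. by move=> /qP0[y hy]; exists y; apply: sgval_inj; rewrite sgcodE. Qed.

Lemma Zincl_inj : injective Zincl.
Proof. by apply: additive_inj => w; apply: f_flat; exact: sgval_inj. Qed.

Lemma Zincl_surj x : cd (bcx f P) n x = 0 -> exists w, Zincl w = x.
Proof.
apply: flat_exact => // y y0.
by exists (@sgmk _ ZP y y0).
Qed.

Lemma Zincl_closed w : cd (bcx f P) n (Zincl w) = 0.
Proof.
elim/tensor_ind: w => [|b z|w w' hw hw']; first by rewrite !raddf0.
  by rewrite !tmapE [cd P n _](sgvalP z) (balanced0r (balanced_tpure _ _)).
by rewrite !raddfD hw hw' addr0.
Qed.

Lemma Zincl_prevZ v : @bdry (bcx f P) n (Zincl (lmap (ralg f) prevZ_equiv v)).
Proof.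
have -> : Zincl (lmap (ralg f) prevZ_equiv v) = lmap (ralg f) (@prevd_equiv _ P n) v.
  by tens_elim v b y; rewrite !tmapE sgcodE.
exact: ltc_bdry.
Qed.

Lemma bdry_prevZ w : @bdry (bcx f P) n (Zincl w) -> lmap (ralg f) qPE w = 0.
Proof.
move=> /(ltc_bdry_lift (@prevd_equiv _ P n))[v hv].
have -> : w = lmap (ralg f) prevZ_equiv v.
  apply: Zincl_inj; rewrite -hv; clear hv.
  by tens_elim v b y; rewrite !tmapE sgcodE.
clear hv; tens_elim v b y; rewrite !tmapE (_ : qP (prevZ y) = 0).
  exact: (balanced0r (balanced_tpure _ _)).
by apply/qP0; rewrite sgcodE; exists y.
Qed.

(** As [f] is flat, the cycles and boundaries of [B (x)_A P] are those of [P] tensored with [B], so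
    that cohomology commutes with base change. [HP] and [HQ] are known only through [qP] and [qQ],
    whose kernels are the boundaries. *)
Lemma base_change_cohomology :
  qis_at (bcm hE) n <-> injective (bcmap etaE) /\ (forall y, exists x, bcmap etaE x = y).
Proof.
split=> [[hi hs]|[bi bs]].
- split=> [|y].
    apply: additive_inj => x; have [w <-] := lmap_surj (sL := ralg f) qPE qP_surj x.
    rewrite -qQ_hZ => /qQ0; rewrite hZ_incl => /(hi _ (Zincl_closed w)).
    exact: bdry_prevZ.
  have [z <-] := qQ_surj y.
  have [x /Zincl_surj[w <-] hb] := hs _ (sgvalP z).
  exists (lmap (ralg f) qPE w); rewrite -qQ_hZ; apply/eqP; rewrite eq_sym -subr_eq0.
  by rewrite -raddfB; apply/eqP/qQ0; rewrite raddfB hZ_incl.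
- split=> [x /Zincl_surj[w <-] hb|y y0].
    have : lmap (ralg f) qPE w = 0.
      by apply: bi; rewrite raddf0 -qQ_hZ; apply/qQ0; rewrite hZ_incl.
    have qe := @lmap_exact _ _ _ _ _ (ralg f) _ _ _ _ _ prevZ_equiv qPE qP_surj qP_exact w.
    by move=> /qe[v <-]; exact: Zincl_prevZ.
  pose z := @sgmk _ ZQ y y0.
  have [x] := bs (qQ z); have [w <-] := lmap_surj (sL := ralg f) qPE qP_surj x.
  rewrite -qQ_hZ => /eqP; rewrite eq_sym -subr_eq0 -raddfB => /eqP/qQ0.
  rewrite raddfB hZ_incl => hb; exists (Zincl w) => //; exact: Zincl_closed.
Qed.

End CohomologyBaseChange.

Section FreeBaseChange.
Variables (A B : comPzRingType) (f : {rmorphism A -> B}) (I : choiceType).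
Variables (phi : {additive freeMod I A -> freeMod I B}).
Hypothesis phiE : forall g i, phi g i = f (g i).
Hypothesis phi_equiv : equiv (lact (freeMod I A)) (restr f (lact (freeMod I B))) phi.

Lemma fm_deltaZ (R : comPzRingType) (i : I) (a : R) : fm_delta i a = a *: fm_delta i 1.
Proof.
apply: val_inj; apply: funext => j.
rewrite -[RHS]/((a *: fm_delta i 1) j) fm_scaleE /=.
by case: eqP; rewrite ?mulr1 ?mulr0.
Qed.

Lemma phi_delta i a : phi (fm_delta i a) = fm_delta i (f a).
Proof.
apply: val_inj; apply: funext => j; rewrite -[LHS]/(fval (phi (fm_delta i a)) j) phiE /=.
by case: eqP; rewrite ?rmorph0.
Qed.

Lemma free_decomp x : exists r0 : seq I, forall r, uniq r -> {subset r0 <= r} ->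
  x = \sum_(i <- r) tpure (ralg f) (lact (freeMod I A)) (bcmap phi_equiv x i) (fm_delta i 1).
Proof.
elim/tensor_ind: x => [|b g|y z [ry hy] [rz hz]].
- by exists [::] => r _ _; rewrite big1 // => i _; rewrite raddf0 (balanced0l (balanced_tpure _ _)).
- have [r0 hr0] := covers_exists g; exists r0 => r ur r0r.
  have gr := covers_sub hr0 ur r0r.
  rewrite {1}(fm_decomp gr); elim/big_rec2: _ => [|i z y _ <-].
    by rewrite (balanced0r (balanced_tpure _ _)).
  rewrite tpureDr; congr (_ + _); rewrite bcmapE fm_scaleE phiE fm_deltaZ.
  by rewrite mulrC; exact/esym/tpureZ.
- exists (ry ++ rz) => r ur sr; rewrite {1}(hy r) //; last first.
    by move=> i ii; apply: sr; rewrite mem_cat ii.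
  rewrite {1}(hz r) //; last by move=> i ii; apply: sr; rewrite mem_cat ii orbT.
  by rewrite -big_split; apply: eq_bigr => i _ /=; rewrite raddfD tpureDl.
Qed.

Lemma free_bc_inj : injective (bcmap phi_equiv).
Proof.
apply: additive_inj => x x0; have [r hr] := free_decomp x.
rewrite (hr (undup r)) ?undup_uniq //; last by move=> i; rewrite mem_undup.
by rewrite big1 // => i _; rewrite x0 (balanced0l (balanced_tpure _ _)).
Qed.

Lemma free_bc_surj y : exists x, bcmap phi_equiv x = y.
Proof.
have [r hr] := covers_exists y.
exists (\sum_(i <- r) tpure (ralg f) (lact (freeMod I A)) (y i) (fm_delta i 1)).
rewrite raddf_sum {2}(fm_decomp hr); apply: eq_bigr => i _.
by rewrite bcmapE phi_delta rmorph1 [RHS]fm_deltaZ.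
Qed.

End FreeBaseChange.

Section FreeMap.
Variables (S : ringedSpace) (I : choiceType) (M : omodule S) (m : forall q : S, I -> M q).
Hypothesis m_res : forall q q' (h : le q q') i, mres M h (m q i) = m q' i.

Definition free_fun q (g : free_omodule S I q) : M q := fm_sum (lact (M q)) (m q) g.

Lemma free_funE q (g : free_omodule S I q) r : covers g r ->
  free_fun g = \sum_(i <- r) (g i : stalk q) *: m q i.
Proof. exact: fm_sumE. Qed.

Lemma free_funD q : {morph @free_fun q : x y / x + y}.
Proof. by move=> x y; exact: fm_sumD. Qed.

Lemma free_funZ q a (x : free_omodule S I q) : free_fun (a *: x) = a *: free_fun x.
Proof. exact: fm_sumZ. Qed.

Lemma free_fun_res q q' (h : le q q') (x : free_omodule S I q) :
  mres M h (free_fun x) = free_fun (mres (free_omodule S I) h x).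
Proof.
have [r hr] := covers_exists (x : freeMod I (stalk q)).
rewrite (free_funE hr) (@free_funE q' _ r); last first.
  split=> [|i]; first by case: hr.
  move=> xi; case: hr => _; apply => x0; apply: xi.
  by rewrite -[LHS]/(res h (fval (x : freeMod I (stalk q)) i)) x0 rmorph0.
rewrite raddf_sum; apply: eq_bigr => i _.
by rewrite -(m_res h); exact: linearZ_LR.
Qed.

Definition free_map : omorphism (free_omodule S I) M.
Proof.
exists (fun q => mklin (@free_funD q) (@free_funZ q)) => q q' h x.
by rewrite !(mklinE (@free_funD _)) free_fun_res.
Defined.

Lemma free_mapE q x : free_map q x = free_fun x. Proof. exact: mklinE. Qed.

Lemma free_map_delta q i a : free_map q (fm_delta i a) = a *: m q i.
Proof. by rewrite free_mapE; exact: fm_sum_delta. Qed.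

End FreeMap.

Section QuasiCoherent.
Variables (W : ringedSpace) (H : omodule W).

Lemma mres_equiv p q (h : le p q) :
  equiv (lact (H p)) (restr (res h) (lact (H q))) (mres H h).
Proof. by move=> a m; exact: linearZ_LR. Qed.

Definition stalk_bc := forall p q (h : le p q),
  injective (bcmap (mres_equiv h)) /\ forall y, exists x, bcmap (mres_equiv h) x = y.

(** A local presentation gives presentations of [H_p] and [H_q]. Free modules satisfy base change
    and tensoring is right exact, so a diagram chase concludes. *)
Lemma qc_stalk_bc : quasi_coherent H -> stalk_bc.
Proof.
move=> qH p q h; have [U [oU Up [I [J [f [g [fg gs]]]]]]] := qH p.
have Uq : U q := oU _ _ h Up.
pose p' : sub_space U := exist _ p Up; pose q' : sub_space U := exist _ q Uq.
pose h' : le p' q' := h.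
(* The index types carry no structure; [{classic I}] provides the choice structure needed for finite
   sums. *)
pose FI : omodule (sub_space U) := free_omodule (sub_space U) {classic I}.
pose FJ : omodule (sub_space U) := free_omodule (sub_space U) {classic J}.
pose fp : {linear FI p' -> FJ p'} := f p'; pose fq : {linear FI q' -> FJ q'} := f q'.
pose gp : {linear FJ p' -> H p} := g p'; pose gq : {linear FJ q' -> H q} := g q'.
pose phI : {additive freeMod {classic I} (stalk p) -> freeMod {classic I} (stalk q)} :=
  mres FI h'.
pose phJ : {additive freeMod {classic J} (stalk p) -> freeMod {classic J} (stalk q)} :=
  mres FJ h'.
have phIE g' i : phI g' i = res h (g' i) by exact: erefl.
have phJE g' i : phJ g' i = res h (g' i) by exact: erefl.
have phI_e : equiv (lact (freeMod {classic I} (stalk p)))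
    (restr (res h) (lact (freeMod {classic I} (stalk q)))) phI.
  by move=> a m; apply: (linearZ_LR (mres FI h')).
have phJ_e : equiv (lact (freeMod {classic J} (stalk p)))
    (restr (res h) (lact (freeMod {classic J} (stalk q)))) phJ.
  by move=> a m; apply: (linearZ_LR (mres FJ h')).
have fpE := lin_equiv fp; have gpE := lin_equiv gp.
have gp_surj y : exists x, gp x = y by exact: gs.
have gp_exact x : gp x = 0 -> exists y, fp y = x by move=> x0; apply/fg.
have gpq x : mres H h (gp x) = gq (phJ x) by exact: (omor_res g h').
have fpq x : phJ (fp x) = fq (phI x) by exact: (omor_res f h').
have sq_g x : bcmap (mres_equiv h) (lmap (ralg (res h)) gpE x) = gq (bcmap phJ_e x).
  elim/tensor_ind: x => [|b m|x y hx hy]; [by rewrite !raddf0 | | ].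
    rewrite tmapE !bcmapE; apply: etrans (congr1 (lact (H q) b) (gpq m)) _.
    exact/esym/(linearZ_LR gq).
  by rewrite !raddfD hx hy.
have sq_f x : bcmap phJ_e (lmap (ralg (res h)) fpE x) = fq (bcmap phI_e x).
  elim/tensor_ind: x => [|b m|x y hx hy]; [by rewrite !raddf0 | | ].
    rewrite tmapE !bcmapE; apply: etrans (congr1 (lact (FJ q') b) (fpq m)) _.
    exact/esym/(linearZ_LR fq).
  by rewrite !raddfD hx hy.
split.
  apply: additive_inj => x; have [v <-] := lmap_surj (sL := ralg (res h)) gpE gp_surj x.
  rewrite sq_g => v0; have [u hu] : exists u, fq u = bcmap phJ_e v by apply/(fg q').
  have [u' hu'] := free_bc_surj phIE phI_e u.
  have -> : v = lmap (ralg (res h)) fpE u'.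
    by apply: (free_bc_inj phJE (phi_equiv := phJ_e)); rewrite sq_f hu' hu.
  have -> : lmap (ralg (res h)) gpE (lmap (ralg (res h)) fpE u') = 0; last by [].
  have gf0 m : gp (fp m) = 0 by exact: (fg p' (fp m)).2 (ex_intro _ m erefl).
  clear hu'; elim/tensor_ind: u' => [|b m|w w' hw hw']; [by rewrite !raddf0 | |].
    rewrite !tmapE; apply: etrans (congr1 (tpure _ _ b) (gf0 m)) _.
    exact: (balanced0r (balanced_tpure _ _)).
  by rewrite !raddfD hw hw' addr0.
move=> y; have [v hv] := gs q' y; have [v' hv'] := free_bc_surj phJE phJ_e v.
by exists (lmap (ralg (res h)) gpE v'); rewrite sq_g hv' -hv.
Qed.

(** On [U_p] the generators are all elements of [H_p] and the relations all elements of the kernel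
    at [p]. Base change along [p <= q] shows that this remains a presentation at [q]. *)
Lemma stalk_bc_qc : stalk_bc -> quasi_coherent H.
Proof.
move=> bc p; exists (le p); split; [exact: is_open_le | exact: Defs.le_refl |].
pose S := sub_space (le p).
pose J : choiceType := H p.
pose FJ : omodule S := free_omodule S J.
pose gm (q : S) (j : J) : Defs.restrict (le p) H q := mres H (valP q) j.
have gm_res (q q' : S) (h : le q q') j : mres (Defs.restrict (le p) H) h (gm q j) = gm q' j.
  exact: (@mres_comp W H p (val q) (val q') (valP q) h (valP q')).
pose g : omorphism FJ (Defs.restrict (le p) H) := free_map gm_res.
pose p' : S := exist _ p (Defs.le_refl p).
pose K := kerg (g p' : {additive freeMod J (stalk p) -> H p}).
pose I : choiceType := subg K.
pose ph (q : S) : {additive freeMod J (stalk p) -> freeMod J (stalk (val q))} :=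
  @mres S FJ p' q (valP q).
have phE (q : S) c i : ph q c i = res (valP q) (c i) by exact: erefl.
have ph_e (q : S) : equiv (lact (freeMod J (stalk p)))
    (restr (res (valP q)) (lact (freeMod J (stalk (val q))))) (ph q).
  by move=> a c; apply: (linearZ_LR (@mres S FJ p' q (valP q))).
pose fm (q : S) (i : I) : FJ q := ph q (sgval K i).
have fm_res (q q' : S) (h : le q q') i : mres FJ h (fm q i) = fm q' i.
  exact: (@mres_comp S FJ p' q q' (valP q) h (valP q')).
pose f : omorphism (free_omodule S I) FJ := free_map fm_res.
pose gp : {additive freeMod J (stalk p) -> H p} := g p'.
have gpE : equiv (lact (freeMod J (stalk p))) (lact (H p)) gp.
  by move=> a c; apply: (linearZ_LR (g p')).
have gp_surj y : exists x, gp x = y.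
  exists (fm_delta y 1); rewrite [LHS](free_map_delta gm_res) scale1r.
  exact: mres_id.
have sq (q : S) x : bcmap (mres_equiv (valP q)) (lmap (ralg (res (valP q))) gpE x) =
    g q (bcmap (ph_e q) x).
  elim/tensor_ind: x => [|b c|x y hx hy]; [by rewrite !raddf0 | |].
    rewrite tmapE !bcmapE.
    apply: etrans (congr1 (lact (H (val q)) b) (@omor_res _ _ _ g p' q (valP q) c)) _.
    exact/esym/(linearZ_LR (g q)).
  by rewrite !raddfD hx hy.
have gf0 (q : S) x : g q (f q x) = 0.
  have -> : f q x = fm_sumA (lact (FJ q)) (fm q) x by rewrite [LHS]free_mapE mkaddE.
  have [r hr] := covers_exists (x : freeMod I (stalk (val q))).
  rewrite mkaddE (fm_sumE _ _ hr) linear_sum big1 // => i _.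
  rewrite [LHS](linearZ_LR (g q)) -[g q _]/(g q (ph q (sgval K i))).
  rewrite -[g q _](@omor_res _ _ _ g p' q (valP q)).
  by rewrite [g p' _](sgvalP i) raddf0 scaler0.
exists I, J, f, g; split; last first.
  move=> q y; have [x hx] := (bc _ _ (valP q)).2 y.
  have [v hv] := lmap_surj (sL := ralg (res (valP q))) gpE gp_surj x.
  by exists (bcmap (ph_e q) v); rewrite -sq hv hx.
move=> q v; split=> [v0|[x <-]]; last exact: gf0.
have [v' hv'] := free_bc_surj (phE q) (ph_e q) v.
have : lmap (ralg (res (valP q))) gpE v' = 0.
  by apply: (bc _ _ (valP q)).1; rewrite raddf0 sq hv'.
have kE := sgval_equiv (kerg_act gpE).
have ex c : gp c = 0 -> exists i, sgval K i = c by move=> c0; exists (@sgmk _ K c c0).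
have qe := @lmap_exact _ _ _ _ _ (ralg (res (valP q))) _ _ _ _ _ kE gpE gp_surj ex v'.
move=> /qe[w hw]; rewrite -hv' -hw {hw hv' v0 qe}.
elim/tensor_ind: w => [|b i|x y [x' hx] [y' hy]].
- by exists 0; rewrite !raddf0.
- exists (fm_delta i b); rewrite [LHS](free_map_delta fm_res) tmapE bcmapE.
  by [].
- by exists (x' + y'); rewrite linearD hx hy !raddfD.
Qed.

End QuasiCoherent.

(** * Cocartesian squares of rings *)

Section Cocartesian.
Variables (A B R S : comPzRingType) (f : {rmorphism A -> B}) (f' : {rmorphism R -> S}).
Variables (g : {rmorphism A -> R}) (g' : {rmorphism B -> S}).

Definition cocart_commute := forall a, g' (f a) = f' (g a).

Section Map.
Hypothesis gf : cocart_commute.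
Variables (M : zmodType) (s : act R M) (s1 : act A M).
Hypothesis s1E : forall a m, s1 a m = s (g a) m.

Lemma cocart_balanced : balanced (ralg f) s1 (fun b m => tpure (ralg f') s (g' b) m).
Proof.
split=> [b b' m|b m m'|a b m]; rewrite ?rmorphD ?tpureDl ?tpureDr //.
by rewrite s1E -tpureZ /= rmorphM gf.
Qed.

Definition cocart_map : {additive tensor (ralg f) s1 -> tensor (ralg f') s} :=
  tliftA cocart_balanced.

Lemma cocart_mapE b m :
  cocart_map (tpure (ralg f) s1 b m) = tpure (ralg f') s (g' b) m.
Proof. exact: tliftAE. Qed.

End Map.

(* [S] is the pushout [B (x)_A R], tested on modules. *)
Definition cocart := cocart_commute /\
  forall (gf : cocart_commute) (M : zmodType) (s : act R M) (s1 : act A M)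
    (s1E : forall a m, s1 a m = s (g a) m),
    injective (cocart_map gf s1E) /\ forall y, exists x, cocart_map gf s1E x = y.

(** [S (x)_R N] is [B (x)_A N], and [B] is flat over [A]. *)
Lemma cocart_flat : cocart -> mflat (ralg f) -> mflat (ralg f').
Proof.
move=> [gf bij] fl N N' t t' u uE u_inj x x0.
have e1 a m : restr g t a m = t (g a) m by [].
have e1' a m : restr g t' a m = t' (g a) m by [].
have [y hy] := (bij gf _ _ _ e1).2 x; rewrite -hy.
suff -> : y = 0 by rewrite raddf0.
have uE1 : equiv (restr g t) (restr g t') u by exact: equiv_restr.
apply: (fl _ _ _ _ _ uE1 u_inj); apply: (bij gf _ _ _ e1').1.
rewrite raddf0 -x0 -hy; clear hy.
by tens_elim y b m; rewrite tmapE !cocart_mapE tmapE.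
Qed.

Section Qis.
Hypothesis fc : cocart.
Variables (P : acx R) (Q : acx S) (h : cmap P Q) (hE : semilin f' h).
Variables (P1 : forall n, act A (P n)) (Q1 : forall n, act B (Q n)).
Hypothesis P1E : forall n a m, P1 n a m = aca P n (g a) m.
Hypothesis Q1E : forall n a m, Q1 n a m = aca Q n (g' a) m.
Variables (p1E : forall n, equiv (P1 n) (P1 n.+1) (cd P n)).
Variables (q1E : forall n, equiv (Q1 n) (Q1 n.+1) (cd Q n)).
Variable (hE1 : @semilin _ _ f (Acx p1E) (Acx q1E) h).

Definition cocart_cmap : cmap (bcx f (Acx p1E)) (bcx f' P).
Proof.
exists (fun n => cocart_map fc.1 (@P1E n)) => n x.
by tens_elim x b m; rewrite tmapE !cocart_mapE tmapE.
Defined.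

Lemma cocart_qis n : qis_at cocart_cmap n.
Proof.
have bij m := fc.2 fc.1 _ _ _ (@P1E m).
split=> [x x0 [y hy]|y y0].
  case: n x x0 y hy => [|n] x x0 y.
    rewrite /= zeroaddE => x1; exists 0; rewrite raddf0; apply: (bij 0%N).1.
    by rewrite raddf0 x1.
  have [y' <-] := (bij n).2 y => /= hy; exists y'; apply: (bij n.+1).1.
  by rewrite -[RHS]hy; exact: (@cmd _ _ cocart_cmap n y').
have [x hx] := (bij n).2 y; exists x.
  by apply: (bij n.+1).1; rewrite raddf0 -[RHS]y0 -hx; exact: (@cmd _ _ cocart_cmap n x).
by rewrite /= hx subrr; exact: bdry0.
Qed.

(** The pushout property identifies [B (x)_A P] with [S (x)_R P], compatibly with the maps to
    [Q]. *)
Lemma cocart_bcm n : qis_at (bcm hE1) n <-> qis_at (bcm hE) n.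
Proof.
have e x : bcm hE n (cocart_cmap n x) = bcm hE1 n x.
  by tens_elim x b m; rewrite [cocart_cmap n _]cocart_mapE !bcmapE /= Q1E.
split=> q.
  apply: (qis_at_cancel (cocart_qis n)).
  by apply: (qis_at_ext _ q) => x; rewrite -e.
apply: (@qis_at_ext _ _ (cmap_comp (bcm hE) cocart_cmap)) => [x|]; first exact: e.
by apply: qis_at_comp => //; exact: cocart_qis.
Qed.

End Qis.
End Cocartesian.

Lemma cocart_paste (A B R S T U : comPzRingType) (f : {rmorphism A -> B})
  (f' : {rmorphism R -> S}) (f'' : {rmorphism T -> U}) (g : {rmorphism A -> R})
  (g' : {rmorphism B -> S}) (l : {rmorphism R -> T}) (l' : {rmorphism S -> U}) :
  cocart f f' g g' -> cocart f' f'' l l' -> cocart f f'' (l \o g) (l' \o g').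
Proof.
move=> [c1 b1] [c2 b2]; split=> [a|gf M s s1 s1E]; first by rewrite /= c1 c2.
have e1 a m : s1 a m = restr l s (g a) m by rewrite s1E.
have e2 r m : restr l s r m = s (l r) m by [].
have e x : cocart_map gf s1E x = cocart_map c2 e2 (cocart_map c1 e1 x).
  by tens_elim x b m; rewrite !cocart_mapE.
split=> [x y|y].
  by rewrite !e => /(b2 c2 _ _ _ e2).1 /(b1 c1 _ _ _ e1).1.
have [z hz] := (b2 c2 _ _ _ e2).2 y; have [x hx] := (b1 c1 _ _ _ e1).2 z.
by exists x; rewrite e hx.
Qed.

Section CocartesianTensor.
Variables (k A B C R S : comPzRingType) (f : {rmorphism A -> B}) (f' : {rmorphism R -> S}).
Variables (g : {rmorphism A -> R}) (g' : {rmorphism B -> S}).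
Variables (kA : {rmorphism k -> A}) (kB : {rmorphism k -> B}) (kC : {rmorphism k -> C}).
Variables (u : {rmorphism C -> R}).
Hypothesis kAB : forall r, f (kA r) = kB r.
Hypothesis gf : forall a, g' (f a) = f' (g a).
Hypothesis ku : forall r, g (kA r) = u (kC r).
Hypothesis R_ind : forall K : R -> Prop, K 0 -> (forall a c, K (g a * u c)) ->
  (forall r r', K r -> K r' -> K (r + r')) -> forall r, K r.
Variable theta : {additive tensor (ralg kB) (ralg kC) -> S}.
Hypothesis thetaE : forall b c, theta (tpure _ _ b c) = g' b * f' (u c).
Hypothesis theta_inj : injective theta.
Hypothesis theta_surj : forall y, exists x, theta x = y.

Definition theta_inv_fun y := projT1 (cid (theta_surj y)).

Lemma theta_inv_funK y : theta (theta_inv_fun y) = y.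
Proof. by rewrite /theta_inv_fun; case: cid. Qed.

Lemma theta_invD : {morph theta_inv_fun : x y / x + y}.
Proof. by move=> x y; apply: theta_inj; rewrite raddfD !theta_inv_funK. Qed.

Definition theta_inv : {additive S -> tensor (ralg kB) (ralg kC)} := mkadd theta_invD.

Lemma theta_invK y : theta (theta_inv y) = y.
Proof. by rewrite mkaddE theta_inv_funK. Qed.

Lemma thetaK x : theta_inv (theta x) = x.
Proof. by apply: theta_inj; rewrite theta_invK. Qed.

Section Module.
Variables (M : zmodType) (s : act R M) (s1 : act A M).
Hypothesis s1E : forall a m, s1 a m = s (g a) m.

Lemma ct_balanced m : balanced (ralg kB) (ralg kC)
  (fun b c => tpure (ralg f) s1 b (s (u c) m)).
Proof.
split=> [b b' c|b c c'|r b c]; rewrite ?tpureDl //.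
  by rewrite rmorphD actDl tpureDr.
rewrite -[ralg kB r b]/(kB r * b) -kAB -[f _ * b]/(ralg f (kA r) b) tpureZ s1E ku.
by rewrite actM -rmorphM.
Qed.

Lemma ctD x : {morph (fun m => tliftA (ct_balanced m) x) : m m' / m + m'}.
Proof.
move=> m m'; elim/tensor_ind: x => [|b c|y z hy hz]; first by rewrite !raddf0 addr0.
  by rewrite !tliftAE actDr tpureDr.
by rewrite !raddfD hy hz addrACA.
Qed.

(** Linearity over [R] of the candidate inverse, checked on the additive generators [g a * u c] of
    [R]. *)
Lemma ct_act r x m :
  tliftA (ct_balanced m) (theta_inv (f' r * theta x)) = tliftA (ct_balanced (s r m)) x.
Proof.
elim/tensor_ind: x => [|b c|y z hy hz]; first by rewrite !raddf0 mulr0 !raddf0.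
  elim/R_ind: r => [|a c0|r r' hr hr'].
  - by rewrite rmorph0 mul0r !raddf0 act0l tliftAE act0 (balanced0r (balanced_tpure _ _)).
  - have -> : f' (g a * u c0) * theta (tpure _ _ b c) = theta (tpure _ _ (f a * b) (c0 * c)).
      by rewrite !thetaE !rmorphM gf mulrACA.
    rewrite thetaK !tliftAE -[f a * b]/(ralg f a b) tpureZ s1E !actM rmorphM.
    by rewrite mulrA [u c * _]mulrC.
  - by rewrite rmorphD mulrDl !raddfD hr hr' actDl ctD.
by rewrite raddfD mulrDr !raddfD hy hz.
Qed.

Lemma ct_inv_balanced : balanced (ralg f') s (fun y m => tliftA (ct_balanced m) (theta_inv y)).
Proof.
split=> [y y' m|y m m'|r y m]; first by rewrite !raddfD.
  exact: ctD.
by rewrite -[in LHS](theta_invK y) ct_act.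
Qed.

End Module.

(** The case in mind is [R = A (x)_k C] and [S = B (x)_k C]: the inverse sends [(b (x) c) (x) m] to
    [b (x) (u c) m]. *)
Lemma cocart_tensor : cocart f f' g g'.
Proof.
split=> // gf' M s s1 s1E; split.
  apply: (can_inj (g := tliftA (ct_inv_balanced s1E))) => x.
  tens_elim x b m; rewrite cocart_mapE tliftAE.
  have -> : g' b = theta (tpure _ _ b 1) by rewrite thetaE !rmorph1 mulr1.
  by rewrite thetaK tliftAE rmorph1 act1.
elim/tensor_ind => [|y m|y z [y' <-] [z' <-]]; first by exists 0; rewrite raddf0.
  have [x <-] := theta_surj y; elim/tensor_ind: x => [|b c|x x' [w hw] [w' hw']].
  - by exists 0; rewrite !raddf0 (balanced0l (balanced_tpure _ _)).
  - exists (tpure _ _ b (s (u c) m)); rewrite cocart_mapE thetaE mulrC.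
    exact/esym/tpureZ.
  - by exists (w + w'); rewrite !raddfD hw hw' tpureDl.
by exists (y' + z'); rewrite raddfD.
Qed.

End CocartesianTensor.

Section Projections.
Variables (k : comPzRingType) (X Y : overSpace k).
Notation Z := (prod_space X Y).

Lemma proj1_res (z z' : Z) (h : le z z') (a : stalk z.1) :
  res h (tinl (kmor z.1) (kmor z.2) a) =
  tinl (kmor z'.1) (kmor z'.2) (res (prod_le1 h) a).
Proof. by rewrite [LHS]prod_resE rmorph1. Qed.

Definition proj1_mor : ringedMor Z X :=
  @RingedMor Z X (fun z => z.1) (fun z z' h => prod_le1 h)
    (fun z => tinl (kmor z.1) (kmor z.2)) proj1_res.

Lemma proj2_res (z z' : Z) (h : le z z') (a : stalk z.2) :
  res h (tinr (kmor z.1) (kmor z.2) a) =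
  tinr (kmor z'.1) (kmor z'.2) (res (prod_le2 h) a).
Proof. by rewrite [LHS]prod_resE rmorph1. Qed.

Definition proj2_mor : ringedMor Z Y :=
  @RingedMor Z Y (fun z => z.2) (fun z z' h => prod_le2 h)
    (fun z => tinr (kmor z.1) (kmor z.2)) proj2_res.

(** The identity map between two convertible descriptions of the same tensor product. *)
Definition tens_talg (x : X) (y : Y) :
  {additive tensor (ralg (kmor x)) (ralg (kmor y)) -> talg (kmor x) (kmor y)} :=
  @mkadd (tensor (ralg (kmor x)) (ralg (kmor y))) (talg (kmor x) (kmor y))
    (fun z => z) (fun _ _ => erefl).

Lemma tens_talgE x y a b : tens_talg x y (tpure _ _ a b) = tpr (kmor x) (kmor y) a b.
Proof. exact: mkaddE. Qed.

Lemma tens_talg_inj x y : injective (tens_talg x y).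
Proof. by move=> a b; rewrite !mkaddE. Qed.

Lemma tens_talg_surj x y a : exists b, tens_talg x y b = a.
Proof. by exists a; rewrite mkaddE. Qed.

Lemma prod_is_product : is_product proj1_mor proj2_mor.
Proof.
have tE (z : Z) (b : balanced (ralg (kmor z.2)) (ralg (kmor z.1))
    (fun l m => comor proj2_mor z l * comor proj1_mor z m)) x :
    tliftA b x = tens_talg z.1 z.2 (tswap _ _ x).
  elim/tensor_ind: x => [|l m|x y hx hy]; first by rewrite !raddf0.
    by rewrite tliftAE tswapE tens_talgE [LHS]tprM mulr1 mul1r.
  by rewrite !raddfD hx hy.
split.
- by move=> x y; exists (x, y).
- by [].
- by move=> z c; rewrite /= -[RHS](tinlr (kmor z.1) (kmor z.2)).
- move=> z b x y; rewrite !tE => /tens_talg_inj.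
  exact: (can_inj (@tswapK _ _ _ _ _)).
- move=> z b a; have [c hc] := tens_talg_surj a.
  by exists (tswap _ _ c); rewrite tE tswapK.
Qed.

Lemma stalk_ind (z : Z) (K : stalk z -> Prop) : K 0 ->
  (forall a c, K (tinl (kmor z.1) (kmor z.2) a * tinr (kmor z.1) (kmor z.2) c)) ->
  (forall r r', K r -> K r' -> K (r + r')) -> forall r, K r.
Proof. by move=> K0 Kp KD; apply: talg_ind => // a b; rewrite -tinlrM. Qed.

Lemma cocart_left (x x'' : X) (y : Y) (hx : le x x'')
  (h : @le Z (x, y) (x'', y)) :
  cocart (res hx) (res h) (tinl (kmor x) (kmor y)) (tinl (kmor x'') (kmor y)).
Proof.
have gf a : tinl (kmor x'') (kmor y) (res hx a) = res h (tinl (kmor x) (kmor y) a).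
  by rewrite [RHS](@proj1_res (x, y) (x'', y)) (bool_irrelevance (prod_le1 h) hx).
apply: (@cocart_tensor _ _ _ _ _ _ (res hx) (res h) _ _ (kmor x) (kmor x'') (kmor y)
  (tinr (kmor x) (kmor y)) _ gf _ _ (tens_talg x'' y)).
- by move=> r; exact: kmor_res.
- by move=> r; exact: tinlr.
- exact: (@stalk_ind (x, y)).
- move=> b c; rewrite tens_talgE [res h _](@proj2_res (x, y) (x'', y)) res_id.
  by rewrite tinlrM.
- exact: tens_talg_inj.
- exact: tens_talg_surj.
Qed.

Lemma cocart_right (x : X) (y y'' : Y) (hy : le y y'')
  (h : @le Z (x, y) (x, y'')) :
  cocart (res hy) (res h) (tinr (kmor x) (kmor y)) (tinr (kmor x) (kmor y'')).
Proof.
have gf a : tinr (kmor x) (kmor y'') (res hy a) = res h (tinr (kmor x) (kmor y) a).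
  by rewrite [RHS](@proj2_res (x, y) (x, y'')) (bool_irrelevance (prod_le2 h) hy).
pose th : {additive tensor (ralg (kmor y'')) (ralg (kmor x)) -> talg (kmor x) (kmor y'')} :=
  tens_talg x y'' \o tswap _ _.
apply: (@cocart_tensor _ _ _ _ _ _ (res hy) (res h) _ _ (kmor y) (kmor y'') (kmor x)
  (tinl (kmor x) (kmor y)) _ gf _ _ th).
- by move=> r; exact: kmor_res.
- by move=> r; exact/esym/tinlr.
- move=> K K0 Kp KD; apply: (@stalk_ind (x, y)) => // a c.
  by rewrite mulrC; exact: Kp.
- move=> b c; rewrite /th /= tswapE tens_talgE.
  rewrite [res h _](@proj1_res (x, y) (x, y'')) res_id.
  by rewrite mulrC tinlrM.
- by move=> a b /tens_talg_inj; exact: (can_inj (@tswapK _ _ _ _ _)).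
- move=> a; have [c hc] := tens_talg_surj a.
  by exists (tswap _ _ c); rewrite /th /= tswapK.
Qed.

End Projections.

Section Transfer.
Variables (Z V W : ringedSpace) (p : ringedMor Z V) (q : ringedMor Z W).
Variables (E : nat -> omodule Z) (d : forall n, omorphism (E n) (E n.+1)).
Hypothesis dd : forall n (p : Z) m, d n.+1 p (d n p m) = 0.
Variables (v v'' : V) (hv : le v v'') (w w'' : W) (hw : le w w'').
Variables (g : {rmorphism stalk v -> stalk w}) (g'' : {rmorphism stalk v'' -> stalk w''}).
Hypothesis sq : cocart (res hv) (res hw) g g''.
Hypothesis gE : forall z (h1 : le v (p z)) (h2 : le w (q z)) a,
  comor p z (res h1 a) = comor q z (res h2 (g a)).
Hypothesis gE'' : forall z (h1 : le v'' (p z)) (h2 : le w'' (q z)) a,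
  comor p z (res h1 a) = comor q z (res h2 (g'' a)).
Variables (P P'' : pred Z) (hP : psub P'' P).
Variables (Pv : psub P (fun z => le v (p z))) (Pv'' : psub P'' (fun z => le v'' (p z))).
Variables (Pw : psub P (fun z => le w (q z))) (Pw'' : psub P'' (fun z => le w'' (q z))).

(** The same sections are modules over the stalks of [V] and of [W], compatibly by [gE] and [gE''];
    the pushout square matches the two base change maps. *)
Lemma base_change_cocart n :
  qis_at (bcm (@GO_semilin _ _ p _ _ dd v v'' hv P P'' Pv Pv'' hP)) n <->
  qis_at (bcm (@GO_semilin _ _ q _ _ dd w w'' hw P P'' Pw Pw'' hP)) n.
Proof.
have e m a (s : GO dd Pv m) : aca (GO dd Pv) m a s = aca (GO dd Pw) m (g a) s.
  apply: sections_ext => z hz.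
  by rewrite (GO_actE _ _ _ (@Pv z hz)) [RHS](GO_actE _ _ _ (@Pw z hz)) (gE _ (@Pw z hz)).
have e'' m a (s : GO dd Pv'' m) : aca (GO dd Pv'') m a s = aca (GO dd Pw'') m (g'' a) s.
  apply: sections_ext => z hz.
  by rewrite (GO_actE _ _ _ (@Pv'' z hz)) [RHS](GO_actE _ _ _ (@Pw'' z hz)) (gE'' _ (@Pw'' z hz)).
exact: (@cocart_bcm _ _ _ _ _ _ _ _ sq (GO dd Pw) (GO dd Pw'') _
  (@GO_semilin _ _ q _ _ dd w w'' hw P P'' Pw Pw'' hP) (aca (GO dd Pv)) (aca (GO dd Pv''))
  e e'' (acE (GO dd Pv)) (acE (GO dd Pv''))
  (@GO_semilin _ _ p _ _ dd v v'' hv P P'' Pv Pv'' hP) n).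
Qed.

End Transfer.

Section Composition.
Variables (A B C : comPzRingType) (f : {rmorphism A -> B}) (g : {rmorphism B -> C}).
Variables (gf : {rmorphism A -> C}) (gfE : forall a, gf a = g (f a)).
Variables (P : acx A) (Q : acx B) (T : acx C) (h : cmap P Q) (h' : cmap Q T) (h'' : cmap P T).
Hypothesis hE : semilin f h.
Hypothesis hE' : semilin g h'.
Hypothesis hE'' : semilin gf h''.
Hypothesis hh : forall n x, h'' n x = h' n (h n x).
Hypothesis g_flat : mflat (ralg g).

Lemma comp_balanced n : balanced (ralg gf) (aca P n)
  (fun c m => tpure (ralg g) (bact f (aca P n)) c (tpure (ralg f) (aca P n) 1 m)).
Proof.
split=> [c c' m|c m m'|a c m]; rewrite ?tpureDl ?tpureDr //.
rewrite -[ralg gf a c]/(gf a * c) gfE -[g _ * c]/(ralg g (f a) c) tpureZ tactE.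
by rewrite -[mulact B _ _]/(f a * 1) -[f a * 1]/(ralg f a 1) tpureZ.
Qed.

Definition comp_cmap : cmap (bcx gf P) (bcx g (bcx f P)).
Proof.
exists (fun n => tliftA (comp_balanced n)) => n x.
by tens_elim x c m; rewrite tmapE !tliftAE.
Defined.

Lemma decomp_balanced1 n c : balanced (ralg f) (aca P n)
  (fun b m => tpure (ralg gf) (aca P n) (g b * c) m).
Proof.
split=> [b b' m|b m m'|a b m]; rewrite ?rmorphD ?mulrDl ?tpureDl ?tpureDr //.
by rewrite -tpureZ /= rmorphM gfE mulrA.
Qed.

Lemma decomp_balanced n : balanced (ralg g) (bact f (aca P n))
  (fun c z => tliftA (decomp_balanced1 n c) z).
Proof.
split=> [c c' z|c z z'|b c z]; last first.
- by tens_elim z b' m; rewrite tactE !tliftAE /= rmorphM mulrCA mulrA.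
- exact: raddfD.
- by tens_elim z b' m; rewrite !tliftAE mulrDr tpureDl.
Qed.

Definition decomp_cmap : cmap (bcx g (bcx f P)) (bcx gf P).
Proof.
exists (fun n => tliftA (decomp_balanced n)) => n x.
elim/tensor_ind: x => [|c z|x y hx hy]; [by rewrite !raddf0 | | by rewrite !raddfD hx hy].
elim/tensor_ind: z => [|b m|x y hx hy].
- by rewrite (balanced0r (balanced_tpure _ _)) !raddf0.
- by rewrite !tmapE !tliftAE.
- by rewrite tpureDr !raddfD hx hy.
Defined.

Lemma comp_qis : qis comp_cmap.
Proof.
apply: (@qis_iso _ _ _ decomp_cmap) => n x.
  by tens_elim x c m; rewrite !tliftAE rmorph1 mul1r.
elim/tensor_ind: x => [|c z|x y hx hy]; [by rewrite !raddf0 | | by rewrite !raddfD hx hy].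
elim/tensor_ind: z => [|b m|x y hx hy].
- by rewrite (balanced0r (balanced_tpure _ _)) !raddf0.
- rewrite !tliftAE -[g b * c]/(ralg g b c) tpureZ tactE.
  by rewrite -[mulact B b 1]/(b * 1) mulr1.
- by rewrite tpureDr !raddfD hx hy.
Qed.

(** [C (x)_A P] is [C (x)_B (B (x)_A P)], and flatness of [g] allows [bcm hE] to be tensored with
    [C]. *)
Lemma bcm_composition : qis (bcm hE) -> qis (bcm hE') -> qis (bcm hE'').
Proof.
move=> q q' n.
pose w : cmap (bcx g (bcx f P)) (bcx g Q) :=
  @ltcm _ _ (ralg g) (bcx f P) Q _ _ (acE (bcx f P)) (acE Q) (bcm hE)
    (fun n => bcmap_equiv (@hE n)).
have wq : qis w by exact: ltcm_qis_flat.
apply: (@qis_at_ext _ _ (cmap_comp (bcm hE') (cmap_comp w comp_cmap))) => [x|].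
  elim/tensor_ind: x => [|c m|x y hx hy]; [by rewrite !raddf0 | | by rewrite !raddfD hx hy].
  rewrite -[LHS]/(bcm hE' n (w n (comp_cmap n (tpure (ralg gf) (aca P n) c m)))).
  rewrite [comp_cmap n _]tliftAE [w n _]tmapE [LHS]bcmapE bcmapE.
  by rewrite act1 [RHS]bcmapE hh.
by apply: qis_at_comp => //; apply: qis_at_comp; [exact: comp_qis | exact: wq].
Qed.

End Composition.

(** * Higher direct images *)

Section DirectImageCohomology.
Variables (Z W : ringedSpace) (f : ringedMor Z W).
Variables (E : nat -> omodule Z) (d : forall n, omorphism (E n) (E n.+1)).
Hypothesis dd : forall n (p : Z) m, d n.+1 p (d n p m) = 0.
Variables (n : nat) (H : omodule W).
Notation D w := (fun z : Z => le w (f z)).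
Notation dE := (fun m => direct_image_map f (d m)).
Notation G w := (@GO Z W f E d dd w (D w) (fun z h => h)).

Lemma sec_map_direct m w (s : sections (E m) (D w)) :
  sec_map (d m) (D w) s = direct_image_map f (d m) w s.
Proof. by apply: sections_ext => z hz; rewrite sec_mapE. Qed.

Section Cohomology.
Variables (Zo : omodule W) (i : omorphism Zo (direct_image f (E n))) (q : omorphism Zo H).
Hypotheses (i_mono : omono i) (i_exact : oexact i (dE n)) (q_epi : oepi q).
Hypothesis qi : forall (p : W) z, q p z = 0 <-> boundary dE (i p z).

Notation ZG w := (kerg (cd (G w) n)).
Notation sZG w := (subact (kerg_act (acE (G w) n))).

Lemma cycle_ex w (z : subg (ZG w)) : exists l, i w l = sgval (ZG w) z.
Proof. by apply/i_exact; rewrite -sec_map_direct; exact: (sgvalP z). Qed.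

Definition cycle_lift w z : Zo w := projT1 (cid (@cycle_ex w z)).

Lemma cycle_liftE w z : i w (@cycle_lift w z) = sgval (ZG w) z.
Proof. by rewrite /cycle_lift; case: cid. Qed.

Definition coh_fun w z : H w := q w (@cycle_lift w z).

Lemma coh_funE w z l : i w l = sgval (ZG w) z -> coh_fun z = q w l.
Proof. by move=> h; congr (q w _); apply: (i_mono (p := w)); rewrite cycle_liftE h. Qed.

Lemma coh_funD w : {morph @coh_fun w : x y / x + y}.
Proof.
move=> x y; rewrite (@coh_funE _ _ (cycle_lift x + cycle_lift y)) ?linearD //.
by rewrite !cycle_liftE [RHS]raddfD.
Qed.

Definition coh w : {additive subg (ZG w) -> H w} := mkadd (@coh_funD w).

Lemma coh_equiv w : equiv (sZG w) (lact (H w)) (coh w).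
Proof.
move=> a z; rewrite !mkaddE (@coh_funE _ _ (a *: cycle_lift z)).
  exact: (linearZ_LR (q w)).
rewrite [LHS](linearZ_LR (i w)) /= cycle_liftE.
exact: sections_ext.
Qed.

Lemma coh_surj w y : exists z, coh w z = y.
Proof.
have [l <-] := q_epi y.
have l0 : ZG w (i w l : sections (E n) (D w)).
  by rewrite /= sec_map_direct; apply/i_exact; exists l.
by exists (@sgmk _ (ZG w) _ l0); rewrite mkaddE; apply: coh_funE.
Qed.

Lemma boundary_bdry w (b : sections (E n) (D w)) :
  boundary dE (b : direct_image f (E n) w) <-> @bdry (G w) n b.
Proof.
clear; case: n b => [|m] b /=; first by split=> [->|[a /= <-]]; [exact: bdry0 | rewrite zeroaddE].
split=> -[a h]; exists a; rewrite -h; first by rewrite [LHS]sec_map_direct.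
by rewrite [RHS]sec_map_direct.
Qed.

Lemma coh0 w z : coh w z = 0 <-> bdry (sgval (ZG w) z : G w n).
Proof. by rewrite mkaddE -boundary_bdry -cycle_liftE; exact: qi. Qed.

Lemma cohomology_bc_aux w w'' (h : le w w'') (hP : psub (D w'') (D w)) :
  mflat (ralg (res h)) ->
  qis_at (bcm (@GO_semilin Z W f E d dd w w'' h (D w) (D w'') (fun z h => h) (fun z h => h) hP)) n
  <-> injective (bcmap (@mres_equiv W H w w'' h)) /\
      forall y, exists x, bcmap (@mres_equiv W H w w'' h) x = y.
Proof.
move=> fl; apply: (@base_change_cohomology _ _ (res h) _ _ _ _ n _ _ _ _
  (coh w) (@coh_equiv w) (coh w'') (@coh_equiv w'') (@coh_surj w) (@coh_surj w'')
  (@coh0 w) (@coh0 w'')) => // z z' zz'.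
rewrite [coh w z]mkaddE [RHS]mkaddE.
rewrite [LHS](omor_res q h); apply/esym/coh_funE.
rewrite zz' -[LHS](omor_res i h) cycle_liftE; apply: sections_ext => u hu.
by rewrite [RHS](sec_resE _ _ _ (hP u hu)) /=; congr germ; exact: bool_irrelevance.
Qed.

Lemma cohomology_exact_zero_aux : (forall w, exact_at (G w) n) -> is_zero H.
Proof.
move=> Ge w y; have [z <-] := coh_surj y; apply/coh0; apply: Ge; exact: (sgvalP z).
Qed.

Lemma cohomology_zero_exact_aux : is_zero H -> forall w, exact_at (G w) n.
Proof. by move=> H0 w x x0; exact: ((@coh0 w (@sgmk _ (ZG w) x x0)).1 (H0 w _)). Qed.

End Cohomology.

Hypothesis Hc : is_cohomology dE n H.

(** The stalk at [w] of the direct image of [E] is the complex of sections over the preimage of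
    [U_w]; by flatness, base change for it in degree [n] is base change for the stalks of [H]. *)
Lemma cohomology_bc w w'' (h : le w w'') (hP : psub (D w'') (D w)) :
  mflat (ralg (res h)) ->
  qis_at (bcm (@GO_semilin Z W f E d dd w w'' h (D w) (D w'') (fun z h => h) (fun z h => h) hP)) n
  <-> injective (bcmap (@mres_equiv W H w w'' h)) /\
      forall y, exists x, bcmap (@mres_equiv W H w w'' h) x = y.
Proof.
case: Hc => Zo [i [q [[im ie] qe qi]]] fl.
exact: (cohomology_bc_aux im ie qe qi hP fl).
Qed.

Lemma cohomology_zero : is_zero H <-> forall w, exact_at (Gcx dd (D w)) n.
Proof.
case: Hc => Zo [i [q [[im ie] qe qi]]]; split.
  by move=> H0 w x x0; exact: (cohomology_zero_exact_aux im ie qi H0 x0).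
by move=> Ge; exact: (cohomology_exact_zero_aux im ie qe qi Ge).
Qed.

End DirectImageCohomology.

Section CohomologyExists.
Variables (X : ringedSpace) (E : nat -> omodule X) (d : forall n, omorphism (E n) (E n.+1)).
Variable n : nat.

Definition om_kernel : submodule (E n).
Proof.
exists (fun p => kerg (d n p)) => [p a m h|p q h m m0] /=.
  by rewrite (linearZ_LR (d n p)) /= [d n p m]h scaler0.
by rewrite -omor_res [d n p m]m0 raddf0.
Defined.

Lemma boundary0 p : @boundary X E d n p 0.
Proof. by case: n => //= m; exists 0; rewrite raddf0. Qed.

Lemma boundaryB p (x y : E n p) : boundary d x -> boundary d y -> boundary d (x - y).
Proof.
clear; case: n x y => [|m] x y /= => [-> ->|[a <-] [b <-]]; first by rewrite subrr.
by exists (a - b); rewrite linearB.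
Qed.

Lemma boundaryZ p (a : stalk p) (x : E n p) : boundary d x -> boundary d (a *: x).
Proof.
clear; case: n x => [|m] x /= => [->|[b <-]]; first by rewrite scaler0.
by exists (a *: b); rewrite (linearZ_LR (d m p)).
Qed.

Lemma boundary_res p q (h : le p q) (x : E n p) : boundary d x -> boundary d (mres (E n) h x).
Proof.
clear; case: n x => [|m] x /= => [->|[b <-]]; first by rewrite raddf0.
by exists (mres (E m) h b); rewrite omor_res.
Qed.

Definition bdry_subgroup p : subgroup (subom om_kernel p).
Proof.
exists (fun x => boundary d (subom_val x)); first exact: boundary0.
move=> x y hx hy; have -> : subom_val (x - y) = subom_val x - subom_val y by exact: raddfB.
exact: boundaryB.
Defined.

Definition bdry_submodule : submodule (subom om_kernel).
Proof.
exists bdry_subgroup => [p a x hx|p q h x hx] /=; first exact: boundaryZ.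
by rewrite subom_mresE; exact: boundary_res.
Defined.

(** The quotient of cycles by boundaries is realized as the image of [inj_step_map], whose kernel is
    the submodule of boundaries. *)
Lemma cohomology_exists : exists H, is_cohomology d n H.
Proof.
pose q0 := inj_step_map bdry_submodule.
have q0S p x : om_image q0 p (q0 p x) by exists x.
exists (subom (om_image q0)), (subom om_kernel), (subom_in om_kernel), (subom_cor q0S).
split.
- split; first exact: subom_in_mono.
  move=> p m; split=> [m0|[x <-]].
    by exists (@subom_mk _ _ om_kernel p m m0); rewrite subom_inE.
  by rewrite subom_inE; exact: (subom_valP x).
- move=> p y; have [x hx] := subom_valP y; exists x; apply: subom_val_inj.
  by rewrite subom_corE.
- move=> p z; rewrite subom_inE; split=> [z0|hz].
    apply: (inj_step_kernel bdry_submodule z).1.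
    by have := congr1 (@subom_val _ _ _ _) z0; rewrite subom_corE.
  apply: subom_val_inj; rewrite subom_corE.
  exact: (inj_step_kernel bdry_submodule z).2.
Qed.

End CohomologyExists.

Lemma zero_qc (W : ringedSpace) (H : omodule W) : is_zero H -> quasi_coherent H.
Proof.
move=> H0; apply: stalk_bc_qc => p q h; split=> [|y].
  apply: additive_inj => x _; elim/tensor_ind: x => [//|b m|x y -> ->].
    by rewrite (H0 p m) (balanced0r (balanced_tpure _ _)).
  exact: addr0.
by exists 0; rewrite raddf0 (H0 q y).
Qed.

(** Left exactness of direct images: the germs of a 0-cycle lift uniquely through [e], so the lifts
    are compatible and form a section of [M]. *)
Lemma direct_image_cohomology0 (Z W : ringedSpace) (f : ringedMor Z W) (M : omodule Z)
  (E : nat -> omodule Z) (e : omorphism M (E 0)) (d : forall n, omorphism (E n) (E n.+1)) :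
  injective_resolution e d ->
  is_cohomology (fun n => direct_image_map f (d n)) 0 (direct_image f M).
Proof.
move=> Eres; have [e_mono e_exact] := resolution_aug Eres.
have idD (w : W) : {morph (fun s : direct_image f M w => s) : s t / s + t} by [].
have idZ (w : W) (a : stalk w) (s : direct_image f M w) : a *: s = a *: s by [].
pose id_om : omorphism (direct_image f M) (direct_image f M) :=
  @OMorphism W _ _ (fun w => mklin (@idD w) (@idZ w)) (fun w w' h s =>
    etrans (congr1 _ (mklinE (@idD w) (@idZ w) s)) (esym (mklinE (@idD w') (@idZ w') _))).
exists (direct_image f M), (direct_image_map f e), id_om.
have i_mono : omono (direct_image_map f e).
  move=> w s t st; apply: sections_ext => z hz; apply: (e_mono z).
  exact: (congr1 (fun u : sections (E 0) _ => germ u hz) st).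
split.
- split=> // w s; split=> [s0|[u <-]]; last first.
    by apply: sections_ext => z hz; apply/e_exact; exists (germ u hz).
  have ex z (hz : le w (f z)) : exists m, e z m = germ (s : sections _ _) hz.
    apply/e_exact; exact: (congr1 (fun u : sections (E 1) _ => germ u hz) s0).
  pose g z hz := projT1 (cid (@ex z hz)).
  have gE z hz : e z (@g z hz) = germ (s : sections _ _) hz by rewrite /g; case: cid.
  have gr z z' (h : le z z') (hz : le w (f z)) (hz' : le w (f z')) :
      mres M h (g z hz) = g z' hz'.
    by apply: (e_mono z'); rewrite -omor_res !gE; exact: germ_res.
  exists (@Sections Z M (fun z => le w (f z)) g gr); exact: sections_ext.
- by move=> w s; exists s; exact: mklinE.
- move=> w s; rewrite [id_om w s]mklinE /=; split=> [->|h]; first exact: (raddf0 (direct_image_map f e w)).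
  by apply: (i_mono w); rewrite [LHS]h; exact/esym/(raddf0 (direct_image_map f e w)).
Qed.

(** * Schematic and semi-separated spaces in terms of Godement complexes *)

Section GodementOfSchematic.
Variables (k : comPzRingType) (X : overSpace k).
Hypothesis Xf : finite_space X.
Notation M := (structure_sheaf X).

(** The comparison along the identity with [N = k] relates the Godement complex of [X] itself to an
    injective resolution. *)
Definition id_mor : ringedMor X X :=
  @RingedMor X X id (fun _ _ h => h) (fun _ => idfun) (fun _ _ _ _ => erefl).

Section Resolution.
Variables (E : nat -> omodule X) (d : forall n, omorphism (E n) (E n.+1)).
Variables (e : omorphism (structure_sheaf X) (E 0)) (Eres : injective_resolution e d).
Notation dd := (resolution_dd Eres).
Notation t := (mulact k).

Definition k_al z (_ : @predT X z) : {additive k -> stalk z} := kmor z.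

Lemma k_alE z (Qz : predT z) c : @k_al z Qz c = kmor z c. Proof. by []. Qed.

Lemma k_al_res z z' (h : le z z') (Qz : predT z) (Qz' : predT z') c :
  res h (@k_al z Qz c) = @k_al z' Qz' c.
Proof. exact: kmor_res. Qed.

Lemma k_al_t z (Qz : predT z) r c :
  @k_al z Qz (t r c) = comor id_mor z (kmor (id_mor z) r) * @k_al z Qz c.
Proof. exact: rmorphM. Qed.

Notation kc := (kcmp_opmap Eres k_al_res k_al_t).

Lemma tensor_mulact (N : zmodType) (s : act k N) (x : tensor t s) :
  exists n, x = tpure t s 1 n.
Proof.
elim/tensor_ind: x => [|a n|y z [n ->] [n' ->]].
- by exists 0; rewrite (balanced0r (balanced_tpure _ _)).
- by exists (s a n); rewrite -tpureZ /= mulr1.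
- by exists (n + n'); rewrite tpureDr.
Qed.

Lemma kc_stalk p : qis (kc (le p)).
Proof.
apply: (@kcmp_qis_stalk _ _ _ id_mor _ _ _ Eres _ _ predT _ k_al_res k_al_t p isT).
- by rewrite /cbox intr_open; [apply: funext => z; rewrite andbT | exact: is_open_le].
- have sE n : stalk_mul k_al_t (z := p) isT (tpure t (ralg (kmor p)) 1 n) = n.
    by rewrite tliftAE k_alE rmorph1 mul1r.
  move=> x y; have [n ->] := tensor_mulact x; have [m ->] := tensor_mulact y.
  by rewrite !sE => ->.
- move=> a; exists (tpure t (ralg (kmor p)) 1 a).
  by rewrite tliftAE k_alE rmorph1 mul1r.
Qed.

Lemma pure1D (V : pred X) n : {morph (fun c : Kcx M V n => tpure t (aca (Kk V) n) 1 c) : x y / x + y}.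
Proof. by move=> x y; exact: tpureDr. Qed.

Definition pure1 (V : pred X) : cmap (Kcx M V) (NK X t V).
Proof.
exists (fun n => mkadd (@pure1D V n)) => n c.
by rewrite (mkaddE (@pure1D V _)) (mkaddE (@pure1D V _)) [RHS]tmapE.
Defined.

Lemma pure1E V n c : pure1 V n c = tpure t (aca (Kk V) n) 1 c.
Proof. exact: mkaddE. Qed.

Lemma unpure_balanced (V : pred X) n : balanced t (aca (Kk V) n) (fun r c => aca (Kk V) n r c).
Proof.
split=> [a b c|a b c|r a c]; [exact: actDl | exact: actDr |].
by rewrite actM /= mulrC.
Qed.

Definition unpure (V : pred X) : cmap (NK X t V) (Kcx M V).
Proof.
exists (fun n => tliftA (@unpure_balanced V n)) => n x.
by tens_elim x r c; rewrite tmapE !tliftAE; exact/esym/(acE (Kk V) n).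
Defined.

Lemma pure1_qis V : qis (pure1 V).
Proof.
apply: (@qis_iso _ _ _ (unpure V)) => n x.
  by rewrite pure1E [LHS]tliftAE act1.
tens_elim x r c; rewrite pure1E [unpure V n _]tliftAE -tpureZ.
by rewrite /= mulr1.
Qed.

Definition kmap (V : pred X) : cmap (Kcx M V) (Gcx dd (cbox id_mor predT V)) :=
  cmap_comp (kc V) (pure1 V).

Lemma kmapE V n c : kmap V n c = kc V n (tpure t (aca (Kk V) n) 1 c).
Proof. by rewrite -pure1E. Qed.

Lemma kmap_qis V : is_open V -> qis (kmap V).
Proof.
move=> oV n; apply: qis_at_comp; first exact: pure1_qis.
apply: (flabby_qis (f := kc)) => //.
- exact: flabby_NK.
- exact: (flabby_cS id_mor Eres).
- by move=> p m; exact: kc_stalk.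
Qed.

Lemma cbox_id V : is_open V -> cbox id_mor predT V = V.
Proof. by move=> oV; apply: funext => z; rewrite /cbox intr_open // andbT. Qed.

Lemma K_base_change x x'' (hx : le x x'') (U U'' : pred X) (Ux : psub U (le x))
  (Ux'' : psub U'' (le x'')) (hU : psub U'' U) n : is_open U -> is_open U'' ->
  base_change id_mor dd n x x'' U U'' ->
  qis_at (bcm (@KO_semilin _ _ _ _ hx _ _ Ux Ux'' hU)) n.
Proof.
move=> oU oU''; rewrite -{1}[U]cbox_id // -{1}[U'']cbox_id // => bc.
have Px : psub (cbox id_mor predT U) (fun z => le x (id_mor z)) by rewrite cbox_id.
have Px'' : psub (cbox id_mor predT U'') (fun z => le x'' (id_mor z)) by rewrite cbox_id.
apply: (@bcm_transfer_inv _ _ (res hx) (KO Ux) (GO dd Px) (KO Ux'') (GO dd Px'') _ _ _ _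
  (kmap U) (kmap U'') _ _ _ _ _ _ _ (bc hx Px Px'' (cbox_mono hU))).
- by move=> m a c; rewrite !kmapE; exact: kcmp_equiv.
- by move=> m a c; rewrite !kmapE; exact: kcmp_equiv.
- move=> m c; rewrite !kmapE -[LHS](@om_res _ _ _ kc).
  by congr (kc _ _ _); rewrite [LHS]tmapE.
- exact/flat_mflat/Xf.
- exact: kmap_qis.
- exact: kmap_qis.
Qed.

Lemma K_exact (V : pred X) n : is_open V -> exact_at (Gcx dd V) n -> exact_at (Kcx M V) n.
Proof.
move=> oV; rewrite -{1}[V]cbox_id // => Ge x x0.
have [ki _] := kmap_qis oV n; apply: ki => //; apply: Ge.
by rewrite -cmd x0 raddf0.
Qed.

End Resolution.

Lemma diag_tinl x x2 z (h1 : le x (id_mor z)) (h2 : @le (prod_space X X) (x, x2) (diag X z)) a :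
  comor id_mor z (res h1 a) =
  comor (diag X) z (res h2 (tinl (kmor x) (kmor x2) a)).
Proof.
rewrite [res h2 _](@proj1_res _ _ _ (x, x2) (z, z)) /= [RHS]copairE mulr1.
by rewrite (bool_irrelevance (prod_le1 h2) h1).
Qed.

Definition meet (x x2 : X) : pred X := fun z => le x z && le x2 z.

Lemma meet_open x x2 : is_open (meet x x2).
Proof.
by move=> z z' h /andP[h1 h2]; rewrite /meet (Defs.le_trans h1 h) (Defs.le_trans h2 h).
Qed.

(* Base change for the cohomology of the sets [U_x n U_x2], read on the
   Godement complex. *)
Definition godement_bc := forall x x'' x2 (hx : le x x'')
  (Ux : psub (meet x x2) (le x)) (Ux'' : psub (meet x'' x2) (le x''))
  (hU : psub (meet x'' x2) (meet x x2)),
  qis (bcm (@KO_semilin _ _ _ _ hx _ _ Ux Ux'' hU)).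

Definition godement_acyclic := forall x x2 n, exact_at (Kcx M (meet x x2)) n.+1.

(** The intersection of [U_x] and [U_x2] is the preimage of [U_(x, x2)] under the diagonal, so
    quasi-coherence gives base change along [(x, x2) <= (x'', x2)]. The pushout square [cocart_left]
    turns it into base change from [O_x] to [O_x''], and the Godement complex then replaces the
    injective resolution. *)
Lemma schematic_bc : schematic X -> godement_bc.
Proof.
move=> [_ sX] x x'' x2 hx Ux Ux'' hU n.
have [H [[E [e [d [Eres Hc]]]] qH]] := sX n.
apply: (K_base_change (Eres := Eres)); try exact: meet_open.
move=> hx' Px Px'' hP.
have h : @le (prod_space X X) (x, x2) (x'', x2).
  by rewrite /= /prod_le /= hx Defs.le_refl.
have fl : mflat (ralg (res h)).
  by apply: (cocart_flat (cocart_left hx h)); exact/flat_mflat/Xf.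
pose D (w : prod_space X X) : pred X := fun z => le w (diag X z).
pose hD : psub (D (x'', x2)) (D (x, x2)) := hP.
have q := (cohomology_bc (resolution_dd Eres) Hc hD fl).2 (qc_stalk_bc qH h).
have bc := @base_change_cocart _ _ _ id_mor (diag X) _ _ (resolution_dd Eres) _ _ hx' _ _ h
  _ _ (cocart_left hx' h) (@diag_tinl x x2) (@diag_tinl x'' x2) (D (x, x2)) (D (x'', x2)) hD
  Px Px'' (fun z h => h) (fun z h => h) n.
exact (bc.2 q).
Qed.

(** In degree 0 the derived functor is [delta_* O] itself, and in positive degrees a zero module is
    quasi-coherent. *)
Lemma semi_separated_schematic : semi_separated X -> schematic X.
Proof.
move=> [_ qO sX]; split=> // -[|n].
  have [E [e [d Eres]]] := injective_resolution_exists (structure_sheaf X).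
  exists (direct_image (diag X) (structure_sheaf X)); split=> //.
  exists E, e, d; split=> //; exact: (direct_image_cohomology0 (diag X) Eres).
have [H [hH H0]] := sX n.+1 isT; exists H; split=> //.
exact: zero_qc.
Qed.

Lemma semi_separated_acyclic : semi_separated X -> godement_acyclic.
Proof.
move=> [_ _ sX] x x2 n; have [H [[E [e [d [Eres Hc]]]] H0]] := sX n.+1 isT.
apply: (K_exact (Eres := Eres)); first exact: meet_open.
exact: ((cohomology_zero (resolution_dd Eres) Hc).1 H0 (x, x2)).
Qed.

End GodementOfSchematic.

(** * Products *)

Lemma mflat_flat (A B : comPzRingType) (f : {rmorphism A -> B}) :
  mflat (ralg f) -> flat f.
Proof.
move=> fl N N' u u_inj x y xy.
have i : injective (lmap (ralg f) (lin_equiv u)).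
  by apply: additive_inj => z; exact: fl.
have e := mkaddE (tliftD (tmap_balanced (@equiv_id _ _ (ralg f)) (lin_equiv u))).
by apply: i; apply: etrans (e x) (etrans xy (esym (e y))).
Qed.

Lemma mflat_ext (A : comPzRingType) (M : zmodType) (s s' : act A M) :
  (forall a m, s a m = s' a m) -> mflat s -> mflat s'.
Proof.
move=> ss fl N N' t t' u uE u_inj x x0.
have ssE : equiv s s' (idadd M) by move=> a m; exact: ss.
have ssE' : equiv s' s (idadd M) by move=> a m; exact/esym/ss.
have sq y : lmap s uE (rmap ssE' t y) = rmap ssE' t' (lmap s' uE y).
  by tens_elim y m n; rewrite !tmapE.
have h : rmap ssE' t x = 0 by apply: (fl _ _ _ _ _ uE u_inj); rewrite sq x0 raddf0.
have idK y : rmap ssE t (rmap ssE' t y) = y by tens_elim y m n; rewrite !tmapE.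
by rewrite -[x]idK h raddf0.
Qed.

(** A specialization is a composite of two, each moving one coordinate; along each of them the ring
    map is a pushout of a flat restriction map of [X] or [Y]. *)
Lemma finite_prod (k : comPzRingType) (X Y : overSpace k) :
  finite_space X -> finite_space Y -> finite_space (prod_space X Y).
Proof.
move=> Xf Yf [x y] [x'' y''] h; have /andP[/= hx hy] := h.
have h1 : @le (prod_space X Y) (x, y) (x'', y).
  by rewrite /= /prod_le /= hx Defs.le_refl.
have h2 : @le (prod_space X Y) (x'', y) (x'', y'').
  by rewrite /= /prod_le /= hy Defs.le_refl.
apply: mflat_flat; apply: (@mflat_ext _ _ (restr (res h1) (ralg (res h2)))) => [a m|].
  by rewrite /= (res_comp h1 h2 h).
have m1 : mflat (ralg (res h1)).
  exact (cocart_flat (cocart_left hx h1) (flat_mflat (Xf _ _ hx))).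
have m2 : mflat (ralg (res h2)).
  exact (cocart_flat (cocart_right hy h2) (flat_mflat (Yf _ _ hy))).
exact (mflat_trans m1 m2).
Qed.

Section OneStep.
Variables (k : comPzRingType) (W1 W2 : overSpace k) (Z W : ringedSpace).
Variables (p1 : ringedMor Z W1) (p2 : ringedMor Z W2) (Zp : is_product p1 p2).
Variables (pi : ringedMor Z W).
Variables (E : nat -> omodule Z) (d : forall n, omorphism (E n) (E n.+1)).
Variables (e : omorphism (structure_sheaf Z) (E 0)) (Eres : injective_resolution e d).
Notation dd := (resolution_dd Eres).
Hypotheses (W1f : finite_space W1) (W1bc : godement_bc W1).
Variables (v v'' v2 : W1) (hv : le v v'') (w w'' : W) (hw : le w w'').
Variables (g : {rmorphism stalk v -> stalk w}) (g'' : {rmorphism stalk v'' -> stalk w''}).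
Hypothesis sq : cocart (res hv) (res hw) g g''.
Hypothesis gE : forall z (h1 : le v (p1 z)) (h2 : le w (pi z)) a,
  comor p1 z (res h1 a) = comor pi z (res h2 (g a)).
Hypothesis gE'' : forall z (h1 : le v'' (p1 z)) (h2 : le w'' (pi z)) a,
  comor p1 z (res h1 a) = comor pi z (res h2 (g'' a)).

(** Base change over the stalks of [W1] holds for boxes; the pushout square carries it to the stalks
    of [W], here those of the square of the product space. *)
Lemma one_step (V : pred W2) n : is_open V ->
  (fun z => le w (pi z)) = box p1 p2 (meet v v2) V ->
  (fun z => le w'' (pi z)) = box p1 p2 (meet v'' v2) V ->
  base_change pi dd n w w'' (fun z => le w (pi z)) (fun z => le w'' (pi z)).
Proof.
move=> oV -> -> hw' Pw Pw'' hP; rewrite (bool_irrelevance hw' hw).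
have Uv : psub (meet v v2) (le v) by move=> u /andP[].
have Uv'' : psub (meet v'' v2) (le v'') by move=> u /andP[].
have hU : psub (meet v'' v2) (meet v v2).
  by move=> u /andP[h1 h2]; rewrite /meet (Defs.le_trans hv h1).
have bc := @box_base_change _ _ _ _ _ _ Zp _ _ _ Eres _ _ hv _ _ (@meet_open _ _ v v2)
  (@meet_open _ _ v'' v2) Uv Uv'' hU W1f (@W1bc _ _ _ hv Uv Uv'' hU) V n oV.
have Pv := @box_psub1 _ _ _ _ p1 p2 v (meet v v2) V Uv.
have Pv'' := @box_psub1 _ _ _ _ p1 p2 v'' (meet v'' v2) V Uv''.
have c := @base_change_cocart _ _ _ p1 pi _ _ dd _ _ hv _ _ hw _ _ sq gE gE'' _ _ hP
  Pv Pv'' Pw Pw'' n.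
exact (c.1 (bc hv Pv Pv'' hP)).
Qed.

End OneStep.

Lemma base_change_trans (Z W : ringedSpace) (pi : ringedMor Z W)
  (E : nat -> omodule Z) (d : forall n, omorphism (E n) (E n.+1))
  (dd : forall n (p : Z) m, d n.+1 p (d n p m) = 0) (w w' w'' : W) :
  finite_space W -> le w w' -> le w' w'' ->
  (forall n, base_change pi dd n w w' (fun z => le w (pi z)) (fun z => le w' (pi z))) ->
  (forall n, base_change pi dd n w' w'' (fun z => le w' (pi z)) (fun z => le w'' (pi z))) ->
  forall n, base_change pi dd n w w'' (fun z => le w (pi z)) (fun z => le w'' (pi z)).
Proof.
move=> Wf h h' b b' n hw Pw Pw'' hP.
pose P' : psub (fun z => le w' (pi z)) (fun z => le w' (pi z)) := fun z h => h.
have h1 : psub (fun z => le w' (pi z)) (fun z => le w (pi z)).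
  by move=> z; exact: Defs.le_trans.
have h2 : psub (fun z => le w'' (pi z)) (fun z => le w' (pi z)).
  by move=> z; exact: Defs.le_trans.
apply: (@bcm_composition _ _ _ (res h) (res h') (res hw) _ _ _ _ _ _ _
  (@GO_semilin _ _ pi _ _ dd _ _ h _ _ Pw P' h1)
  (@GO_semilin _ _ pi _ _ dd _ _ h' _ _ P' Pw'' h2)).
- by move=> a; rewrite (res_comp h h' hw).
- by move=> m s; exact/esym/(@ores_comp _ (Gopcx dd)).
- exact/flat_mflat/Wf.
- by move=> m; exact: b.
- by move=> m; exact: b'.
Qed.

(** * The diagonal of a product of two spaces *)

Section Diagonal.
Variables (k : comPzRingType) (X : overSpace k).

Lemma diag_resl x x2 z (h1 : le x z) (h2 : @le (prod_space X X) (x, x2) (diag X z)) a :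
  comor (diag X) z (res h2 (tinl (kmor x) (kmor x2) a)) = res h1 a.
Proof. exact/esym/(diag_tinl (h1 : le x (id_mor X z))). Qed.

Lemma diag_resr x x2 z (h1 : le x2 z) (h2 : @le (prod_space X X) (x, x2) (diag X z)) a :
  comor (diag X) z (res h2 (tinr (kmor x) (kmor x2) a)) = res h1 a.
Proof.
rewrite [res h2 _](@proj2_res _ _ _ (x, x2) (z, z)) /= [LHS]copairE mul1r.
by rewrite (bool_irrelevance (prod_le2 h2) h1).
Qed.

End Diagonal.

Section DiagonalOfProduct.
Variables (k : comPzRingType) (X Y : overSpace k).
Hypotheses (Xf : finite_space X) (Yf : finite_space Y).
Notation Z := (prod_space X Y).
Notation ZZ := (prod_space Z Z).
Variables (E : nat -> omodule Z) (d : forall n, omorphism (E n) (E n.+1)).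
Variables (e : omorphism (structure_sheaf Z) (E 0)) (Eres : injective_resolution e d).
Notation dd := (resolution_dd Eres).
Notation D w := (fun z : Z => @le ZZ w (diag Z z)).
Notation p1 := (proj1_mor X Y).
Notation p2 := (proj2_mor X Y).

Lemma diag_box (x1 x2 : X) (y1 y2 : Y) :
  D ((x1, y1), (x2, y2)) = box p1 p2 (meet x1 x2) (meet y1 y2).
Proof. by apply: funext => -[x y]; rewrite /box /meet /= andbACA. Qed.

Lemma diag_box_swap (x1 x2 : X) (y1 y2 : Y) :
  D ((x1, y1), (x2, y2)) = box p2 p1 (meet y1 y2) (meet x1 x2).
Proof. by rewrite diag_box; apply: funext => z; rewrite /box andbC. Qed.

Lemma meetC (T : overSpace k) (a b : T) : meet a b = meet b a.
Proof. by apply: funext => z; rewrite /meet andbC. Qed.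

Hypotheses (Xbc : godement_bc X) (Ybc : godement_bc Y).

(** The square of rings is pasted from two pushouts, from [X] to [X x Y] and from there to the first
    factor of the square of [X x Y]. The next three lemmas move the other coordinates. *)
Lemma step_x1 (x x'' x2 : X) (y y2 : Y) n : le x x'' ->
  base_change (diag Z) dd n ((x, y), (x2, y2)) ((x'', y), (x2, y2))
    (D ((x, y), (x2, y2))) (D ((x'', y), (x2, y2))).
Proof.
move=> hx.
have h : @le Z (x, y) (x'', y) by rewrite /= /prod_le /= hx Defs.le_refl.
have hh : @le ZZ ((x, y), (x2, y2)) ((x'', y), (x2, y2)).
  by apply/andP; split; [exact: h | exact: Defs.le_refl].
have gE u : forall z (h1 : le u (p1 z)) (h2 : @le ZZ ((u, y), (x2, y2)) (diag Z z)) a,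
  comor p1 z (res h1 a) = comor (diag Z) z (res h2
    ((tinl (@kmor k Z (u, y)) (@kmor k Z (x2, y2)) \o tinl (kmor u) (kmor y)) a)).
  move=> z h1 h2 a; have [h3 _] := andP h2.
  rewrite [RHS](diag_resl h3) [RHS](@proj1_res _ _ _ (u, y)).
  by rewrite (bool_irrelevance (prod_le1 h3) h1).
apply: (@one_step _ _ _ _ _ p1 p2 (prod_is_product X Y) (diag Z) _ _ _ Eres Xf Xbc
  x x'' x2 hx _ _ hh _ _ (cocart_paste (cocart_left hx h) (cocart_left h hh)) (gE x) (gE x'')
  (meet y y2)).
- exact: meet_open.
- exact: diag_box.
- exact: diag_box.
Qed.

Lemma step_y1 (x x2 : X) (y y'' y2 : Y) n : le y y'' ->
  base_change (diag Z) dd n ((x, y), (x2, y2)) ((x, y''), (x2, y2))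
    (D ((x, y), (x2, y2))) (D ((x, y''), (x2, y2))).
Proof.
move=> hy.
have h : @le Z (x, y) (x, y'') by rewrite /= /prod_le /= hy Defs.le_refl.
have hh : @le ZZ ((x, y), (x2, y2)) ((x, y''), (x2, y2)).
  by apply/andP; split; [exact: h | exact: Defs.le_refl].
have gE u : forall z (h1 : le u (p2 z)) (h2 : @le ZZ ((x, u), (x2, y2)) (diag Z z)) a,
  comor p2 z (res h1 a) = comor (diag Z) z (res h2
    ((tinl (@kmor k Z (x, u)) (@kmor k Z (x2, y2)) \o tinr (kmor x) (kmor u)) a)).
  move=> z h1 h2 a; have [h3 _] := andP h2.
  rewrite [RHS](diag_resl h3) [RHS](@proj2_res _ _ _ (x, u)).
  by rewrite (bool_irrelevance (prod_le2 h3) h1).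
apply: (@one_step _ _ _ _ _ p2 p1 (is_product_sym (prod_is_product X Y)) (diag Z) _ _ _ Eres
  Yf Ybc y y'' y2 hy _ _ hh _ _ (cocart_paste (cocart_right hy h) (cocart_left h hh))
  (gE y) (gE y'') (meet x x2)).
- exact: meet_open.
- exact: diag_box_swap.
- exact: diag_box_swap.
Qed.

Lemma step_x2 (x x'' x1 : X) (y y1 : Y) n : le x x'' ->
  base_change (diag Z) dd n ((x1, y1), (x, y)) ((x1, y1), (x'', y))
    (D ((x1, y1), (x, y))) (D ((x1, y1), (x'', y))).
Proof.
move=> hx.
have h : @le Z (x, y) (x'', y) by rewrite /= /prod_le /= hx Defs.le_refl.
have hh : @le ZZ ((x1, y1), (x, y)) ((x1, y1), (x'', y)).
  by apply/andP; split; [exact: Defs.le_refl | exact: h].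
have gE u : forall z (h1 : le u (p1 z)) (h2 : @le ZZ ((x1, y1), (u, y)) (diag Z z)) a,
  comor p1 z (res h1 a) = comor (diag Z) z (res h2
    ((tinr (@kmor k Z (x1, y1)) (@kmor k Z (u, y)) \o tinl (kmor u) (kmor y)) a)).
  move=> z h1 h2 a; have [_ h3] := andP h2.
  rewrite [RHS](diag_resr h3) [RHS](@proj1_res _ _ _ (u, y)).
  by rewrite (bool_irrelevance (prod_le1 h3) h1).
apply: (@one_step _ _ _ _ _ p1 p2 (prod_is_product X Y) (diag Z) _ _ _ Eres Xf Xbc
  x x'' x1 hx _ _ hh _ _ (cocart_paste (cocart_left hx h) (cocart_right h hh))
  (gE x) (gE x'') (meet y1 y)).
- exact: meet_open.
- by rewrite meetC; exact: diag_box.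
- by rewrite meetC; exact: diag_box.
Qed.

Lemma step_y2 (x x1 : X) (y y'' y1 : Y) n : le y y'' ->
  base_change (diag Z) dd n ((x1, y1), (x, y)) ((x1, y1), (x, y''))
    (D ((x1, y1), (x, y))) (D ((x1, y1), (x, y''))).
Proof.
move=> hy.
have h : @le Z (x, y) (x, y'') by rewrite /= /prod_le /= hy Defs.le_refl.
have hh : @le ZZ ((x1, y1), (x, y)) ((x1, y1), (x, y'')).
  by apply/andP; split; [exact: Defs.le_refl | exact: h].
have gE u : forall z (h1 : le u (p2 z)) (h2 : @le ZZ ((x1, y1), (x, u)) (diag Z z)) a,
  comor p2 z (res h1 a) = comor (diag Z) z (res h2
    ((tinr (@kmor k Z (x1, y1)) (@kmor k Z (x, u)) \o tinr (kmor x) (kmor u)) a)).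
  move=> z h1 h2 a; have [_ h3] := andP h2.
  rewrite [RHS](diag_resr h3) [RHS](@proj2_res _ _ _ (x, u)).
  by rewrite (bool_irrelevance (prod_le2 h3) h1).
apply: (@one_step _ _ _ _ _ p2 p1 (is_product_sym (prod_is_product X Y)) (diag Z) _ _ _ Eres
  Yf Ybc y y'' y1 hy _ _ hh _ _ (cocart_paste (cocart_right hy h) (cocart_right h hh))
  (gE y) (gE y'') (meet x1 x)).
- exact: meet_open.
- by rewrite meetC; exact: diag_box_swap.
- by rewrite meetC; exact: diag_box_swap.
Qed.

Lemma diag_base_change (w w'' : ZZ) n : le w w'' ->
  base_change (diag Z) dd n w w'' (D w) (D w'').
Proof.
case: w w'' => [[x1 y1] [x2 y2]] [[x1' y1'] [x2' y2']] /andP[/= h1 h2].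
have /andP[/= hx1 hy1] := h1; have /andP[/= hx2 hy2] := h2.
have Zf := finite_prod Xf Yf; have ZZf := finite_prod Zf Zf.
have l1 : @le ZZ ((x1, y1), (x2, y2)) ((x1', y1), (x2, y2)).
  by rewrite /= /prod_le /= /prod_le /= hx1 !Defs.le_refl.
have l2 : @le ZZ ((x1', y1), (x2, y2)) ((x1', y1'), (x2, y2)).
  by rewrite /= /prod_le /= /prod_le /= hy1 !Defs.le_refl.
have l3 : @le ZZ ((x1', y1'), (x2, y2)) ((x1', y1'), (x2', y2)).
  by rewrite /= /prod_le /= /prod_le /= hx2 !Defs.le_refl.
have l4 : @le ZZ ((x1', y1'), (x2', y2)) ((x1', y1'), (x2', y2')).
  by rewrite /= /prod_le /= /prod_le /= hy2 !Defs.le_refl.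
have b1 m := @step_x1 x1 x1' x2 y1 y2 m hx1.
have b2 m := @step_y1 x1' x2 y1 y1' y2 m hy1.
have b3 m := @step_x2 x2 x2' x1' y2 y1' m hx2.
have b4 m := @step_y2 x2' x1' y2 y2' y1' m hy2.
have c2 := base_change_trans ZZf l1 l2 b1 b2.
have c3 := base_change_trans ZZf (Defs.le_trans l1 l2) l3 c2 b3.
exact (base_change_trans ZZf (Defs.le_trans (Defs.le_trans l1 l2) l3) l4 c3 b4 n).
Qed.

Lemma diag_cohomology_qc n H :
  is_cohomology (fun m => direct_image_map (diag Z) (d m)) n H -> quasi_coherent H.
Proof.
move=> Hc; apply: stalk_bc_qc => w w'' h.
have hD : psub (D w'') (D w) by move=> z; exact: Defs.le_trans.
have Zf := finite_prod Xf Yf; have ZZf := finite_prod Zf Zf.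
exact ((cohomology_bc dd Hc hD (flat_mflat (ZZf _ _ h))).1
  (diag_base_change n h h (fun z h => h) (fun z h => h) hD)).
Qed.

(** The preimage of a minimal open set under the diagonal is a box on two intersections of minimal
    open sets, both acyclic by hypothesis. *)
Lemma diag_cohomology_zero n H : godement_acyclic X -> godement_acyclic Y ->
  is_cohomology (fun m => direct_image_map (diag Z) (d m)) n.+1 H -> is_zero H.
Proof.
move=> Xa Ya Hc; apply/(cohomology_zero dd Hc) => -[[x1 y1] [x2 y2]].
rewrite diag_box.
have Ux : psub (meet x1 x2) (le x1) by move=> u /andP[].
have Vy : psub (meet y1 y2) (le y1) by move=> u /andP[].
have h := box_exact (prod_is_product X Y) (Eres := Eres) (@meet_open _ _ x1 x2) Ux Xf (Xa x1 x2)
  (@meet_open _ _ y1 y2) Vy Yf (Ya y1 y2).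
exact (h n).
Qed.

End DiagonalOfProduct.

Theorem proposition4p8 (k : comPzRingType) (X Y : overSpace k)
  (hX : finite_space X) (hY : finite_space Y) :
  (schematic X -> schematic Y -> schematic (prod_space X Y)) /\
  (semi_separated X -> semi_separated Y -> semi_separated (prod_space X Y)).
Proof.
have [E [e [d Eres]]] := injective_resolution_exists (structure_sheaf (prod_space X Y)).
have ex n := cohomology_exists (fun m => direct_image_map (diag (prod_space X Y)) (d m)) n.
have qc Xs Ys := @diag_cohomology_qc _ X Y hX hY E d e Eres (schematic_bc hX Xs) (schematic_bc hY Ys).
split=> [Xs Ys|Xs Ys]; split; first exact: finite_prod.
- move=> n; have [H Hc] := ex n; exists H; split; last exact: (qc Xs Ys n).
  by exists E, e, d.
- exact: finite_prod.
  (* Degree 0 is an instance of the schematic case: [delta_* O] is the 0-th cohomology of the direct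
     image of [E]. *)
  apply: (qc (semi_separated_schematic hX Xs) (semi_separated_schematic hY Ys) 0%N).
  exact: (direct_image_cohomology0 (diag (prod_space X Y)) Eres).
- move=> [//|n] _; have [H Hc] := ex n.+1; exists H; split; first by exists E, e, d.
  have h := diag_cohomology_zero hX hY Eres (semi_separated_acyclic Xs)
    (semi_separated_acyclic Ys) Hc.
  exact h.
Qed.
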